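(* Let $F$ be the free group on $\{x_1,\ldots,x_d\}$, let $\mathbb F_q$ be the finite field with $q$ elements, and let $L$ be a finitely presented right $\mathbb F_q[F]$-module. Then, for all sufficiently large $n$, the function $\Lambda_L(n)$ is a rational function of $q^n$. Moreover, the set $A(L)$ is finite and $$\Lambda_L(n)=q^{\chi(L)n}+\sum_{N\in A(L)}q^{\chi(L/N)n}\bigl(1+O(q^{-n})\bigr)\qquad (n\to\infty).$$
   Context: A homomorphism $\phi\colon F\to \mathrm{GL}_n(q)=\mathrm{GL}_n(\mathbb F_q)$ induces the structure of a right $\mathbb F_q[F]$-module on $\mathbb F_q^n$, denoted $(\mathbb F_q^n)_\phi$. For a finitely generated right $\mathbb F_q[F]$-module $L$ define $$\Lambda_L(n)=\frac{1}{|\mathrm{GL}_n(q)|^d}\sum_{\phi\colon F\to\mathrm{GL}_n(q)}\left|\mathrm{Hom}_{\mathbb F_q[F]}\bigl(L,(\mathbb F_q^n)_\phi\bigr)\right|,$$ the sum being over all group homomorphisms $\phi$. A right $\mathbb F_q[F]$-module is called algebraic if it has no nontrivial (i.e. nonzero) free direct summand; equivalently, it does not admit a surjection onto a nontrivial free module. For a right $\mathbb F_q[F]$-module $L$, $A(L)$ denotes the set of its nontrivial (nonzero) algebraic submodules. If $L$ is finitely presented, then $L\cong \mathbb F_q[F]^r/U$ with $U\cong \mathbb F_q[F]^s$ free of finite rank (submodules of free $\mathbb F_q[F]$-modules are free), and the Euler characteristic is $\chi(L)=r-s$; this is independent of the chosen presentation. *)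

(* Defs.v *)
From HB Require Import structures.
From mathcomp Require Import all_boot all_order all_fingroup all_algebra.
From mathcomp Require Import boolp classical_sets cardinality fsbigop.
From mathcomp Require Import finmap generic_quotient.
From mathcomp Require Import monalg.

Set Implicit Arguments.
Unset Strict Implicit.
Unset Printing Implicit Defensive.

Import GRing.Theory.

(* The free group on [d] generators, realised as the group of reduced words:
   the letter (i, true) stands for x_i and (i, false) for its inverse. *)
Section FreeGroup.
Context {d : nat}.

Definition letter : Type := ('I_d * bool)%type.
Implicit Types (a b : letter) (u v w : seq letter).

Definition linv a : letter := (a.1, ~~ a.2).

Definition reduced w := sorted (fun a b => b != linv a) w.

(* Left multiplication of a reduced word by one letter. *)
Definition lmul a w :=
  if w is b :: w' then if b == linv a then w' else a :: w else [:: a].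

Definition wmul u v := foldr lmul v u.

Definition winv u := rev (map linv u).

Lemma linvK : involutive linv.
Proof. by case=> i b; rewrite /linv /= negbK. Qed.

Lemma lmul_reduced a w : reduced w -> reduced (lmul a w).
Proof.
case: w => [|b w] //= rw; case: ifPn => [_|ne]; first exact: path_sorted rw.
by rewrite /reduced /= ne.
Qed.

Lemma wmul_reduced u v : reduced v -> reduced (wmul u v).
Proof. by move=> rv; elim: u => //= a u; apply: lmul_reduced. Qed.

Lemma winv_reduced u : reduced u -> reduced (winv u).
Proof.
rewrite /reduced /winv rev_sorted sorted_map; apply: sub_sorted => a b /=.
by rewrite linvK eq_sym; apply: contra => /eqP->.
Qed.

Lemma lmulK a w : reduced w -> lmul a (lmul (linv a) w) = w.
Proof.
case: w => [|b w] /=; first by rewrite eqxx.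
rewrite linvK; case: eqVneq => [->|_ _] /=; last by rewrite eqxx.
by case: w => [|c w] //=; rewrite /reduced /= => /andP[/negbTE->].
Qed.

Lemma wmul_lmul a u v : reduced v -> wmul (lmul a u) v = lmul a (wmul u v).
Proof.
move=> rv; case: u => [|b u] //=; case: eqP => [->|] //=.
by rewrite lmulK // wmul_reduced.
Qed.

Lemma wmulA u v w : reduced w -> wmul u (wmul v w) = wmul (wmul u v) w.
Proof. by move=> rw; elim: u => //= a u ->; rewrite wmul_lmul. Qed.

Lemma wmulw1 u : reduced u -> wmul u [::] = u.
Proof.
elim: u => //= a u IH; rewrite /reduced /= => pu.
rewrite IH; last exact: path_sorted pu.
by case: u pu {IH} => [|b u] //= /andP[/negbTE->].
Qed.

Lemma wmulVw u : wmul (winv u) u = [::].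
Proof.
elim: u => // a u IH; rewrite /winv /= rev_cons /wmul foldr_rcons /=.
by rewrite linvK eqxx.
Qed.

Lemma winvK : involutive winv.
Proof. by move=> u; rewrite /winv map_rev revK (mapK linvK). Qed.

Lemma wmulwV u : wmul u (winv u) = [::].
Proof. by have := wmulVw (winv u); rewrite winvK. Qed.

End FreeGroup.

Record free_group (d : nat) :=
  FreeGroup { fg_word : seq (@letter d); _ : reduced fg_word }.

HB.instance Definition _ d := [isSub for @fg_word d].
HB.instance Definition _ d := [Choice of free_group d by <:].

Section FreeGroupGroup.
Context {d : nat}.
Implicit Types u v w : free_group d.

Definition fg_one : free_group d := @FreeGroup d [::] isT.
Definition fg_mul u v := FreeGroup (wmul_reduced (fg_word u) (valP v)).
Definition fg_inv u := FreeGroup (winv_reduced (valP u)).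

Lemma fg_mulA : associative fg_mul.
Proof. by move=> u v w; apply: val_inj; apply: wmulA (valP w). Qed.

Lemma fg_mul1g : left_id fg_one fg_mul.
Proof. by move=> u; apply: val_inj. Qed.

Lemma fg_mulg1 : right_id fg_one fg_mul.
Proof. by move=> u; apply: val_inj; apply: wmulw1 (valP u). Qed.

Lemma fg_mulVg : left_inverse fg_one fg_inv fg_mul.
Proof. by move=> u; apply: val_inj; apply: wmulVw. Qed.

Lemma fg_mulgV : right_inverse fg_one fg_inv fg_mul.
Proof. by move=> u; apply: val_inj; apply: wmulwV. Qed.

HB.instance Definition _ := isGroup.Build (free_group d)
  fg_mulA fg_mul1g fg_mulg1 fg_mulVg fg_mulgV.

Definition fgen (i : 'I_d) : free_group d := @FreeGroup d [:: (i, true)] isT.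

End FreeGroupGroup.

Section FreeGroupUniversal.
Context {d : nat} {H : groupType}.
Variable h : 'I_d -> H.
Local Open Scope group_scope.

Definition leval (a : @letter d) : H := if a.2 then h a.1 else (h a.1)^-1.
Definition weval (w : seq (@letter d)) : H := foldr (fun a x => leval a * x) 1 w.
Definition fg_lift (u : free_group d) : H := weval (fg_word u).

Lemma leval_linv a : leval (linv a) = (leval a)^-1.
Proof. by case: a => i [] //=; rewrite /leval /= invgK. Qed.

Lemma fg_liftM : {morph fg_lift : u v / u * v}.
Proof.
move=> u v; rewrite /fg_lift /=; elim: (fg_word u) => /= [|a w IH].
  by rewrite mul1g.
rewrite -mulgA -IH; case: (wmul _ _) => [|b w'] //=.
by case: eqP => [->|] //=; rewrite leval_linv mulKVg.
Qed.

Lemma fg_lift_gen i : fg_lift (fgen i) = h i.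
Proof. by rewrite /fg_lift /= mulg1. Qed.

Lemma fg_lift_unique (f : free_group d -> H) :
  {morph f : u v / u * v} -> (forall i, f (fgen i) = h i) -> f =1 fg_lift.
Proof.
move=> fM fgenE; have f1 : f 1 = 1.
  by apply: (mulgI (f 1)); rewrite -fM !mulg1.
have fV u : f u^-1 = (f u)^-1.
  by apply: (mulgI (f u)); rewrite -fM !mulgV.
case=> w rw; rewrite /fg_lift /=; elim: w rw => [|a w IH] raw.
  by rewrite -[RHS]f1; congr f; apply: val_inj.
have rw : reduced w by exact: path_sorted raw.
have ra : reduced [:: a] by [].
have -> : FreeGroup raw = FreeGroup ra * FreeGroup rw.
  apply: val_inj => /=; case: w raw {IH rw} => [|b w] //=.
  by rewrite /reduced /= => /andP[/negbTE->].
rewrite fM IH /=; congr (_ * _); case: a {raw} ra => i [] ra.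
  by rewrite -[RHS]fgenE; congr f; apply: val_inj.
rewrite /leval /= -fgenE -fV; congr f; exact: val_inj.
Qed.

End FreeGroupUniversal.

Local Open Scope ring_scope.

(* The group algebra k[G]: finitely supported functions G -> k under
   convolution.  It needs its own alias because [monalg] only puts a ring
   structure on {malg k[G]} when no element of G but 1 is invertible. *)
Definition group_alg (k : nzRingType) (G : groupType) : Type := {malg k[G]}.

Section GroupAlgebra.
Context {k : nzRingType} {G : groupType}.
Implicit Types f g : {malg k[G]}.
Local Open Scope fset_scope.

HB.instance Definition _ := GRing.Lmodule.copy (group_alg k G) {malg k[G]}.

Definition ga_one : {malg k[G]} := << 1%g >>.

Definition ga_mul f g : {malg k[G]} :=
  \sum_(x <- msupp f) \sum_(y <- msupp g) << f@_x * g@_y *g (x * y)%g >>.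

Lemma ga_mulw (d1 d2 : {fset G}) f g : msupp f `<=` d1 -> msupp g `<=` d2 ->
  ga_mul f g =
    \sum_(x <- d1) \sum_(y <- d2) << f@_x * g@_y *g (x * y)%g >>.
Proof.
move=> le1 le2; rewrite /ga_mul (big_fset_incl _ le1) /=.
  apply/eq_bigr => x _; apply/big_fset_incl => // y _ /mcoeff_outdom ->.
  by rewrite mulr0 monalgU0.
move=> x _ /mcoeff_outdom fx.
by rewrite big1 // => y _; rewrite fx mul0r monalgU0.
Qed.

Lemma ga_mulUU (a b : k) (x y : G) :
  ga_mul << a *g x >> << b *g y >> = << a * b *g (x * y)%g >>.
Proof. by rewrite (ga_mulw msuppU_le msuppU_le) !big_seq_fset1 !mcoeffUU. Qed.

Lemma ga_mulDl : left_distributive ga_mul +%R.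
Proof.
move=> f1 f2 g; have le := fsubset_refl (msupp g).
rewrite (ga_mulw (msuppD_le f1 f2) le) (ga_mulw (fsubsetUl _ (msupp f2)) le).
rewrite (ga_mulw (fsubsetUr (msupp f1) _) le) -big_split /=.
apply/eq_bigr => x _; rewrite -big_split /=; apply/eq_bigr => y _.
by rewrite mcoeffD mulrDl monalgUD.
Qed.

Lemma ga_mulDr : right_distributive ga_mul +%R.
Proof.
move=> g f1 f2; have le := fsubset_refl (msupp g).
rewrite (ga_mulw le (msuppD_le f1 f2)) (ga_mulw le (fsubsetUl _ (msupp f2))).
rewrite (ga_mulw le (fsubsetUr (msupp f1) _)) -big_split /=.
apply/eq_bigr => x _; rewrite -big_split /=; apply/eq_bigr => y _.
by rewrite mcoeffD mulrDr monalgUD.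
Qed.

Lemma ga_mul0l g : ga_mul 0 g = 0.
Proof. by rewrite /ga_mul msupp0 big_seq_fset0. Qed.

Lemma ga_mul0r f : ga_mul f 0 = 0.
Proof. by rewrite /ga_mul big1 // => x _; rewrite msupp0 big_seq_fset0. Qed.

Lemma ga_mul_suml (I : Type) (r : seq I) (E : I -> {malg k[G]}) g :
  ga_mul (\sum_(i <- r) E i) g = \sum_(i <- r) ga_mul (E i) g.
Proof.
exact: (big_morph (ga_mul^~ g) (fun x y => ga_mulDl x y g) (ga_mul0l g)).
Qed.

Lemma ga_mul_sumr (I : Type) (r : seq I) (E : I -> {malg k[G]}) f :
  ga_mul f (\sum_(i <- r) E i) = \sum_(i <- r) ga_mul f (E i).
Proof.
exact: (big_morph (ga_mul f) (fun x y => ga_mulDr f x y) (ga_mul0r f)).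
Qed.

Lemma ga_mulA : associative ga_mul.
Proof.
move=> f g h; rewrite (monalgE f) !ga_mul_suml; apply/eq_bigr => x _.
rewrite (monalgE g) !(ga_mul_suml, ga_mul_sumr); apply/eq_bigr => y _.
rewrite (monalgE h) !ga_mul_sumr; apply/eq_bigr => z _.
by rewrite !ga_mulUU mulrA mulgA.
Qed.

Lemma ga_mul1g : left_id ga_one ga_mul.
Proof.
move=> g; rewrite [in LHS](monalgE g) ga_mul_sumr [RHS](monalgE g).
by apply/eq_bigr => x _; rewrite ga_mulUU mul1r mul1g.
Qed.

Lemma ga_mulg1 : right_id ga_one ga_mul.
Proof.
move=> g; rewrite [in LHS](monalgE g) ga_mul_suml [RHS](monalgE g).
by apply/eq_bigr => x _; rewrite ga_mulUU mulr1 mulg1.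
Qed.

Lemma ga_one_neq0 : ga_one != 0.
Proof. by rewrite monalgU_eq0 oner_eq0. Qed.

HB.instance Definition _ := GRing.Zmodule_isNzRing.Build (group_alg k G)
  ga_mulA ga_mul1g ga_mulg1 ga_mulDl ga_mulDr ga_one_neq0.

End GroupAlgebra.

(* Submodules of [M] are the elements of [submodClosed M]. *)
Section Submodules.
Context {R : nzRingType} {M : lmodType R}.
Implicit Types N P Q : submodClosed M.
Local Open Scope classical_set_scope.

HB.instance Definition _ := gen_eqMixin (submodClosed M).
HB.instance Definition _ := gen_choiceMixin (submodClosed M).

(* A submodule is counted once: it is determined by its elements. *)
Lemma submod_ext N P : N =i P -> N = P.
Proof.
case: N P => [N cN] [P cP] /= eNP.
have eq : N = P by apply: funext => x; exact: eNP x.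
case: P / eq in cP eNP *; congr GRing.SubmodClosed.Pack.
case: cN cP => [[a] [b]] [[a'] [b']].
by rewrite (Prop_irrelevance a a') (Prop_irrelevance b b').
Qed.

Definition submod_zmod N : {pred M} := N.

Fact submod_zmod_closed N : zmod_closed (submod_zmod N).
Proof. exact: GRing.submod_closedB (submodClosedP N). Qed.

HB.instance Definition _ N :=
  GRing.isZmodClosed.Build M (submod_zmod N) (submod_zmod_closed N).

Definition is_basis (P : submodClosed M) (B : set M) :=
  [/\ forall b, B b -> b \in P,
      forall x, x \in P -> exists (s : seq M) (c : M -> R),
        (forall b, b \in s -> B b) /\ x = \sum_(b <- s) c b *: b
    & forall (s : seq M) (c : M -> R), uniq s -> (forall b, b \in s -> B b) ->
        \sum_(b <- s) c b *: b = 0 -> forall b, b \in s -> c b = 0].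

Definition is_free P := exists B, is_basis P B.

Definition is_zero P := forall x, x \in P -> x = 0.

Definition is_direct_sum N P Q :=
  [/\ {subset P <= N}, {subset Q <= N},
      forall x, x \in N -> exists2 y, y \in P & exists2 z, z \in Q & x = y + z
    & forall x, x \in P -> x \in Q -> x = 0].

Definition algebraic N :=
  forall P Q, is_direct_sum N P Q -> is_free P -> is_zero P.

End Submodules.

Definition nonzero_algebraic {R : nzRingType} (M : lmodType R) :
  set (submodClosed M) := [set N | ~ is_zero N /\ algebraic N]%classic.
Arguments nonzero_algebraic {R} M _.

(* The library quotient of additive groups, made a module. *)
Definition quotmod {R : nzRingType} {M : lmodType R} (N : submodClosed M) :=
  Quotient.quot (submod_zmod N).

Section QuotientModule.
Context {R : nzRingType} {M : lmodType R} (N : submodClosed M).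
Local Open Scope quotient_scope.

HB.instance Definition _ := GRing.Zmodule.on (quotmod N).

Definition quotmod_pi (x : M) : quotmod N := \pi_(Quotient.quot (submod_zmod N)) x.

Definition quotmod_scale (a : R) (x : quotmod N) : quotmod N :=
  quotmod_pi (a *: repr x).

Lemma quotmod_piE x y : (quotmod_pi x = quotmod_pi y) <-> (x - y \in N).
Proof.
have -> : (x - y \in N) = (x - y \in submod_zmod N) by [].
rewrite Quotient.idealrBE; exact: (rwP eqP).
Qed.

Lemma quotmod_repr x : quotmod_pi (repr x) = x.
Proof. exact: reprK. Qed.

Lemma quotmod_piD x y : quotmod_pi (x + y) = quotmod_pi x + quotmod_pi y.
Proof. by rewrite /quotmod_pi !piE. Qed.

Lemma quotmod_piZ a x : quotmod_pi (a *: x) = quotmod_scale a (quotmod_pi x).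
Proof.
apply/quotmod_piE; rewrite -scalerBr rpredZ //.
by apply/quotmod_piE; rewrite quotmod_repr.
Qed.

Lemma quotmod_scaleA a b x :
  quotmod_scale a (quotmod_scale b x) = quotmod_scale (a * b) x.
Proof. by rewrite -[x]quotmod_repr -!quotmod_piZ scalerA. Qed.

Lemma quotmod_scale1 : left_id 1 quotmod_scale.
Proof. by move=> x; rewrite -[x]quotmod_repr -quotmod_piZ scale1r. Qed.

Lemma quotmod_scaleDr : right_distributive quotmod_scale +%R.
Proof.
move=> a x y; rewrite -[x]quotmod_repr -[y]quotmod_repr.
by rewrite -quotmod_piD -!quotmod_piZ scalerDr quotmod_piD.
Qed.

Lemma quotmod_scaleDl x : {morph quotmod_scale^~ x : a b / a + b}.
Proof.
by move=> a b; rewrite -[x]quotmod_repr -!quotmod_piZ scalerDl quotmod_piD.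
Qed.

HB.instance Definition _ := GRing.Zmodule_isLmodule.Build R (quotmod N)
  quotmod_scaleA quotmod_scale1 quotmod_scaleDr quotmod_scaleDl.

End QuotientModule.

Section Presentations.
Context {R : nzRingType}.

(* M is the cokernel of f : R^s -> R^r, via p : R^r -> M. *)
Definition presents (M : lmodType R) (r s : nat)
    (f : {linear 'rV[R]_s -> 'rV[R]_r}) (p : {linear 'rV[R]_r -> M}) :=
  (forall m, exists x, p x = m) /\ (forall x, p x = 0 <-> exists y, f y = x).

Definition fin_presented (M : lmodType R) :=
  exists r s (f : {linear 'rV[R]_s -> 'rV[R]_r})
         (p : {linear 'rV[R]_r -> M}), presents f p.

Definition has_euler_char (M : lmodType R) (c : int) :=
  exists r s (f : {linear 'rV[R]_s -> 'rV[R]_r})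
         (p : {linear 'rV[R]_r -> M}),
    [/\ presents f p, injective f & c = r%:Z - s%:Z].

(* The value r - s for some such presentation; 0 when there is none. *)
Definition euler_char (M : lmodType R) : int := xget 0 (@has_euler_char M).

End Presentations.

(* A right A-module is a left module over the converse ring A^c, in which
   a *: v stands for v a. *)
Notation right_module A := (lmodType A^c).

(* The right module (k^n)_phi.  As in [{'GL_n[k]}], the dimension is n.-1.+1,
   which is n for every positive n. *)
Definition gl_module {k : finFieldType} {G : groupType} {n : nat}
  (phi : {multiplicative G -> {'GL_n[k]}}) : Type := 'rV[k]_n.-1.+1.

Section GLModule.
Context {k : finFieldType} {G : groupType} {n : nat}.
Variable phi : {multiplicative G -> {'GL_n[k]}}.
Local Open Scope fset_scope.

HB.instance Definition _ := GRing.Zmodule.copy (gl_module phi) 'rV[k]_n.-1.+1.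

Definition gl_scale (a : {malg k[G]}) (v : 'rV[k]_n.-1.+1) : 'rV[k]_n.-1.+1 :=
  \sum_(g <- msupp a) a@_g *: (v *m GLval (phi g)).

Lemma gl_scalew (d : {fset G}) (a : {malg k[G]}) v : msupp a `<=` d ->
  gl_scale a v = \sum_(g <- d) a@_g *: (v *m GLval (phi g)).
Proof.
move=> le; rewrite /gl_scale (big_fset_incl _ le) // => g _ /mcoeff_outdom->.
by rewrite scale0r.
Qed.

Lemma gl_scaleU c g v :
  gl_scale << c *g g >> v = c *: (v *m GLval (phi g)).
Proof. by rewrite (gl_scalew _ msuppU_le) big_seq_fset1 mcoeffUU. Qed.

Lemma gl_scaleDl v : {morph gl_scale^~ v : a b / (a + b)%R}.
Proof.
move=> a b; rewrite (gl_scalew v (msuppD_le a b)).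
rewrite (gl_scalew v (fsubsetUl _ (msupp b))).
rewrite (gl_scalew v (fsubsetUr (msupp a) _)) -big_split /=.
by apply/eq_bigr => g _; rewrite mcoeffD scalerDl.
Qed.

Lemma gl_scaleDr : right_distributive gl_scale +%R.
Proof.
move=> a v w; rewrite /gl_scale -big_split /=.
by apply/eq_bigr => g _; rewrite mulmxDl scalerDr.
Qed.

Lemma gl_scale0l v : gl_scale 0 v = 0.
Proof. by rewrite /gl_scale msupp0 big_seq_fset0. Qed.

Lemma gl_scale_suml (I : Type) (r : seq I) (E : I -> {malg k[G]}) v :
  gl_scale (\sum_(i <- r) E i) v = \sum_(i <- r) gl_scale (E i) v.
Proof.
exact: (big_morph (gl_scale^~ v) (gl_scaleDl v) (gl_scale0l v)).
Qed.

Lemma gl_scale_sumr (I : Type) (r : seq I) a (E : I -> 'rV[k]_n.-1.+1) :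
  gl_scale a (\sum_(i <- r) E i) = \sum_(i <- r) gl_scale a (E i).
Proof.
apply: (big_morph (gl_scale a) (gl_scaleDr a)).
by apply: (addrI (gl_scale a 0)); rewrite -gl_scaleDr !addr0.
Qed.

Lemma gl_phi1 : GLval (phi 1%g) = 1%:M.
Proof.
have -> : phi 1%g = 1%g by apply: (mulgI (phi 1%g)); rewrite -gmulfM !mulg1.
by rewrite GL_1E.
Qed.

Lemma gl_scaleA a b v : gl_scale a (gl_scale b v) = gl_scale (ga_mul b a) v.
Proof.
rewrite (monalgE a) (monalgE b).
rewrite ga_mul_suml [RHS]gl_scale_suml [in LHS]gl_scale_suml.
under eq_bigr do rewrite gl_scale_suml gl_scale_sumr.
rewrite exchange_big; apply/eq_bigr => h _.
rewrite ga_mul_sumr gl_scale_suml; apply/eq_bigr => g _.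
rewrite ga_mulUU !gl_scaleU gmulfM GL_ME -scalemxAl scalerA mulmxA.
by rewrite [_ * b@_h]mulrC.
Qed.

Lemma gl_scale1 : left_id ga_one gl_scale.
Proof.
by move=> v; rewrite gl_scaleU gl_phi1 mulmx1 scale1r.
Qed.

HB.instance Definition _ :=
  GRing.Zmodule_isLmodule.Build (group_alg k G)^c (gl_module phi)
    gl_scaleA gl_scale1 gl_scaleDr gl_scaleDl.

End GLModule.

(* Group homomorphisms as an index type for the sum defining Lambda. *)
Section GroupHomType.
Context {G H : groupType}.

HB.instance Definition _ := gen_eqMixin {multiplicative G -> H}.
HB.instance Definition _ := gen_choiceMixin {multiplicative G -> H}.

Lemma ghom_ext (f g : {multiplicative G -> H}) : f =1 g -> f = g.
Proof.
case: f g => [f cf] [g cg] /= efg.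
have eq : f = g by apply: funext.
case: g / eq in cg efg *; congr monoid.Multiplicative.Pack.
by case: cf cg => [[a]] [[b]]; rewrite (Prop_irrelevance a b).
Qed.

End GroupHomType.

(* The number of module homomorphisms; used on finite Hom-sets only. *)
Definition card_Hom {R : nzRingType} (M V : lmodType R) : nat :=
  #|` fset_set [set f : M -> V | linear f]%classic |.

Section Lambda.
Context {d : nat} {k : finFieldType}.
Variable L : right_module (group_alg k (free_group d)).

Definition Lambda (n : nat) : rat :=
  (\sum_(phi \in [set: {multiplicative free_group d -> {'GL_n[k]}}]%classic)
     ((card_Hom L (gl_module phi))%:R : rat)) / #|'GL_n[k]%g|%:R ^+ d.

End Lambda.

(* Main.v *)
(** A finitely presented [L] has a window: a finite-dimensional subspace [W]
    generating it, such that every linear map defined on [W] and respecting the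
    letters there extends to a homomorphism on [L].  In coordinates on [W] the
    homomorphisms from [L] to [(k^n)_phi] solve linear equations indexed by the
    generators, so their number is [q^(chi(L) n)] times the number of solutions
    of the transposed equations, up to a fixed dimension count.  Averaging over
    [phi] and sorting these solutions by their row space [S] yields
      [Lambda_L(n) = q^(chi(L) n) * \sum_S F_(rk S) / \prod_i F_(rk S_i)],
    where [F_r = (q^n - 1) ... (q^n - q^(r-1))], [S_i] is the [i]-th component
    of [S], and [S] runs over the finitely many subspaces of [W^(2d)] satisfying
    a compatibility condition.
    This is rational in [q^n], and [S = 0] contributes [q^(chi(L) n)].
    Each such [S] generates an algebraic submodule [N], every nonzero algebraic
    [N] arises in this way, and among the [S] giving [N] exactly one attains the
    largest exponent, which is [chi(L/N) - chi(L)]. *)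

Require Import Defs.
From HB Require Import structures.
From mathcomp Require Import all_boot all_order all_fingroup all_algebra.
From mathcomp Require Import boolp classical_sets cardinality fsbigop.
From mathcomp Require Import finmap generic_quotient monalg zify.

Set Implicit Arguments.
Unset Strict Implicit.
Unset Printing Implicit Defensive.

Import Order.TTheory GRing.Theory Num.Theory.
Local Open Scope ring_scope.
Local Open Scope classical_set_scope.

(** Finiteness rests on free growth outside a window: when a window is enlarged by [act b y], a new
    vector can stay inside the enlargement only under [linv b] ([free_step]). Hence a full subspace,
    whose vectors are spanned by those moved within it by a letter other than a prescribed one,
    cannot leave the window, and the trace of a submodule on the window is a window for that
    submodule. Windows are tested only on finite-dimensional modules: that is what counting over a
    finite field can verify, and the chain argument recovers extension into every module. The
    equations are transposed because each generator then enters only through [gam i *m t i = s i].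
    Matrices with a given row space of rank r form one orbit under GL_n, of size F_r, so averaging
    over phi produces reciprocals of orbit sizes. The invariant behind the exponents is [defect]:
    the dimension of a window of N minus those of the domains of the generators, equal to chi(L) -
    chi(L/N). Shrinking a window preserves it, and on the full window of N it is strictly smaller
    than on any other full system generating N. *)

(* A right [k[F]]-module as a vector space with an action of the letters:
   [fs_act c v] is [v c]. *)
Record fspace (k : fieldType) (d : nat) := FSpace {
  fs_car :> lmodType k;
  fs_act : @letter d -> {linear fs_car -> fs_car};
  fs_actK : forall c v, fs_act (linv c) (fs_act c v) = v }.

Notation act := (@fs_act _ _ _).

(** * Subspaces, generated submodules and partial homomorphisms *)

Section Windows.
Context {k : fieldType} {d : nat}.
Implicit Types (V X : fspace k d) (b c : @letter d).

Lemma actK V c : cancel (act c : V -> V) (act (linv c)).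
Proof. exact: fs_actK. Qed.

Lemma actVK V c : cancel (act (linv c) : V -> V) (act c).
Proof. by move=> v; have := actK (linv c) v; rewrite linvK. Qed.

Lemma linv_neq b : linv b != b.
Proof. by case: b => i [] /=; rewrite /linv xpair_eqE eqxx. Qed.

Definition subspace V (Z : set V) :=
  Z 0 /\ forall a x y, Z x -> Z y -> Z (a *: x + y).

Definition stable V (Z : set V) :=
  subspace Z /\ forall c x, Z x -> Z (act c x).

Definition cl V (Z : set V) : set V :=
  [set x | forall N, stable N -> Z `<=` N -> N x].

Definition addl V (Z : set V) (v : V) : set V := [set x | exists a, Z (x - a *: v)].

Definition linon V X (Z : set V) (h : V -> X) :=
  forall a x y, Z x -> Z y -> h (a *: x + y) = a *: h x + h y.

(** A partial homomorphism: [Z] is usually a finite-dimensional subspace and not a submodule, so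
    equivariance is asked only where the letter does not leave [Z]. *)
Definition hom V X (Z : set V) (h : V -> X) :=
  linon Z h /\ forall c x, Z x -> Z (act c x) -> h (act c x) = act c (h x).

Definition extends_to V X (N Z : set V) :=
  forall h : V -> X, hom Z h ->
    exists2 H : V -> X, hom N H & forall x, Z x -> H x = h x.

Section Basics.
Context {V : fspace k d}.
Implicit Types Z N : set V.

Lemma subspace0 Z : subspace Z -> Z 0. Proof. by case. Qed.

Lemma subspaceD Z x y : subspace Z -> Z x -> Z y -> Z (x + y).
Proof. by case=> _ h zx zy; have := h 1 x y zx zy; rewrite scale1r. Qed.

Lemma subspaceZ Z a x : subspace Z -> Z x -> Z (a *: x).
Proof. by case=> z0 h zx; have := h a x 0 zx z0; rewrite addr0. Qed.

Lemma subspaceB Z x y : subspace Z -> Z x -> Z y -> Z (x - y).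
Proof. by move=> sZ zx zy; rewrite -scaleN1r; apply: subspaceD => //; apply: subspaceZ. Qed.

Lemma subspaceZK Z a x : subspace Z -> a != 0 -> Z (a *: x) -> Z x.
Proof.
by move=> sZ a0 /(subspaceZ a^-1 sZ); rewrite scalerA mulVf // scale1r.
Qed.

Lemma subspace_sum Z (I : Type) (s : seq I) (P : pred I) (F : I -> V) :
  subspace Z -> (forall i, P i -> Z (F i)) -> Z (\sum_(i <- s | P i) F i).
Proof.
move=> sZ h; elim/big_rec: _ => [|i x Pi zx]; first exact: subspace0.
by apply: subspaceD => //; apply: h.
Qed.

Lemma subspaceI Z N : subspace Z -> subspace N -> subspace (N `&` Z).
Proof.
move=> [z0 zh] [n0 nh]; split=> // a x y [nx zx] [ny zy].
by split; [apply: nh|apply: zh].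
Qed.

Lemma subspaceT : subspace [set: V]. Proof. by []. Qed.

Lemma stableT : stable [set: V]. Proof. by []. Qed.

Lemma addl_sub Z v : Z `<=` addl Z v.
Proof. by move=> x zx; exists 0; rewrite scale0r subr0. Qed.

Lemma addl_vec Z v : subspace Z -> addl Z v v.
Proof. by move=> sZ; exists 1; rewrite scale1r subrr; apply: subspace0. Qed.

Lemma subspace_addl Z v : subspace Z -> subspace (addl Z v).
Proof.
move=> sZ; split; first by apply: addl_sub; apply: subspace0.
move=> a x y [e zx] [f zy]; exists (a * e + f).
have -> : a *: x + y - (a * e + f) *: v = a *: (x - e *: v) + (y - f *: v).
  by rewrite scalerDl scalerBr scalerA opprD addrACA.
by apply: subspaceD => //; apply: subspaceZ.
Qed.

Lemma addl_min Z v N : subspace N -> Z `<=` N -> N v -> addl Z v `<=` N.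
Proof.
move=> sN ZN nv x [a /ZN nx]; rewrite -(subrK (a *: v) x).
by apply: subspaceD => //; apply: subspaceZ.
Qed.

Lemma addl_in Z v : subspace Z -> Z v -> addl Z v = Z.
Proof.
move=> sZ zv; apply/seteqP; split; first exact: addl_min.
exact: addl_sub.
Qed.

Lemma cl_sub Z : Z `<=` cl Z. Proof. by move=> x zx N _; apply. Qed.

Lemma stable_cl Z : stable (cl Z).
Proof.
split; first split.
- by move=> N [sN _] _; apply: subspace0.
- move=> a x y cx cy N sN ZN; case: (sN) => [[_ h] _].
  by apply: h; [apply: cx|apply: cy].
- by move=> c x cx N sN ZN; apply: sN.2; apply: cx.
Qed.

Lemma cl_min Z N : stable N -> Z `<=` N -> cl Z `<=` N.
Proof. by move=> sN ZN x cx; apply: cx. Qed.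

Lemma linon0 X Z (h : V -> X) : subspace Z -> linon Z h -> h 0 = 0.
Proof.
move=> sZ hl; have z0 := subspace0 sZ.
by have := hl (-1) 0 0 z0 z0; rewrite scaler0 addr0 scaleN1r addNr.
Qed.

Lemma linonD X Z (h : V -> X) x y : linon Z h -> Z x -> Z y ->
  h (x + y) = h x + h y.
Proof. by move=> hl zx zy; have := hl 1 x y zx zy; rewrite !scale1r. Qed.

Lemma linonZ X Z (h : V -> X) a x : subspace Z -> linon Z h -> Z x ->
  h (a *: x) = a *: h x.
Proof.
move=> sZ hl zx; have := hl a x 0 zx (subspace0 sZ).
by rewrite (linon0 sZ hl) !addr0.
Qed.

Lemma linonB X Z (h : V -> X) x y : subspace Z -> linon Z h -> Z x -> Z y ->
  h (x - y) = h x - h y.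
Proof.
move=> sZ hl zx zy; rewrite -scaleN1r addrC hl // scaleN1r addrC //.
Qed.

Lemma linon_sum X Z (h : V -> X) (I : Type) (s : seq I) (P : pred I) (F : I -> V) :
  subspace Z -> linon Z h -> (forall i, P i -> Z (F i)) ->
  h (\sum_(i <- s | P i) F i) = \sum_(i <- s | P i) h (F i).
Proof.
move=> sZ hl hF; elim: s => [|i s IH]; first by rewrite !big_nil (linon0 sZ hl).
rewrite !big_cons; case: ifP => // Pi.
rewrite (linonD hl) ?IH //; first exact: hF.
exact: subspace_sum.
Qed.

Lemma hom_sub X (N Z : set V) (h : V -> X) : Z `<=` N -> hom N h -> hom Z h.
Proof.
move=> ZN [hl hc]; split=> [a x y /ZN nx /ZN ny|c x /ZN nx /ZN ncx].
  exact: hl.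
exact: hc.
Qed.

Lemma hom_ext X (N Z : set V) (h h' : V -> X) : stable N -> Z `<=` N ->
  hom N h -> hom N h' -> (forall x, Z x -> h x = h' x) ->
  forall x, cl Z x -> h x = h' x.
Proof.
move=> sN ZN hh hh' e x cx.
pose E := [set x | N x /\ h x = h' x].
have /(_ _ _)/= := cx E; case=> //; last by move=> z zz; split; [apply: ZN|apply: e].
split; first split.
- split; first exact: subspace0 sN.1.
  by rewrite (linon0 sN.1 hh.1) (linon0 sN.1 hh'.1).
- move=> a y z [ny ey] [nz ez]; split; first by apply: sN.1.2.
  by rewrite hh.1 // hh'.1 // ey ez.
- move=> c y [ny ey]; have ncy := sN.2 c _ ny; split=> //.
  by rewrite hh.2 // hh'.2 // ey.
Qed.

(** The extension of [h] to [addl Z e] with value [v] at [e]; the coefficient [a] is unique once [e]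
    lies outside [Z]. *)
Definition lift1 X Z (e : V) (v : X) (h : V -> X) (x : V) : X :=
  let a := xget 0 [set a | Z (x - a *: e)] in h (x - a *: e) + a *: v.

Lemma lift1E X Z (e : V) (v : X) (h : V -> X) a x : subspace Z -> ~ Z e -> Z x ->
  lift1 Z e v h (x + a *: e) = h x + a *: v.
Proof.
move=> sZ nze zx; rewrite /lift1; case: xgetP => [b _ /= zb|/(_ a)]; last first.
  by case; rewrite /= addrK.
have [-> |ne] := eqVneq b a; first by rewrite addrK.
case: nze; apply: (@subspaceZK _ (a - b)) => //; first by rewrite subr_eq0 eq_sym.
have -> : (a - b) *: e = (x + a *: e - b *: e) - x.
  by rewrite scalerBl [RHS]addrC !addrA addNr add0r.
exact: subspaceB.
Qed.

Lemma linon_lift1 X Z (e : V) (v : X) (h : V -> X) :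
  subspace Z -> ~ Z e -> linon Z h -> linon (addl Z e) (lift1 Z e v h).
Proof.
move=> sZ nze hl a x y [f zx] [g zy].
rewrite -[x](subrK (f *: e)) -[y](subrK (g *: e)).
have -> : a *: (x - f *: e + f *: e) + (y - g *: e + g *: e) =
   (a *: (x - f *: e) + (y - g *: e)) + (a * f + g) *: e.
  by rewrite scalerDr scalerDl addrACA scalerA.
rewrite !lift1E //; last by apply: sZ.2.
by rewrite hl // scalerDr scalerDl addrACA scalerA.
Qed.

Lemma lift1_base X Z (e : V) (v : X) (h : V -> X) x :
  subspace Z -> ~ Z e -> Z x -> lift1 Z e v h x = h x.
Proof.
by move=> sZ nze zx; have := lift1E v h 0 sZ nze zx; rewrite !scale0r !addr0.
Qed.

Lemma lift1_vec X Z (e : V) (v : X) (h : V -> X) :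
  subspace Z -> ~ Z e -> linon Z h -> lift1 Z e v h e = v.
Proof.
move=> sZ nze hl; have := lift1E v h 1 sZ nze (subspace0 sZ).
by rewrite !scale1r add0r (linon0 sZ hl) add0r.
Qed.

End Basics.

Definition fd V (Z : set V) :=
  exists m (iota : {linear 'rV[k]_m -> V}), injective iota /\ Z = range iota.

Lemma fd_subspace V (Z : set V) : fd Z -> subspace Z.
Proof.
case=> m [iota [_ ->]]; split; first by exists 0 => //; rewrite linear0.
by move=> a _ _ [x _ <-] [y _ <-]; exists (a *: x + y) => //; rewrite linearP.
Qed.

Definition addl_coord V m (iota : {linear 'rV[k]_m -> V}) (v : V)
  (u : 'rV[k]_(m + 1)) : V := iota (lsubmx u) + rsubmx u 0 0 *: v.

Lemma addl_coord_linear V m (iota : {linear 'rV[k]_m -> V}) v :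
  linear (addl_coord iota v).
Proof.
move=> a x y; rewrite /addl_coord !linearP /= !mxE scalerDl scalerDr scalerA.
by rewrite addrACA.
Qed.

HB.instance Definition _ V m (iota : {linear 'rV[k]_m -> V}) v :=
  GRing.isLinear.Build k 'rV[k]_(m + 1) V _ (addl_coord iota v)
    (addl_coord_linear iota v).

Lemma fd_addl V (Z : set V) v : fd Z -> fd (addl Z v).
Proof.
move=> fZ; have sZ := fd_subspace fZ.
have [zv|nzv] := pselect (Z v); first by rewrite addl_in.
case: fZ => m [iota [inj EZ]].
exists (m + 1)%N, (addl_coord iota v : {linear _ -> V}); split.
  apply: raddf_inj => u /eqP; rewrite /= /addl_coord addr_eq0 => /eqP eu.
  have u0 : rsubmx u 0 0 = 0.
    apply/eqP/negPn/negP => ne; apply: nzv.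
    apply: (@subspaceZK _ _ (- rsubmx u 0 0)); rewrite ?oppr_eq0 //.
    by rewrite scaleNr -eu EZ; exists (lsubmx u).
  move: eu; rewrite u0 scale0r oppr0 -[RHS](linear0 iota) => /inj eu.
  by rewrite -[u]hsubmxK eu [rsubmx u]mx11_scalar u0 raddf0 row_mx0.
apply/seteqP; split=> [x [a]|_ [u _ <-]].
  rewrite EZ => -[w _ ew]; exists (row_mx w a%:M) => //=.
  by rewrite /addl_coord row_mxKl row_mxKr mxE eqxx mulr1n ew subrK.
by exists (rsubmx u 0 0); rewrite /= /addl_coord addrK EZ; exists (lsubmx u).
Qed.

End Windows.

(** * Matrix coordinates on a window and the escape of new vectors *)

Section MatrixSpaces.
Context {k : fieldType} {d : nat}.
Implicit Types (V X : fspace k d) (b c : @letter d).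

(** A matrix of maximal rank among those with row space inside [P] works: a further vector of [P]
    would raise the rank. *)
Lemma rowspace_of_pred m (P : set 'rV[k]_m) :
  P 0 -> (forall a u v, P u -> P v -> P (a *: u + v)) ->
  exists D : 'M[k]_m, forall u, (u <= D)%MS <-> P u.
Proof.
move=> P0 PL.
pose Q r := `[< exists D : 'M[k]_m, \rank D = r /\ forall u, (u <= D)%MS -> P u >].
have Q0 : exists r, Q r.
  exists 0%N; apply/asboolP; exists 0; rewrite mxrank0; split=> // u.
  by rewrite submx0 => /eqP ->.
have Qm r : Q r -> (r <= m)%N.
  by move=> /asboolP[D [<- _]]; apply: rank_leq_row.
case: (ex_maxnP Q0 Qm) => r /asboolP[D [rD DP]] rmax.
exists D => u; split; first exact: DP.
move=> Pu; apply/negPn/negP => nuD.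
have : Q (\rank (D + u)%MS).
  apply/asboolP; exists (D + u)%MS; split=> // v /sub_addsmxP[[a e] /= ->].
  rewrite addrC [e]mx11_scalar mul_scalar_mx; apply: PL => //.
  exact/DP/submxMl.
move=> /rmax; rewrite -rD => le.
have /mxrank_leqif_sup[_] : (D <= D + u)%MS by apply: addsmxSl.
rewrite eqn_leq le mxrankS ?addsmxSl //= => /esym.
by rewrite addsmx_sub submx_refl (negbTE nuD).
Qed.

(** [pinvmx A *m B] carries [A] to [B]. Equal kernels give equal ranks, so it can be replaced by an
    invertible matrix without changing its effect on the rows of [A]. *)
Lemma same_kernel_unitmx q m (A B : 'M[k]_(q, m)) :
  (forall a : 'rV_q, (a *m A == 0) = (a *m B == 0)) ->
  exists2 g : 'M[k]_m, g \in unitmx & A *m g = B.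
Proof.
move=> kerE.
have AB : A *m (pinvmx A *m B) = B.
  have : forall a : 'rV_q, a *m A *m pinvmx A *m A = a *m A.
    by move=> a; rewrite mulmxKpV ?submxMl.
  move: (pinvmx A) => Ap ApK.
  apply/row_matrixP => i; apply/eqP; rewrite -subr_eq0 !rowE !mulmxA.
  by rewrite -mulmxBl -kerE mulmxBl ApK subrr.
have rk : \rank (A *m (pinvmx A *m B)) = \rank A.
  rewrite AB; apply/eqP; rewrite -(inj_eq (@addnI (\rank (kermx A)))).
  rewrite {2}mxrank_ker subnK ?rank_leq_row //.
  have -> : \rank (kermx A) = \rank (kermx B).
    apply/eqmx_rank/andP; split; apply/row_subP => i; apply/sub_kermxP.
      by apply/eqP; rewrite -kerE; apply/eqP/sub_kermxP/row_sub.
    by apply/eqP; rewrite kerE; apply/eqP/sub_kermxP/row_sub.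
  by rewrite mxrank_ker subnK ?rank_leq_row.
have [g gu gE] := complete_unitmx rk; exists g => //.
by rewrite -gE AB.
Qed.

Lemma partial_iso_coord (V : lmodType k) m (iota : {linear 'rV[k]_m -> V})
    (D : 'M[k]_m) (f : {linear V -> V}) :
  injective iota -> injective f ->
  (forall u, (u <= D)%MS -> range iota (f (iota u))) ->
  exists2 g : 'M[k]_m, g \in unitmx &
    forall u, (u <= D)%MS -> f (iota u) = iota (u *m g).
Proof.
move=> inj injf hD.
have /choice[w hw] : forall i : 'I_m, exists w, iota w = f (iota (row i D)).
  by move=> i; have [w _ hw] := hD _ (row_sub i D); exists w.
pose B := \matrix_i w i.
have key (a : 'rV_m) : f (iota (a *m D)) = iota (a *m B).
  rewrite mulmx_sum_row [a *m B]mulmx_sum_row !linear_sum; apply: eq_bigr => i _.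
  by rewrite !linearZ /= rowK hw.
have [|g gu gE] := @same_kernel_unitmx _ _ D B.
  move=> a; apply/eqP/eqP => e; first by apply: inj; rewrite -key e !linear0.
  by apply/inj/injf; rewrite key e !linear0.
exists g => // u /submxP[a ->].
by rewrite key -mulmxA gE.
Qed.

(** [D c] holds the coordinates of the vectors that [c] keeps in the window, and [g c] is an
    invertible extension of this partial action. Outside [D c] the choice is arbitrary, except that
    [g (linv c)] inverts [g c]. *)
Record window_coord V m (iota : {linear 'rV[k]_m -> V})
    (D g : @letter d -> 'M[k]_m) : Prop := WindowCoord {
  wc_inj : injective iota;
  wc_gK : forall c, g c *m g (linv c) = 1%:M;
  wc_D : forall c u, (u <= D c)%MS <-> range iota (act c (iota u));
  wc_act : forall c u, (u <= D c)%MS -> act c (iota u) = iota (u *m g c) }.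

Lemma act_inj V c : injective (act c : V -> V).
Proof. exact: can_inj (actK c). Qed.

Lemma window_coord_exists V m (iota : {linear 'rV[k]_m -> V}) :
  injective iota -> exists D g, window_coord iota D g.
Proof.
move=> inj; have sZ : subspace (range iota).
  by apply: fd_subspace; exists m, iota.
have /choice[D hD] : forall c : letter, exists D : 'M[k]_m,
    forall u, (u <= D)%MS <-> range iota (act c (iota u)).
  move=> c; apply: (rowspace_of_pred (P := fun u => range iota (act c (iota u)))).
    by rewrite !linear0; apply: subspace0.
  by move=> a u v hu hv; rewrite !linearP; apply: sZ.2.
(* Matrices are chosen for the positive letters only; the negative ones receive the inverses. *)
have /choice[g0 hg0] : forall i : 'I_d, exists g : 'M[k]_m, g \in unitmx /\
    forall u, (u <= D (i, true))%MS -> act (i, true) (iota u) = iota (u *m g).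
  move=> i; have [|g gu gE] := @partial_iso_coord V m iota (D (i, true))
    (fs_act V (i, true)) inj (@act_inj V (i, true)).
    by move=> u /hD.
  by exists g.
exists D, (fun c => if c.2 then g0 c.1 else invmx (g0 c.1)); split=> //.
- case=> i [] /=; first by rewrite mulmxV //; case: (hg0 i).
  by rewrite mulVmx //; case: (hg0 i).
- case=> i [] u /=; first by case: (hg0 i) => _; apply.
  move=> /hD[w _ ew]; rewrite -ew; congr (iota _).
  have e : act (i, true) (iota w) = iota u.
    by rewrite ew; exact: (@actVK _ _ V (i, true)).
  have [gu gE] := hg0 i.
  have := gE w; rewrite e => e2.
  have /e2/inj -> : (w <= D (i, true))%MS by apply/hD; rewrite e; exists u.
  by rewrite mulmxK.
Qed.

Section MxSpace.
Variables (n : nat) (rho : @letter d -> 'M[k]_n).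
Hypothesis rhoK : forall c, rho c *m rho (linv c) = 1%:M.

Lemma mxspace_actK c (v : 'rV[k]_n) : mulmxr (rho (linv c)) (mulmxr (rho c) v) = v.
Proof. by rewrite /= -mulmxA rhoK mulmx1. Qed.

Definition mxspace : fspace k d :=
  @FSpace k d 'rV[k]_n (fun c => mulmxr (rho c) : {linear _ -> _}) mxspace_actK.
End MxSpace.

(** Only modules given by matrices are tested, because [compare_extends] can reach no others. For a
    generating [Z] and [N = setT], [chain_extension] upgrades this to all modules. *)
Definition fwin V (N Z : set V) :=
  [/\ stable N, Z `<=` N &
    forall n (rho : @letter d -> 'M[k]_n)
      (rhoK : forall c, rho c *m rho (linv c) = 1%:M),
      extends_to (mxspace rhoK) N Z].

(** The value at [act b y] is forced by the value at [y], so an extension from [Z] already agrees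
    with [h] there. *)
Lemma extends_addl V X (N Z : set V) y b :
  stable N -> Z `<=` N -> subspace Z -> Z y ->
  extends_to X N Z -> extends_to X N (addl Z (act b y)).
Proof.
move=> sN ZN sZ zy ex h hh.
have ZZ : Z `<=` addl Z (act b y) by apply: addl_sub.
have [H HH He] := ex h (hom_sub ZZ hh).
exists H => // x [a zx].
have zz := addl_vec (act b y) sZ.
have nz : N (act b y) by apply: sN.2; apply: ZN.
rewrite -[x](subrK (a *: act b y)) addrC (HH.1 a) //; last exact: ZN.
rewrite (hh.1 a) //; last exact: ZZ.
rewrite HH.2 //; last exact: ZN.
by rewrite !He // hh.2 //; apply: ZZ.
Qed.

Lemma fwin_addl V (N Z : set V) y b :
  subspace Z -> fwin N Z -> Z y -> fwin N (addl Z (act b y)).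
Proof.
move=> sZ [sN ZN ex] zy; split=> //.
  by apply: addl_min => //; [case: sN|apply: sN.2; apply: ZN].
by move=> n rho rhoK; apply: extends_addl => //; apply: ex.
Qed.

Definition swapmx : 'M[k]_(1 + 1) := block_mx 0 1%:M 1%:M 0.

Lemma swapmxK : swapmx *m swapmx = 1%:M.
Proof.
by rewrite mulmx_block !mulmx0 !mul0mx !mulmx1 !addr0 !add0r -scalar_mx_block.
Qed.

(* Mapping the window to itself plus a plane, on which every letter swaps the
   two basis vectors, the action of [b] can be sheared so that [act b y]
   acquires a component along the first of them; a further letter other than
   [linv b] then leads out of the enlarged window. *)
Lemma free_step V (N Z : set V) y b u c :
  fd Z -> fwin N Z -> Z y -> c != linv b ->
  addl Z (act b y) u -> ~ Z u -> ~ addl Z (act b y) (act c u).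
Proof.
move=> fZ wZ zy ncb Zu nZu Zcu; have sZ := fd_subspace fZ.
have nz : ~ Z (act b y) by move=> zz; apply: nZu; rewrite addl_in in Zu.
case: fZ => m [iota [inj EZ]].
have [D [g [_ gK DE gE]]] := window_coord_exists inj.
move: (zy); rewrite EZ => -[uy _ ey].
have nDy : ~~ (uy <= D b)%MS.
  by apply/negP => /DE; rewrite -EZ ey.
(* The functional [la] is 1 at [y] and vanishes wherever [b] stays in [Z], so a shear along it is
   invisible on the window. *)
have [la la0 la1] : exists2 la : 'cV[k]_m, D b *m la = 0 & uy *m la = 1%:M.
  move: nDy; rewrite submxE; have := mulmx_coker (D b).
  move: (cokermx (D b)) => C DC /rV0Pn[j ne0].
  exists (((uy *m C) 0 j)^-1 *: col j C).
    by rewrite colE -scalemxAr mulmxA DC mul0mx scaler0.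
  rewrite colE -scalemxAr mulmxA -colE [LHS]mx11_scalar.
  by rewrite [X in X%:M]mxE [X in _ * X]mxE mulVf.
have lale (w : 'rV_m) : (w <= D b)%MS -> w *m la = 0.
  by move=> /submxP[e ->]; rewrite -mulmxA la0 mulmx0.
pose t : 'M[k]_(1, 1 + 1) := row_mx 1%:M 0.
(* [linv b] receives the inverse of the sheared matrix; the other letters act blockwise, without
   shear. *)
pose rho c0 : 'M[k]_(m + (1 + 1)) := if c0 == b then block_mx (g b) (la *m t) 0 swapmx
  else if c0 == linv b then
    block_mx (g (linv b)) (- (g (linv b) *m la *m t *m swapmx)) 0 swapmx
  else block_mx (g c0) 0 0 swapmx.
have gVK : g (linv b) *m g b = 1%:M by have := gK (linv b); rewrite linvK.
have rhoK c0 : rho c0 *m rho (linv c0) = 1%:M.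
  rewrite /rho; have [->|nb] := eqVneq c0 b.
    rewrite (negbTE (linv_neq b)) eqxx mulmx_block !mulmx0 !mul0mx swapmxK gK.
    by rewrite !addr0 !add0r mulmxN !mulmxA gK mul1mx addNr -scalar_mx_block.
  have [->|nb'] := eqVneq c0 (linv b).
    rewrite linvK eqxx mulmx_block !mulmx0 !mul0mx swapmxK gVK.
    rewrite !addr0 !add0r mulNmx -!mulmxA swapmxK mulmx1.
    by rewrite subrr -scalar_mx_block.
  rewrite (can2_eq linvK linvK) (negbTE nb') (can_eq linvK) (negbTE nb).
  rewrite mulmx_block !mulmx0 !mul0mx swapmxK gK.
  by rewrite !addr0 !add0r -scalar_mx_block.
pose inv x := xget 0 [set u | iota u = x].
have invK w : inv (iota w) = w.
  rewrite /inv; case: xgetP => [w' _ /= /inj//|/(_ w)/= h]; exact: False_ind (h _).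
pose X := mxspace rhoK.
pose h (x : V) : X := row_mx (inv x) 0.
have hE w : h (iota w) = row_mx w 0 by rewrite /h invK.
have actD c0 x : Z x -> Z (act c0 x) ->
    exists2 w, x = iota w & (w <= D c0)%MS.
  by rewrite EZ => -[w _ <-] hw; exists w => //; apply/DE.
have hh : hom (X := X) Z h.
  split.
    rewrite EZ => a _ _ [w _ <-] [w' _ <-]; rewrite -linearP !hE.
    by rewrite scale_row_mx add_row_mx scaler0 addr0.
  move=> c0 x zx zcx; have [w -> wD] := actD _ _ zx zcx.
  rewrite gE // !hE /= /rho; case: eqVneq => [E|_].
    rewrite E mul_row_block !mul0mx !addr0 mulmxA.
    by rewrite lale ?mul0mx ?mulmx0 -?E.
  case: eqVneq => [E|_]; last first.
    by rewrite mul_row_block !mul0mx !addr0 !mulmx0.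
  rewrite E mul_row_block !mul0mx !addr0 mulmxN !mulmxA.
  have : (w *m g (linv b) <= D b)%MS.
    rewrite E in wD; apply/DE; rewrite -gE // actVK; by exists w.
  by move=> /lale ->; rewrite !mul0mx oppr0.
case: wZ => sN ZN /(_ _ _ rhoK) ex.
have [H HH He] := ex h hh.
have nact : N (act b y) by apply: sN.2; apply: ZN.
have subN : addl Z (act b y) `<=` N by apply: addl_min => //; case: sN.
(* On the enlarged window the plane component always lies along [t], with the coefficient of
   [act b y]. *)
have HZ x a : Z (x - a *: act b y) ->
    exists w, H x = row_mx w (a *: t).
  move=> zx; rewrite -[x](subrK (a *: act b y)) addrC HH.1 //; last exact: ZN.
  rewrite HH.2 //; last exact: ZN.
  rewrite !He // -{1}ey hE; move: zx; rewrite EZ => -[w _ <-].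
  rewrite hE /= /rho eqxx mul_row_block !mul0mx mulmxA la1 mul1mx !addr0.
  by rewrite scale_row_mx add_row_mx addr0; eexists.
case: (Zu) => a /HZ[w Hu].
have a0 : a != 0.
  apply/eqP => a0; apply: nZu; case: Zu.
  move=> a' za'; have [w' Hu'] := HZ _ _ za'.
  have : a' *: t = 0.
    by move: Hu; rewrite Hu' a0 scale0r => /eq_row_mx[].
  move/rowP => /(_ 0); rewrite !mxE.
  case: splitP => [j _|j]; last by [].
  by rewrite mxE !ord1 /= mulr1 => E; move: za'; rewrite E scale0r subr0.
case: (Zcu) => a' /HZ[w' Hcu].
have : H (act c u) = act c (H u) by apply: HH.2; apply: subN.
rewrite Hcu Hu /= /rho (negbTE ncb) => E.
(* Every letter but [linv b] sends [a *: t] to its swap plus a multiple of [t]; the second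
   coordinate of the plane then forces [a = 0]. *)
have : exists e, a' *: t = e *: t + a *: t *m swapmx.
  move: E; case: eqVneq => [_|_]; rewrite mul_row_block.
    move=> /eq_row_mx[_ ->]; exists ((w *m la) 0 0).
    by rewrite mulmxA {1}[w *m la]mx11_scalar mul_scalar_mx.
  by move=> /eq_row_mx[_ ->]; exists 0; rewrite scale0r mulmx0 add0r.
case=> e /(congr1 rsubmx); rewrite -scalemxAl mul_row_block mul1mx !mul0mx.
rewrite !scale_row_mx add_row_mx !row_mxKr mul1mx !scaler0 add0r addr0.
move=> /rowP/(_ 0); rewrite !mxE eqxx mulr1 => /esym/eqP.
by rewrite (negbTE a0).
Qed.

End MatrixSpaces.

(** * Growth of a window and traces of submodules *)

Section Growth.
Context {k : fieldType} {d : nat} {V : fspace k d}.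
Implicit Types (X : fspace k d) (Z N J : set V) (b c : @letter d).

Inductive grow Z : set V -> Prop :=
| grow0 : grow Z Z
| growS Z1 y b : grow Z Z1 -> Z1 y -> grow Z (addl Z1 (act b y)).

Lemma grow_sub Z Z' : grow Z Z' -> Z `<=` Z'.
Proof.
elim=> // Z1 y b _ h _; exact: subset_trans h (addl_sub _).
Qed.

Lemma grow_trans Z Z1 Z2 : grow Z Z1 -> grow Z1 Z2 -> grow Z Z2.
Proof. by move=> g1; elim=> // Z3 y b _ IH y3; apply: growS. Qed.

Lemma grow_fd Z Z' : grow Z Z' -> fd Z -> fd Z'.
Proof. by elim=> // Z1 y b _ h _ /h; apply: fd_addl. Qed.

Lemma grow_fwin N Z Z' : grow Z Z' -> fd Z -> fwin N Z -> fwin N Z'.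
Proof.
elim=> // Z1 y b g h y1 fZ wZ; apply: fwin_addl => //; last exact: h.
exact/fd_subspace/(grow_fd g).
Qed.

(** The steps leading from [Z] to [Z2] can be replayed on top of [Z1]. *)
Lemma grow_join Z Z1 Z2 : fd Z -> grow Z Z1 -> grow Z Z2 ->
  exists2 Z3, grow Z1 Z3 & Z2 `<=` Z3.
Proof.
move=> fZ g1; elim=> [|Z2' y b g2 [Z3 g3 s3] y2].
  by exists Z1; [apply: grow0|apply: grow_sub].
have f3 : subspace Z3 by apply/fd_subspace/(grow_fd g3)/(grow_fd g1).
exists (addl Z3 (act b y)); first by apply: growS => //; apply: s3.
apply: addl_min; [exact: subspace_addl|exact: subset_trans (addl_sub _)|].
exact: addl_vec.
Qed.

Lemma grow_cl Z x : fd Z -> cl Z x -> exists2 Z', grow Z Z' & Z' x.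
Proof.
move=> fZ cx; suff sE : stable [set x | exists2 Z', grow Z Z' & Z' x].
  by apply: (cx _ sE) => z Zz; exists Z => //; apply: grow0.
split; first split.
- by exists Z; [apply: grow0|exact: subspace0 (fd_subspace fZ)].
- move=> a u v [Z1 g1 u1] [Z2 g2 v2]; have [Z3 g3 s3] := grow_join fZ g1 g2.
  exists Z3; first exact: grow_trans g3.
  have [_] : subspace Z3 by apply/fd_subspace/(grow_fd g3)/(grow_fd g1).
  by apply; [apply: (grow_sub g3)|apply: s3].
- move=> c u [Z1 g1 u1]; exists (addl Z1 (act c u)); first exact: growS.
  exact/addl_vec/fd_subspace/(grow_fd g1).
Qed.

Lemma grow_seq Z (s : seq V) : fd Z -> (forall x, x \in s -> cl Z x) ->
  exists2 Z', grow Z Z' & forall x, x \in s -> Z' x.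
Proof.
move=> fZ; elim: s => [|x s IH] hs; first by exists Z; [apply: grow0|].
have [|Z1 g1 s1] := IH; first by move=> y ys; apply: hs; rewrite inE ys orbT.
have [|Z2 g2 x2] := grow_cl (x := x) fZ; first by apply: hs; rewrite mem_head.
have [Z3 g3 s3] := grow_join fZ g1 g2.
exists Z3; first exact: grow_trans g3.
move=> y; rewrite inE => /predU1P[->|/s1 y1]; first exact: s3.
exact: (grow_sub g3).
Qed.

Lemma fd_generators Z : fd Z -> exists2 s : seq V,
  (forall x, x \in s -> Z x) &
  forall S, subspace S -> (forall x, x \in s -> S x) -> Z `<=` S.
Proof.
case=> m [iota [_ ->]]; exists [seq iota (delta_mx 0 i) | i <- enum 'I_m].
  by move=> _ /mapP[i _ ->]; exists (delta_mx 0 i).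
move=> S sS hS _ [u _ <-]; rewrite [u]row_sum_delta linear_sum.
apply: subspace_sum => // i _; rewrite linearZ; apply: subspaceZ => //.
by apply: hS; apply: map_f; rewrite mem_enum.
Qed.

Lemma grow_act Z : fd Z ->
  exists2 Z', grow Z Z' & forall c x, Z x -> Z' (act c x).
Proof.
move=> fZ; have [s sZ sgen] := fd_generators fZ.
pose t := [seq act c x | c <- enum {: @letter d}, x <- s].
have [|Z' gZ' tZ'] := @grow_seq Z t fZ.
  move=> _ /allpairsP[[c x] [_ /= xs ->]].
  by apply: (stable_cl Z).2; apply: cl_sub; apply: sZ.
exists Z' => // c x Zx; have sZ' := fd_subspace (grow_fd gZ' fZ).
pose S := [set x | Z' (act c x)].
apply: (sgen S _ _ x Zx).
  split; first by rewrite /S /= linear0; apply: subspace0.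
  by move=> a u v Su Sv; rewrite /S /= linearP; apply: sZ'.2.
by move=> z zs; apply: tZ'; apply/allpairsP; exists (c, z); rewrite mem_enum.
Qed.

(* For every [o], [J] is spanned by its vectors that some letter other than [o]
   keeps in [J]; [None] forbids no letter and only matters when [d = 0]. *)
Definition full J := forall (o : option letter) S, subspace S ->
  (forall c x, Some c != o -> J x -> J (act c x) -> S x) -> J `<=` S.

(** The growth of [Z] that captures [J] is undone step by step. At a step by [act b y], fullness
    with [linv b] forbidden spans [J] by vectors that another letter keeps inside, and by
    [free_step] none of these is new. *)
Lemma full_sub_window N Z J : fd Z -> fd J -> fwin N Z -> J `<=` cl Z ->
  full J -> J `<=` Z.
Proof.
move=> fZ fJ wZ JZ fullJ; have [s sJ sgen] := fd_generators fJ.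
have [|Z' gZ' sZ'] := @grow_seq Z s fZ; first by move=> x /sJ /JZ.
have {sgen sZ'} : J `<=` Z'.
  by apply: sgen => //; apply/fd_subspace/(grow_fd gZ').
elim: gZ' => // Z1 y b g1 IH y1 JZ1; apply: IH.
have f1 := grow_fd g1 fZ; apply: (fullJ (Some (linv b))); first exact: fd_subspace.
move=> c x cb Jx Jcx; apply/not_notP => nx.
apply: (free_step f1 (grow_fwin g1 fZ wZ) y1 cb _ nx); exact: JZ1.
Qed.

Section Chain.
Variables (N : set V) (K : set V) (X : fspace k d) (h0 : V -> X) (x0 : X).
Hypothesis sN : stable N.

(** As long as no vector has been chosen freely and sent to [x0], the trace stays inside the
    submodule generated by [K]. For modules without free quotient this will show that the trace
    generates them. *)
Definition chain_inv Z (h : V -> X) :=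
  [/\ hom (N `&` Z) h, forall x, K x -> h x = h0 x &
    (exists2 e, (N `&` Z) e & h e = x0) \/ N `&` Z `<=` cl K].

Lemma chain_step Z y b (h : V -> X) : K `<=` N `&` Z ->
  fd Z -> fwin setT Z -> Z y -> chain_inv Z h ->
  exists2 h', chain_inv (addl Z (act b y)) h' &
    forall x, (N `&` Z) x -> h' x = h x.
Proof.
move=> KZ fZ wZ zy [hh hK hx]; have sZ := fd_subspace fZ.
set Z' := addl Z (act b y).
have sNZ : subspace (N `&` Z) by apply: subspaceI => //; case: sN.
have sNZ' : subspace (N `&` Z') by apply: subspaceI; [apply: subspace_addl|case: sN].
have ZZ' : N `&` Z `<=` N `&` Z'.
  by move=> x [nx zx]; split=> //; apply: addl_sub.
have [sub|] := pselect (N `&` Z' `<=` Z).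
  exists h => //; have -> : chain_inv Z' h = chain_inv Z h; last by split.
  rewrite /chain_inv; have -> // : N `&` Z' = N `&` Z.
  by apply/seteqP; split=> // x nzx; split; [case: nzx|apply: sub].
move=> /existsNP[e0 /not_implyP[ne0 nze0]].
(* The trace grows by at most one line, since the window does; any new vector of it spans that
   line. *)
have ZE e : (N `&` Z') e -> ~ Z e -> N `&` Z' = addl (N `&` Z) e.
  move=> [ne [f zf]] nze; have f0 : f != 0.
    by apply/eqP => f0; move: zf; rewrite f0 scale0r subr0.
  apply/seteqP; split=> [x [nx [a za]]|]; last first.
    by apply: addl_min => //; split=> //; exists f.
  exists (a / f); split.
    by apply: (subspaceB sN.1) => //; apply: (subspaceZ _ sN.1).
  have -> : x - (a / f) *: e =
     (x - a *: act b y) - (a / f) *: (e - f *: act b y).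
    by rewrite scalerBr scalerA divfK // opprB addrA addrNK.
  by apply: (subspaceB sZ) => //; apply: (subspaceZ _ sZ).
(* By [free_step] only [b], or [linv b] read backwards, connects the old trace with new vectors, so
   equivariance under [b] is all that has to be checked. *)
have hom_step h' : linon (N `&` Z') h' ->
    (forall x, (N `&` Z) x -> h' x = h x) ->
    (forall u, (N `&` Z) u -> (N `&` Z') (act b u) -> h' (act b u) = act b (h u)) ->
    hom (N `&` Z') h'.
  move=> hl hE hb; split=> // c x [nx zx] [ncx zcx].
  have [Zx|nZx] := pselect (Z x); have [Zcx|nZcx] := pselect (Z (act c x)).
  - by rewrite !hE ?hh.2.
  - have [Ec|ne] := eqVneq c b; first by rewrite Ec in ncx zcx *; rewrite hb ?hE.
    case: (@free_step _ _ _ _ _ y b (act c x) (linv c) fZ wZ) => //.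
      by rewrite (can_eq linvK).
    by rewrite actK.
  - have [Ec|ne] := eqVneq c (linv b); last first.
      by case: (free_step fZ wZ zy ne zx nZx).
    rewrite {c}Ec in ncx zcx Zcx *; rewrite hE //.
    by rewrite -{2}[x](actVK b) hb ?actK ?actVK.
  - have [Ec|ne] := eqVneq c (linv b); last first.
      by case: (free_step fZ wZ zy ne zx nZx).
    case: (@free_step _ _ _ _ _ y b (act c x) b fZ wZ) => //.
      by rewrite eq_sym linv_neq.
    by rewrite Ec actVK.
(* Forced case: the new vector of the trace is the image under [b] of an old one, and so stays in
   the submodule generated by [K] if the old ones lie there. *)
have [[u0 [[nu0 zu0] nzb zb]]|nf] := pselect (exists u0,
    [/\ (N `&` Z) u0, ~ Z (act b u0) & Z' (act b u0)]).
  have nb : N (act b u0) by apply: sN.2.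
  have nI : ~ (N `&` Z) (act b u0) by case.
  have EZ := ZE _ (conj nb zb) nzb.
  pose h' := lift1 (N `&` Z) (act b u0) (act b (h u0)) h.
  have h'E x : (N `&` Z) x -> h' x = h x by apply: lift1_base.
  exists h' => //; split.
  - apply: hom_step => //; first by rewrite EZ; apply: linon_lift1 => //; case: hh.
    move=> u nu; rewrite EZ => -[a na].
    rewrite -[act b u](subrK (a *: act b u0)) {1}/h' lift1E //.
    have := na; rewrite -linearZ -linearB => nb'.
    have nua : (N `&` Z) (u - a *: u0).
      by apply: subspaceB => //; apply: subspaceZ.
    rewrite hh.2 // (linonB sNZ) //; last first.
    - exact: subspaceZ.
    - by case: hh.
    by rewrite (linonZ _ sNZ hh.1) // linearB linearZ subrK.
  - by move=> x Kx; rewrite h'E ?hK //; apply: KZ.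
  - case: hx => [[e ne he]|sub]; [left|right].
      by exists e; [apply: ZZ'|rewrite h'E].
    rewrite EZ; apply: addl_min => //; first by case: (stable_cl K).
    by apply: (stable_cl K).2; apply: sub.
(* Free case: [b] moves no old vector of the trace onto a new one, so the value [x0] violates
   nothing. *)
have nI : ~ (N `&` Z) e0 by case.
have EZ := ZE _ ne0 nze0.
pose h' := lift1 (N `&` Z) e0 x0 h.
have h'E x : (N `&` Z) x -> h' x = h x by apply: lift1_base.
exists h' => //; split.
- apply: hom_step => //; first by rewrite EZ; apply: linon_lift1 => //; case: hh.
  move=> u nu [nbu zbu]; have [Zbu|nZbu] := pselect (Z (act b u)).
    by rewrite h'E // hh.2.
  by case: nf; exists u.
- by move=> x Kx; rewrite h'E ?hK //; apply: KZ.
- by left; exists e0 => //; apply: lift1_vec => //; case: hh.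
Qed.

Lemma chain_grow Z Z' (h : V -> X) : grow Z Z' -> K `<=` N `&` Z ->
  fd Z -> fwin setT Z -> chain_inv Z h ->
  exists2 h', chain_inv Z' h' & forall x, (N `&` Z) x -> h' x = h x.
Proof.
move=> + KZ fZ wZ hI; elim=> [|Z1 y b g1 [h1 hI1 h1E] y1]; first by exists h.
have K1 : K `<=` N `&` Z1.
  by move=> x /KZ[nx zx]; split=> //; apply: (grow_sub g1).
have [h2 hI2 h2E] :=
  chain_step b K1 (grow_fd g1 fZ) (grow_fwin g1 fZ wZ) y1 hI1.
exists h2 => // x [nx zx]; rewrite h2E ?h1E //.
by split=> //; apply: (grow_sub g1).
Qed.

End Chain.

(* The window is enlarged one vector at a time until it exhausts the space.
   Whenever the intersection with [N] grows, the new vector is either obtained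
   from the previous ones by a letter, which forces the value of the extension,
   or it is unconstrained and is sent to [x0]. *)
Theorem chain_extension Z N X (h0 : V -> X) (x0 : X) :
  fd Z -> fwin setT Z -> cl Z = setT -> stable N -> hom (N `&` Z) h0 ->
  exists2 H : V -> X, hom N H /\ (forall x, (N `&` Z) x -> H x = h0 x) &
    (exists2 e, N e & H e = x0) \/ N `<=` cl (N `&` Z).
Proof.
move=> fZ wZ clZ sN hh0.
pose K := N `&` Z; pose state := (set V * (V -> X))%type.
pose P (s : state) := [/\ fd s.1, fwin setT s.1, K `<=` N `&` s.1 &
  chain_inv N K h0 x0 s.1 s.2].
pose R (s s' : {s | P s}) := [/\ (sval s).1 `<=` (sval s').1,
   forall c x, (sval s).1 x -> (sval s').1 (act c x) &
   forall x, (N `&` (sval s).1) x -> (sval s').2 x = (sval s).2 x].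
(* One round adds the images of the whole window under every letter; all rounds together therefore
   exhaust [cl Z], which is everything. *)
have /choice[f fR] : forall s, exists s', R s s'.
  move=> [[Z1 h1] [/= f1 w1 K1 I1]]; have [Z2 g2 a2] := grow_act f1.
  have [h2 I2 h2E] := chain_grow sN g2 K1 f1 w1 I1.
  have P2 : P (Z2, h2).
    split=> //=; [exact: grow_fd g2 _|exact: grow_fwin g2 _ _|].
    by move=> x /K1[nx zx]; split=> //; apply: (grow_sub g2).
  by exists (exist _ _ P2); split=> //=; apply: grow_sub.
have P0 : P (Z, h0).
  by split=> //=; split=> //; right; apply: cl_sub.
pose s r := sval (iter r f (exist _ _ P0)).
have sP r : P (s r) by apply: svalP.
have sS r : R (iter r f (exist _ _ P0)) (iter r.+1 f (exist _ _ P0)) by apply: fR.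
have mono r t : (r <= t)%N -> (s r).1 `<=` (s t).1.
  move=> /subnK <-; elim: (t - r)%N => // q IH; apply: subset_trans IH _.
  by rewrite addSn; case: (sS (q + r)%N).
have agree r t : (r <= t)%N -> forall x, (N `&` (s r).1) x -> (s t).2 x = (s r).2 x.
  move=> /subnK <-; elim: (t - r)%N => // q IH x nx; rewrite addSn.
  have [_ _ e] := sS (q + r)%N; rewrite /s e ?[LHS]IH //.
  by case: nx => nx zx; split=> //; apply: (mono r) => //; apply: leq_addl.
have cover x : exists r, (s r).1 x.
  have cx : cl Z x by rewrite clZ.
  suff sE : stable [set x | exists r, (s r).1 x].
    by apply: (cx _ sE) => z zz; exists 0%N.
  split; first split.
  - by exists 0%N; exact: subspace0 (fd_subspace fZ).
  - move=> a u v [r1 u1] [r2 v2]; exists (maxn r1 r2).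
    have [/fd_subspace[_ h] _ _ _] := sP (maxn r1 r2).
    by apply: h; [apply: mono u1; apply: leq_maxl|apply: mono v2; apply: leq_maxr].
  - by move=> c u [r u1]; exists r.+1; case: (sS r) => _ h _; apply: h.
pose H x := (s (xget 0%N [set r | (s r).1 x])).2 x.
have HE r x : N x -> (s r).1 x -> H x = (s r).2 x.
  move=> nx zx; rewrite /H; case: xgetP => [t _ /= zt|/(_ r)//].
  by case: (leqP r t) => [le|/ltnW le]; [|symmetry]; apply: agree.
have Nc c x : N x -> N (act c x) by apply: sN.2.
exists H; first split; first split.
- move=> a x y nx ny; have [r1 x1] := cover x; have [r2 y2] := cover y.
  pose r := maxn r1 r2.
  have zx : (s r).1 x by apply: mono x1; apply: leq_maxl.
  have zy : (s r).1 y by apply: mono y2; apply: leq_maxr.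
  have [/fd_subspace[_ h] _ _ [[hl _] _ _]] := sP r.
  rewrite !(HE r) //; [exact: hl|exact: sN.1.2|exact: h].
- move=> c x nx _; have [r zx] := cover x; have [mS aS _] := sS r.
  have zcx : (s r.+1).1 (act c x) by apply: aS.
  have zx' : (s r.+1).1 x by apply: mS.
  have [_ _ _ [[_ hc] _ _]] := sP r.+1.
  rewrite !(HE r.+1) //; last exact: Nc.
  by apply: hc; split=> //; apply: Nc.
- by move=> x [nx zx]; rewrite (HE 0%N).
- have [[r [e ne he]]|none] := pselect (exists r, exists2 e, (N `&` (s r).1) e & (s r).2 e = x0).
    by left; exists e; [case: ne|case: ne => ne ze; rewrite (HE r)].
  right=> x nx; have [r zx] := cover x.
  have [_ _ _ [_ _ []]] := sP r; last by apply.
  by move=> h; case: none; exists r.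
Qed.

End Growth.

(** * Domains of letters in coordinates and shrinking *)

Section Coordinates.
Context {k : fieldType} {d : nat} {V : fspace k d} {m : nat}.
Context {iota : {linear 'rV[k]_m -> V}} {D g : @letter d -> 'M[k]_m}.
Hypothesis wc : window_coord iota D g.
Implicit Types (X : fspace k d) (b c : @letter d) (J E : 'M[k]_m) (u v w : 'rV[k]_m).

Let inj := wc_inj wc.
Let gK := wc_gK wc.
Let DE := wc_D wc.
Let actE := wc_act wc.

Lemma window_gVK c : g (linv c) *m g c = 1%:M.
Proof. by have := gK (linv c); rewrite linvK. Qed.

Lemma window_g_unit c : g c \in unitmx.
Proof. by have [] := mulmx1_unit (gK c). Qed.

Definition im J : set V := [set x | exists2 u, (u <= J)%MS & iota u = x].

Definition inv x : 'rV[k]_m := xget 0 [set u | iota u = x].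

Lemma invK u : inv (iota u) = u.
Proof.
by rewrite /inv; case: xgetP => [v _ /= /inj//|/(_ u)/= h]; case: h.
Qed.

Lemma im_iota J u : im J (iota u) <-> (u <= J)%MS.
Proof. by split=> [[v vJ /inj <-]|uJ] //; exists u. Qed.

Lemma im_subspace J : subspace (im J).
Proof.
split; first by exists 0; rewrite ?sub0mx ?linear0.
move=> a _ _ [u uJ <-] [v vJ <-]; exists (a *: u + v); last by rewrite linearP.
by apply: addmx_sub => //; apply: scalemx_sub.
Qed.

Lemma im_fd J : fd (im J).
Proof.
pose f (u : 'rV[k]_(\rank J)) := iota (u *m row_base J).
have fl : linear f by move=> a u v; rewrite /f mulmxDl -scalemxAl linearP.
pose fL : {linear 'rV[k]_(\rank J) -> V} := HB.pack f (GRing.isLinear.Build _ _ _ _ _ fl).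
exists (\rank J), fL; split.
  by move=> u v /inj /(row_free_inj (row_base_free J)).
apply/seteqP; split=> [_ [u uJ <-]|_ [u _ <-]].
  move: uJ; rewrite -(eq_row_base J) => /submxP[w ->]; by exists w.
by exists (u *m row_base J) => //; rewrite -(eq_row_base J) submxMl.
Qed.

Lemma im_mono J1 J2 : (J1 <= J2)%MS <-> im J1 `<=` im J2.
Proof.
split=> [le _ [u uJ <-]|le]; first by exists u => //; apply: submx_trans le.
by apply/row_subP => i; apply/im_iota/le/im_iota/row_sub.
Qed.

Lemma im_eqmx J1 J2 : (J1 :=: J2)%MS -> im J1 = im J2.
Proof. by move=> e; apply/seteqP; split; apply/im_mono; rewrite e. Qed.

Lemma window_D_linv c u : (u <= D c)%MS -> (u *m g c <= D (linv c))%MS.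
Proof. by move=> uD; apply/DE; rewrite -actE // actK; exists u. Qed.

Lemma mul_gK c u : u *m g c *m g (linv c) = u.
Proof. by rewrite -mulmxA gK mulmx1. Qed.

Lemma mul_gVK c u : u *m g (linv c) *m g c = u.
Proof. by rewrite -mulmxA window_gVK mulmx1. Qed.

(** [sub_dom] is the intended reading: the vectors of [J] that [c] keeps in [J]. *)
Definition dom J c := (J :&: D c :&: J *m g (linv c))%MS.

Lemma sub_dom J c u :
  (u <= dom J c)%MS = [&& u <= J, u <= D c & u *m g c <= J]%MS.
Proof.
rewrite /dom !sub_capmx -andbA; do 2!congr (_ && _).
apply/idP/idP => [/(submxMr (g c))|/(submxMr (g (linv c)))].
  by rewrite -mulmxA window_gVK mulmx1.
by rewrite mul_gK.
Qed.

Lemma dom_linv_sub J c u : (u <= dom J c)%MS -> (u *m g c <= dom J (linv c))%MS.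
Proof.
rewrite !sub_dom => /and3P[uJ uD ->].
by rewrite window_D_linv //= mul_gK.
Qed.

Lemma dom_linv J c : (dom J (linv c) :=: dom J c *m g c)%MS.
Proof.
apply/eqmxP/andP; split; apply/row_subP => i; last first.
  by rewrite row_mul; apply/dom_linv_sub/row_sub.
have /dom_linv_sub := row_sub i (dom J (linv c)).
by rewrite linvK => /(submxMr (g c)); rewrite mul_gVK.
Qed.

Lemma rank_dom_linv J c : \rank (dom J (linv c)) = \rank (dom J c).
Proof. by rewrite dom_linv mxrankMfree // row_free_unit window_g_unit. Qed.

Lemma im_dom J c u : im J (iota u) -> im J (act c (iota u)) -> (u <= dom J c)%MS.
Proof.
move=> /im_iota uJ ucJ; have uD : (u <= D c)%MS.
  by case: ucJ => w _ e; apply/DE; exists w.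
by rewrite sub_dom uJ uD -im_iota -actE.
Qed.

Lemma dom_act J c u : (u <= dom J c)%MS -> act c (iota u) = iota (u *m g c).
Proof. by rewrite sub_dom => /and3P[_ uD _]; apply: actE. Qed.

Lemma dom_sub J c : (dom J c <= J)%MS.
Proof. by apply/row_subP => i; have := row_sub i (dom J c); rewrite sub_dom => /and3P[]. Qed.

Lemma coord_hom X J (f : 'rV[k]_m -> X) :
  (forall a u v, (u <= J)%MS -> (v <= J)%MS -> f (a *: u + v) = a *: f u + f v) ->
  (forall c u, (u <= dom J c)%MS -> f (u *m g c) = act c (f u)) ->
  hom (im J) (f \o inv).
Proof.
move=> fl fc; split.
  by move=> a _ _ [u uJ <-] [v vJ <-] /=; rewrite -linearP !invK fl.
move=> c _ [u uJ <-] ucJ /=; have uD : (u <= dom J c)%MS.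
  by apply: im_dom => //; apply/im_iota.
by rewrite (dom_act uD) !invK fc.
Qed.

Lemma hom_coord X J (h : V -> X) c u :
  hom (im J) h -> (u <= dom J c)%MS -> h (iota (u *m g c)) = act c (h (iota u)).
Proof.
move=> hh uD; rewrite -(dom_act uD) hh.2 //; first exact/im_iota/(submx_trans uD)/dom_sub.
by rewrite (dom_act uD); apply/im_iota; move: uD; rewrite sub_dom => /and3P[].
Qed.

(** For a generating trace of [N] on the window, with [I] its domains [genD], this is chi(L) -
    chi(L/N); see [quotient_euler_char]. *)
Definition defect (J : 'M[k]_m) (I : 'I_d -> 'M[k]_m) : int :=
  (\rank J)%:Z - (\sum_i \rank (I i))%N%:Z.

Definition genD J (i : 'I_d) := dom J (i, true).

Section Shrink.
Variables (N : set V) (J : 'M[k]_m) (c : @letter d).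
Hypothesis sN : stable N.
Hypothesis clJ : cl (im J) = N.
Hypothesis exJ : forall X, extends_to X N (im J).

(** Under [cover], what is dropped from [J] can be taken in [dom J c]; the letter [c] moves it into
    [shrink], so [linv c] recovers it from there. *)
Definition shrink := (\sum_(c' | c' != c) dom J c')%MS.

Hypothesis cover : (J <= \sum_c' dom J c')%MS.

Lemma shrink_sub : (shrink <= J)%MS.
Proof. by apply/sumsmx_subP => c' _; apply: dom_sub. Qed.

Lemma dom_shrink_sub c' : c' != c -> (dom J c' <= shrink)%MS.
Proof. by move=> ne; apply: (sumsmx_sup c'). Qed.

Lemma shrink_addE : (J :=: shrink + dom J c)%MS.
Proof.
apply/eqmxP/andP; split; last by rewrite addsmx_sub shrink_sub dom_sub.
by apply: submx_trans cover _; rewrite (bigD1 c) //= addsmxC.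
Qed.

Lemma dom_c_act u : (u <= dom J c)%MS -> (u *m g c <= shrink)%MS.
Proof.
move=> /dom_linv_sub h; apply: submx_trans h _; apply: dom_shrink_sub.
exact: linv_neq.
Qed.

Lemma dom_shrink_c : (dom shrink c :=: shrink :&: dom J c)%MS.
Proof.
apply/eqmxP/andP; split; apply/row_subP => i; set u := row _ _.
  have := row_sub i (dom shrink c); rewrite -/u sub_capmx !sub_dom.
  by case/and3P=> us -> us'; rewrite us !(submx_trans _ shrink_sub).
have := row_sub i (shrink :&: dom J c)%MS; rewrite -/u sub_capmx !sub_dom.
case/andP=> us /and3P[uJ uD ucJ]; rewrite us uD.
by apply: dom_c_act; rewrite sub_dom uJ uD.
Qed.

Lemma dom_shrink_other c' : c' != c -> c' != linv c -> (dom shrink c' :=: dom J c')%MS.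
Proof.
move=> ne ne'; apply/eqmxP/andP; split; apply/row_subP => i; set u := row _ _.
  have := row_sub i (dom shrink c'); rewrite -/u !sub_dom.
  by case/and3P=> us -> us'; rewrite !(submx_trans _ shrink_sub).
have uD := row_sub i (dom J c'); rewrite -/u in uD.
have us := submx_trans uD (dom_shrink_sub ne).
rewrite sub_dom us; move: (uD); rewrite sub_dom => /and3P[_ -> _] /=.
apply: submx_trans (dom_linv_sub uD) (dom_shrink_sub _).
by rewrite (can2_eq linvK linvK).
Qed.

(** Only the domain of the generator underlying [c] changes. It passes from [dom J c] to the
    intersection with [shrink], and since [J] is the sum of the two, [J] and the domain lose the
    same dimension. *)
Lemma defect_shrink : defect shrink (genD shrink) = defect J (genD J).
Proof.
rewrite /defect /genD (bigD1 c.1) //= [in RHS](bigD1 c.1) //=.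
rewrite (eq_bigr (fun i => \rank (dom J (i, true)))); last first.
  move=> i ne; rewrite dom_shrink_other //.
    by apply: contra ne => /eqP <-.
  by apply: contra ne => /eqP/(congr1 fst)/= ->.
have sgn J' : \rank (dom J' (c.1, true)) = \rank (dom J' c).
  case: (c) => i [] //=; exact: (rank_dom_linv J' (i, false)).
rewrite !sgn shrink_addE dom_shrink_c.
have := mxrank_sum_cap shrink (dom J c).
by move: (\sum_(i < d | _) _)%N => R; lia.
Qed.

Lemma cl_shrink : cl (im shrink) = N.
Proof.
rewrite -clJ; apply/seteqP; split.
  apply: cl_min; first exact: stable_cl.
  by move=> x xs; apply: cl_sub; move: x xs; apply/im_mono/shrink_sub.
apply: cl_min; first exact: stable_cl.
move=> _ [u uJ <-]; move: uJ; rewrite shrink_addE => /sub_addsmxP[[a b] /= ->].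
rewrite linearD; apply: (subspaceD (Z := cl (im shrink))); first exact: (stable_cl _).1.
  by apply: cl_sub; exists (a *m shrink)%R; rewrite ?submxMl.
rewrite -[iota _](actK c); apply: (stable_cl _).2; apply: cl_sub.
have bD : (b *m dom J c <= dom J c)%MS by apply: submxMl.
by rewrite (dom_act bD); apply/im_iota/dom_c_act.
Qed.

Lemma shrink_split : exists A0 A1 : 'M[k]_m, forall u, (u <= J)%MS ->
  [/\ u = u *m A0 + u *m A1, (u *m A0 <= shrink)%MS & (u *m A1 <= dom J c)%MS].
Proof.
have /sub_addsmxP[[P Q] /= E] : (J <= shrink + dom J c)%MS by rewrite -shrink_addE.
exists (pinvmx J *m (P *m shrink)), (pinvmx J *m (Q *m dom J c)) => u uJ.
split; last 2 first.
- by rewrite !mulmxA submxMl.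
- by rewrite !mulmxA submxMl.
by rewrite -mulmxDr -mulmxDr -E mulmxA mulmxKpV.
Qed.

(** On [dom J c] there is only one candidate: move to [shrink] by [c], apply [h], and come back.
    [A0] and [A1] split a vector linearly into a part in [shrink] and a part in [dom J c], and the
    two prescriptions agree on the overlap. *)
Lemma extends_shrink X : extends_to X N (im shrink).
Proof.
move=> h hh; have [A0 [A1 AE]] := shrink_split.
pose f u := h (iota (u *m A0)) + act (linv c) (h (iota (u *m A1 *m g c))).
have sS := im_subspace shrink.
have fl a u v : (u <= J)%MS -> (v <= J)%MS -> f (a *: u + v) = a *: f u + f v.
  move=> /AE[_ u0 u1] /AE[_ v0 v1]; rewrite /f !(mulmxDl, =^~ scalemxAl) !linearP.
  rewrite !hh.1; try by apply/im_iota => //; apply: dom_c_act.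
  by rewrite !linearP scalerDr addrACA.
have fs u : (u <= shrink)%MS -> f u = h (iota u).
  move=> us; have uJ := submx_trans us shrink_sub.
  have [uE u0 u1] := AE u uJ.
  have u1s : (u *m A1 <= dom shrink c)%MS.
    rewrite dom_shrink_c sub_capmx u1 andbT.
    have -> : u *m A1 = u - u *m A0 by rewrite [X in X - _]uE addrC addKr.
    by rewrite addmx_sub // eqmx_opp.
  rewrite /f (hom_coord hh u1s) actK {3}uE linearD (linonD hh.1) //.
    exact/im_iota.
  by apply/im_iota; move: u1s; rewrite sub_dom => /and3P[].
have fc u : (u <= dom J c)%MS -> f u = act (linv c) (h (iota (u *m g c))).
  move=> ud; have uJ := submx_trans ud (dom_sub _ _).
  have [uE u0 u1] := AE u uJ.
  have u0s : (u *m A0 <= dom shrink c)%MS.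
    rewrite dom_shrink_c sub_capmx u0 /=.
    have -> : u *m A0 = u - u *m A1 by rewrite [X in X - _]uE addrK.
    by rewrite addmx_sub // eqmx_opp.
  rewrite /f {3}uE mulmxDl linearD (linonD hh.1); try exact/im_iota/dom_c_act.
    rewrite linearD /=; congr (_ + _).
    by rewrite (hom_coord hh u0s) actK.
  by apply/im_iota; move: u0s; rewrite sub_dom => /and3P[].
have hf : hom (im J) (f \o inv).
  apply: coord_hom => // c' u ud.
  have [Ec|ne] := eqVneq c' c.
    move: ud; rewrite Ec => ud; rewrite (fc u) // actVK fs //; exact: dom_c_act.
  have us : (u <= shrink)%MS by apply: submx_trans ud (dom_shrink_sub ne).
  rewrite (fs u us); have [Ec|ne'] := eqVneq c' (linv c).
    have := dom_linv_sub ud; rewrite Ec linvK => ud'.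
    by rewrite fc // mul_gVK.
  have uds : (u <= dom shrink c')%MS by rewrite dom_shrink_other.
  rewrite fs; first exact: hom_coord hh uds.
  by move: uds; rewrite sub_dom => /and3P[].
have [H HH HE] := exJ hf; exists H => // _ [u us <-].
rewrite HE /= ?invK ?fs //.
exact/im_iota/(submx_trans us)/shrink_sub.
Qed.

End Shrink.

End Coordinates.

(** * Homomorphisms into the group algebra *)

Section GroupAlgebraSpace.
Context {k : fieldType} {d : nat}.
Implicit Types (c : @letter d) (g h : free_group d) (x y : {malg k[free_group d]}).

Definition lgen c : free_group d := @FreeGroup d [:: c] isT.

Lemma lgenV c : (lgen c)^-1%g = lgen (linv c).
Proof. exact: val_inj. Qed.

Lemma ga_mul_mcoeffU x g h : (ga_mul x << g >>)@_h = x@_(h * g^-1)%g.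
Proof.
rewrite {1}(monalgE x) ga_mul_suml raddf_sum /=.
under eq_bigr => y _ do rewrite ga_mulUU mulr1 mcoeffU.
have E (y : free_group d) : ((y * g)%g == h) = (y == (h * g^-1)%g).
  by apply/eqP/eqP => [<-|->]; rewrite ?mulgK ?mulgVK.
have [xg|nxg] := msuppP.
  rewrite (big_fsetD1 _ xg) /= E eqxx mulr1n big1_fset ?addr0 // => y.
  by rewrite in_fsetD1 E; case: eqP.
rewrite big1_fset // => y ym _; rewrite E; case: eqP => // ey.
by rewrite -ey ym in nxg.
Qed.

Definition rmulg c x : {malg k[free_group d]} := ga_mul x << lgen c >>.

Lemma rmulg_mcoeff c x h : (rmulg c x)@_h = x@_(h * lgen (linv c))%g.
Proof. by rewrite /rmulg ga_mul_mcoeffU lgenV. Qed.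

Lemma rmulg_linear c : linear (rmulg c).
Proof.
move=> a x y; apply/malgP => h.
rewrite [LHS]rmulg_mcoeff [LHS]mcoeffD [RHS]mcoeffD rmulg_mcoeff.
by rewrite [X in _ = X + _]mcoeffZ [X in X + _ = _]mcoeffZ rmulg_mcoeff.
Qed.

HB.instance Definition _ c := GRing.isLinear.Build k {malg k[free_group d]}
  {malg k[free_group d]} _ (rmulg c) (rmulg_linear c).

Lemma rmulgK c x : rmulg (linv c) (rmulg c x) = x.
Proof.
apply/malgP => h; rewrite !rmulg_mcoeff linvK -mulgA -[lgen (linv c)]lgenV.
by rewrite mulgV mulg1.
Qed.

Definition alg_space : fspace k d :=
  @FSpace k d {malg k[free_group d]} (fun c => rmulg c : {linear _ -> _}) rmulgK.

Definition glen g : nat := size (fg_word g).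

Lemma wmul_rcons (u : seq letter) c : reduced (rcons u c) -> wmul u [:: c] = rcons u c.
Proof.
elim: u => //= a u IH; rewrite /reduced /= => pu; rewrite IH; last exact: path_sorted pu.
by case: u pu {IH} => [|b u] /= /andP[/negbTE->].
Qed.

(** Only the inverse of the last letter shortens a reduced word; [None] serves the empty word, where
    nothing cancels. *)
Lemma glen_mul g : exists o : option letter,
  forall c, Some c != o -> glen (g * lgen c)%g = (glen g).+1.
Proof.
case: g => u ru; rewrite /glen /=.
case/lastP: u ru => [|u a] ru; first by exists None.
exists (Some (linv a)) => c ne; rewrite wmul_rcons ?size_rcons //.
move: ru ne; rewrite /reduced -!cats1 -catA /=.
case: u => [|b u] /=; first by move=> _ ne; rewrite andbT.
rewrite !cat_path /= => /and3P[-> -> _] ne; rewrite !andbT; exact: ne.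
Qed.

(* A longest element of the free group occurring in the image of [h] can be
   moved further out by one of the letters allowed by fullness. *)
Lemma full_hom0 (V : fspace k d) (J : set V) (h : V -> alg_space) :
  fd J -> full J -> hom J h -> forall v, J v -> h v = 0.
Proof.
move=> fJ fullJ hh; have sJ := fd_subspace fJ.
pose occ n := exists (x : V) g, [/\ J x, (h x : {malg _[_]})@_g != 0 & glen g = n].
have [B Bmax] : exists B, forall n, `[< occ n >] -> (n <= B)%N.
  have [s sJs sgen] := fd_generators fJ.
  pose B := \max_(x <- s) \max_(g <- msupp (h x : {malg _[_]})) glen g.
  exists B => n /asboolP[x [g [Jx hg <-]]].
  pose S := [set x | J x /\ forall g, (h x : {malg _[_]})@_g != 0 -> (glen g <= B)%N].
  suff : S x by case=> _; apply.
  apply: sgen Jx => [|z zs].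
    split; first by split; [exact: subspace0|move=> g'; rewrite (linon0 sJ hh.1) mcoeff0 eqxx].
    move=> a y z [Jy Sy] [Jz Sz]; split; first exact: sJ.2.
    move=> g'; rewrite hh.1 // mcoeffD mcoeffZ => ne.
    have [e|/Sz//] := eqVneq ((h z : {malg _[_]})@_g') 0.
    by apply: Sy; apply: contra ne => /eqP ->; rewrite e mulr0 addr0.
  split; first exact: sJs.
  move=> g' hg'; apply: leq_trans (leq_bigmax_seq _ zs isT).
  by apply: leq_bigmax_seq => //; rewrite -mcoeff_neq0.
move=> x Jx; apply/eqP/negPn/negP => hx0.
have occE : exists n, `[< occ n >].
  have [g hg] : exists g, (h x : {malg _[_]})@_g != 0.
    apply/not_existsP => hN; case/eqP: hx0; apply/malgP => g; rewrite mcoeff0.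
    by apply/eqP/negPn/negP/hN.
  by exists (glen g); apply/asboolP; exists x, g.
case: (ex_maxnP occE Bmax) => n /asboolP[y [g [Jy hg gn]]] nmax.
have [o go] := glen_mul g.
pose S := [set x | J x /\ (h x : {malg _[_]})@_g = 0].
have sS : subspace S.
  split; first by split; [exact: subspace0|rewrite (linon0 sJ hh.1) mcoeff0].
  move=> a u v [Ju Su] [Jv Sv]; split; first exact: sJ.2.
  by rewrite hh.1 // mcoeffD mcoeffZ Su Sv mulr0 addr0.
have [] : S y; last by move=> _ e; rewrite e eqxx in hg.
apply: (fullJ o S sS) Jy => c e ne Je Jce; split=> //.
apply/eqP/negPn/negP => he.
suff : (n.+1 <= n)%N by rewrite ltnn.
apply: nmax; apply/asboolP; exists (act c e), (g * lgen c)%g; split=> //.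
  rewrite hh.2 //= rmulg_mcoeff -lgenV mulgK //.
by rewrite go // gn.
Qed.

(** Reaching the value 1 amounts to splitting off a free summand of rank one; [algebraic_no_free]
    and [no_free_algebraic] identify this condition with [algebraic]. *)
Definition no_free_quotient (V : fspace k d) (N : set V) :=
  forall H : V -> alg_space, hom N H -> forall v, N v -> H v != << 1%g >>.

Lemma full_no_free_quotient (V : fspace k d) (J : set V) :
  fd J -> full J -> no_free_quotient (cl J).
Proof.
move=> fJ fullJ H HH x cx; have : H x = 0; last first.
  by move=> ->; rewrite eq_sym monalgU_eq0 oner_eq0.
have J0 := full_hom0 fJ fullJ (hom_sub (@cl_sub _ _ _ _) HH).
have hh0 : hom (cl J) (fun=> 0 : alg_space).
  split; first by move=> a u v _ _; rewrite scaler0 addr0.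
  by move=> c u _ _; rewrite linear0.
exact: (hom_ext (stable_cl J) (@cl_sub _ _ _ J) HH hh0 J0 cx).
Qed.

End GroupAlgebraSpace.

(** * Full systems and the full window of a submodule *)

Section FullSystems.
Context {k : fieldType} {d : nat} {V : fspace k d} {m : nat}.
Context {iota : {linear 'rV[k]_m -> V}} {D g : @letter d -> 'M[k]_m}.
Hypothesis wc : window_coord iota D g.
Implicit Types (X : fspace k d) (b c : @letter d) (J E : 'M[k]_m) (u v w : 'rV[k]_m).
Implicit Types (I : 'I_d -> 'M[k]_m).

Notation im := (@im k d V m iota).
Notation dom := (@dom k d m D g).
Notation genD := (@genD k d m D g).
Notation shrink := (@shrink k d m D g).

(** The domain of the letter [c] when generator [i] is restricted to [I i]: an inverse letter is
    defined on the image. *)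
Definition ends I c := if c.2 then I c.1 else I c.1 *m g (c.1, true).

Definition hull I := (\sum_c ends I c)%MS.

(** The matrix form of [full] for the hull, see [full_im_hull]. The domains are recorded separately
    because [I i] may be smaller than [genD (hull I) i]. *)
Record full_system I : Prop := FullSystem {
  fs_dom : forall i, (I i <= D (i, true))%MS;
  fs_full : forall c, (ends I c <= \sum_(c' | c' != c) ends I c')%MS }.

Lemma ends_hull I c : (ends I c <= hull I)%MS.
Proof. exact: (sumsmx_sup c). Qed.

Lemma full_system_hull I c : full_system I ->
  (hull I <= \sum_(c' | c' != c) ends I c')%MS.
Proof.
move=> [_ h]; apply/sumsmx_subP => c' _; have [->|ne] := eqVneq c' c; first exact: h.
exact: (sumsmx_sup c').
Qed.

Lemma ends_dom I c : (forall i, I i <= D (i, true))%MS ->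
  (ends I c <= dom (hull I) c)%MS.
Proof.
move=> ID; apply/row_subP => i; set u := row _ _.
have uE : (u <= ends I c)%MS by apply: row_sub.
case: c @u uE => j [] u uE; rewrite (sub_dom wc) // (submx_trans uE (ends_hull _ _)) /=.
  rewrite (submx_trans uE (ID _)) /=; apply: submx_trans (ends_hull I (j, false)).
  exact: submxMr uE.
have uE' : (u *m g (j, false) <= I j)%MS.
  by have /(submxMr (g (j, false))) := uE; rewrite -mulmxA (wc_gK wc (j, true)) mulmx1.
apply/andP; split; last exact: submx_trans uE' (ends_hull I (j, true)).
have := window_D_linv wc (c := (j, true)) (submx_trans uE' (ID j)).
by rewrite (mul_gK wc (j, false)).
Qed.

Lemma genD_hull I i : (forall i, I i <= D (i, true))%MS ->
  (I i <= genD (hull I) i)%MS.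
Proof. by move=> ID; apply: (ends_dom (i, true) ID). Qed.

Lemma full_im_hull I : full_system I -> full (im (hull I)).
Proof.
move=> fI o S sS hS; have ID := fs_dom fI.
have le : (hull I <= \sum_(c | Some c != o) ends I c)%MS.
  case: o {hS} => [c|].
    apply: submx_trans (full_system_hull c fI) _.
    by apply/sumsmx_subP => c' ne; apply: (sumsmx_sup c').
  by apply/sumsmx_subP => c _; apply: (sumsmx_sup c).
move=> _ [u uJ <-]; have /sub_sumsmxP[w ->] := submx_trans uJ le.
rewrite linear_sum; apply: subspace_sum => // c ne.
have wE : (w c *m ends I c <= dom (hull I) c)%MS.
  by apply: submx_trans (submxMl _ _) (ends_dom c ID).
apply: (hS c) => //; first by apply/(im_iota wc); apply: submx_trans wE (dom_sub wc _ _).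
rewrite (dom_act wc wE); apply/(im_iota wc).
by move: wE; rewrite (sub_dom wc) // => /and3P[].
Qed.

Lemma hull_genD J : (J <= \sum_c dom J c)%MS ->
  (hull (genD J) :=: J)%MS.
Proof.
have E c : (ends (genD J) c :=: dom J c)%MS.
  case: c => i [] /=; first exact: eqmx_refl.
  by apply: eqmx_sym; apply: (dom_linv wc J (i, true)).
move=> le; apply/eqmxP/andP; split.
  by apply/sumsmx_subP => c _; rewrite E (dom_sub wc).
apply: submx_trans le _; apply/sumsmx_subP => c _.
by apply: (sumsmx_sup c) => //; rewrite E.
Qed.

Lemma genD_full_system J :
  (forall c, J <= \sum_(c' | c' != c) dom J c')%MS ->
  full_system (genD J).
Proof.
have E c : (ends (genD J) c :=: dom J c)%MS.
  case: c => i [] /=; first exact: eqmx_refl.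
  by apply: eqmx_sym; apply: (dom_linv wc J (i, true)).
move=> h; split.
  move=> i; apply/row_subP => j; set u := row _ _.
    have : (u <= dom J (i, true))%MS by apply: row_sub.
    by rewrite (sub_dom wc) => /and3P[].
move=> c; rewrite E; apply: submx_trans (dom_sub wc J c) _.
apply: submx_trans (h c) _; apply/sumsmx_subP => c' ne.
by apply: (sumsmx_sup c') => //; rewrite E.
Qed.

Hypothesis wV : fwin setT (im 1%:M).
Hypothesis clV : cl (im 1%:M) = setT.

Lemma coords_meet (N : set V) (K : 'M[k]_m) :
  (forall u, (u <= K)%MS <-> N (iota u)) -> N `&` im 1%:M = im K.
Proof.
move=> NK; apply/seteqP; split=> [x [nx [u _ ux]]|_ [u /NK uK <-]]; last first.
  by split=> //; exists u; rewrite ?submx1.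
by rewrite -ux; apply/(im_iota wc)/NK; rewrite ux.
Qed.

(** The chain construction is run into the group algebra from the zero map with [x0] equal to 1. A
    free choice would give a homomorphism reaching 1, so every vector of [N] was forced. *)
Lemma coords_generate (N : set V) (K : 'M[k]_m) :
  stable N -> no_free_quotient N -> (forall u, (u <= K)%MS <-> N (iota u)) ->
  cl (im K) = N.
Proof.
move=> sN nfN NK; apply/seteqP; split.
  by apply: cl_min => // _ [u /NK uK <-].
have hh : hom (N `&` im 1%:M) (fun=> 0 : alg_space).
  by split=> [a u v _ _|c u _ _]; rewrite ?scaler0 ?addr0 ?linear0.
have [H [HH HE] [[e ne He]|]] :=
  chain_extension (<< 1%g >> : alg_space) (im_fd wc 1%:M) wV clV sN hh; last by rewrite (coords_meet NK).
by have := nfN H HH e ne; rewrite He eqxx.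
Qed.

(** The trace [K] is shrunk at a letter [c] whenever the domains of the other letters fail to span
    it. Ranks drop, while [defect], the generated submodule and the extension property persist; when
    no letter is left, the domains form a full system. *)
Theorem full_system_exists (N : set V) (K : 'M[k]_m) :
  stable N -> no_free_quotient N -> (forall u, (u <= K)%MS <-> N (iota u)) ->
  exists I, [/\ full_system I, cl (im (hull I)) = N,
    forall X, extends_to X N (im (hull I)),
    forall i, (I i :=: genD (hull I) i)%MS &
    defect (hull I) I = defect K (genD K)].
Proof.
move=> sN nfN NK; have KE := coords_meet NK.
have exK X : extends_to X N (im K).
  move=> h; rewrite -KE => hh.
  have [H [HH HE] _] := chain_extension (0 : X) (im_fd wc 1%:M) wV clV sN hh.
  by exists H.
have clK := coords_generate sN nfN NK.
set xi0 := defect K _.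
suff main n J : defect J (genD J) = xi0 -> cl (im J) = N ->
    (forall X, extends_to X N (im J)) -> (\rank J < n)%N ->
    exists I, [/\ full_system I, cl (im (hull I)) = N,
      forall X, extends_to X N (im (hull I)),
      forall i, (I i :=: genD (hull I) i)%MS &
      defect (hull I) I = xi0].
  exact: (main (\rank K).+1 K).
elim: n J => // n IH J xiJ clJ exJ rJ.
(* Otherwise a functional [la] kills all domains. The map it defines into the group algebra has only
   trivial equivariance conditions and reaches 1, against [nfN]. *)
have cover : (J <= \sum_c dom J c)%MS.
  apply/negPn/negP => ncov.
  have [la la0 [i lai]] : exists2 la : 'cV[k]_m, (\sum_c dom J c)%MS *m la = 0 &
      exists i, (row i J *m la) 0 0 = 1.
    move: ncov; rewrite submxE; have := mulmx_coker (\sum_c dom J c)%MS.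
    move: (cokermx _) => C SC /matrix0Pn[i [j ne]].
    exists (((J *m C) i j)^-1 *: col j C).
      by rewrite colE -scalemxAr mulmxA SC mul0mx scaler0.
    have e : (row i J *m col j C) 0 0 = (J *m C) i j.
      by rewrite !mxE; apply: eq_bigr => l _; rewrite !mxE.
    by exists i; rewrite -scalemxAr mxE e mulVf.
  pose f u : @alg_space k d := (u *m la) 0 0 *: (<< 1%g >> : {malg k[free_group d]}).
  have f0 c u : (u <= dom J c)%MS -> f u = 0.
    move=> ud; have /submxP[w ->] : (u <= \sum_c dom J c)%MS by apply: (sumsmx_sup c).
    by rewrite /f -mulmxA la0 mulmx0 mxE scale0r.
  have hf : hom (im J) (f \o inv (iota := iota)).
    apply: (coord_hom wc) => [a u v _ _|c u ud].
      by rewrite /f mulmxDl -scalemxAl !mxE scalerDl scalerA.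
    rewrite (f0 c u ud) linear0 (f0 (linv c)) //.
    exact: (dom_linv_sub wc ud).
  have [H HH HE] := exJ _ _ hf.
  have Ji : im J (iota (row i J)) by apply/(im_iota wc); apply: row_sub.
  have /eqP[] : H (iota (row i J)) != << 1%g >>.
    by apply: nfN => //; rewrite -clJ; apply: cl_sub.
  by rewrite HE //= (invK wc) /f lai scale1r.
have [h|/existsNP[c /negP nJ]] :=
    pselect (forall c, (J <= \sum_(c' | c' != c) dom J c')%MS).
  have E := hull_genD cover.
  have F i : (genD J i :=: genD (hull (genD J)) i)%MS.
    apply/eqmxP/andP; rewrite /genD; split; apply/row_subP => j;
    set u := row _ _; have : (u <= _)%MS := row_sub j _;
    by rewrite !(sub_dom wc) !E.
  exists (genD J); split=> //.
  - exact: genD_full_system.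
  - by rewrite (im_eqmx wc E).
  - by move=> X; rewrite (im_eqmx wc E).
  - by rewrite -xiJ /defect E.
have lt : (\rank (shrink J c) < \rank J)%N.
  have := mxrank_leqif_sup (shrink_sub wc J c) => -[le e].
  by rewrite ltn_neqAle le e nJ.
apply: (IH (shrink J c)).
- by rewrite -xiJ (defect_shrink wc c cover).
- exact: (cl_shrink wc).
- by move=> X; apply: (extends_shrink wc).
- exact: leq_trans lt _.
Qed.

End FullSystems.

(** * Comparison of full systems by counting *)

Lemma card_field_gt1 (k : finFieldType) : (1 < #|k|)%N.
Proof. by rewrite (cardD1 0) (cardD1 1) !inE oner_eq0. Qed.

Section Uniqueness.
Context {k : finFieldType} {d : nat} {V : fspace k d} {m : nat}.
Context {iota : {linear 'rV[k]_m -> V}} {D g : @letter d -> 'M[k]_m}.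
Hypothesis wc : window_coord iota D g.
Implicit Types (X : fspace k d) (b c : @letter d) (J E : 'M[k]_m) (u v w : 'rV[k]_m).
Implicit Types (I : 'I_d -> 'M[k]_m).

Notation im := (@im k d V m iota).
Notation dom := (@dom k d m D g).
Notation genD := (@genD k d m D g).
Notation hull := (@hull k d m g).
Notation full_system := (@full_system k d m D g).
Notation inv := (@inv k d V m iota).

Lemma mx_hom n (rho : @letter d -> 'M[k]_n)
    (rhoK : forall c, rho c *m rho (linv c) = 1%:M) J I (h : 'M[k]_(m, n)) :
  (forall i, (genD J i <= I i)%MS) ->
  (forall i, I i *m (g (i, true) *m h - h *m rho (i, true)) = 0) ->
  hom (im J) (fun x => inv x *m h : mxspace rhoK).
Proof.
move=> JI hI; apply: (coord_hom wc (X := mxspace rhoK) (f := fun u => u *m h)).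
  by move=> a u v _ _; rewrite mulmxDl scalemxAl.
have gen i u : (u <= dom J (i, true))%MS -> u *m g (i, true) *m h = u *m h *m rho (i, true).
  move=> ud; have /submxP[w ->] := submx_trans ud (JI i).
  have := congr1 (mulmx w) (hI i); rewrite mulmx0 mulmxBr mulmxBr !mulmxA.
  by move/eqP; rewrite subr_eq0 => /eqP.
case=> i [] u ud /=; first exact: gen.
have := gen i _ (dom_linv_sub wc ud); rewrite (mul_gK wc (i, false)) => ->.
by rewrite -[RHS]mulmxA (rhoK (i, true) : _ *m rho (i, false) = _) mulmx1.
Qed.

Lemma row_full_mulI p q n (A : 'M[k]_(p, q)) :
  row_full A -> injective (fun z : 'M_(q, n) => A *m z).
Proof.
move=> /row_fullP[B BA] x y e.
by have := congr1 (mulmx B) e; rewrite !mulmxA BA !mul1mx.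
Qed.

Lemma card_mulmx_image n (C : 'M[k]_m) :
  #|[set C *m z | z : 'M[k]_(m, n)]%SET| = (#|k| ^ (\rank C * n))%N.
Proof.
have -> : [set C *m z | z : 'M[k]_(m, n)]%SET =
          [set col_base C *m w | w : 'M[k]_(\rank C, n)]%SET.
  apply/setP => x; apply/imsetP/imsetP => -[z _ ->].
    by exists (row_base C *m z); rewrite // mulmxA mulmx_base.
  exists (pinvmx (row_base C) *m z) => //.
  rewrite -[X in _ = X *m _]mulmx_base -(mulmxA (col_base C)) (mulmxA (row_base C)).
  by rewrite mulmxVp ?mul1mx ?row_base_free.
rewrite card_imset ?card_mx // => x y e.
exact: (row_full_mulI (col_base_full C)) e.
Qed.

Section Compare.
Variables (N : set V) (I I' : 'I_d -> 'M[k]_m).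
Let J := hull I.
Let J' := hull I'.
Hypothesis sN : stable N.
Hypothesis fI : full_system I.
Hypothesis fI' : full_system I'.
Hypothesis clJ : cl (im J) = N.
Hypothesis clJ' : cl (im J') = N.
Hypothesis exJ' : forall X, extends_to X N (im J').
Hypothesis I'E : forall i, (I' i :=: genD J' i)%MS.

Lemma compare_hull : (J <= J')%MS.
Proof.
apply/(im_mono wc); apply: (@full_sub_window _ _ _ N).
- exact: im_fd wc _.
- exact: im_fd wc _.
- split=> //; first by rewrite -clJ'; apply: cl_sub.
- by rewrite clJ' -clJ; apply: cl_sub.
- exact: (full_im_hull wc fI).
Qed.

Lemma compare_gen i : (I i <= I' i)%MS.
Proof.
rewrite I'E; apply/row_subP => j; set u := row _ _.
have : (u <= dom J (i, true))%MS.
  by apply: submx_trans (row_sub _ _) (genD_hull wc _ (fs_dom fI)).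
rewrite /genD !(sub_dom wc) => /and3P[uJ -> uJg].
by rewrite !(submx_trans _ compare_hull).
Qed.

Let C := (J' :\: J)%MS.
Let Ci i := (I' i :\: I i)%MS.
(** The projection onto [C] along [J], written in the basis of [C]. *)
Lemma compare_coord : {P : 'M[k]_(m, \rank C) | J *m P = 0 & row_base C *m P = 1%:M}.
Proof.
exists (proj_mx C J *m pinvmx (row_base C)).
  by rewrite mulmxA proj_mx_0 ?mul0mx // capmx_diff.
rewrite mulmxA proj_mx_id ?capmx_diff ?mulmxVp ?row_base_free //.
by rewrite eq_row_base.
Qed.

Let P := s2val compare_coord.
Let JP : J *m P = 0 := s2valP compare_coord.
Let CP : row_base C *m P = 1%:M := s2valP' compare_coord.

Let I_J i : (I i <= J)%MS.
Proof. exact: (ends_hull I (i, true)). Qed.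

Let Ig_J i : (I i *m g (i, true) <= J)%MS.
Proof. exact: (ends_hull I (i, false)). Qed.

Let subP p (A : 'M_(p, m)) : (A <= J)%MS -> A *m P = 0.
Proof. by move=> /submxP[w ->]; rewrite -mulmxA JP mulmx0. Qed.

Let I'_split i : (I' i <= Ci i + I i)%MS.
Proof. by rewrite -(addsmx_diff_cap_eq (I' i) (I i)) addsmxS // capmxSr. Qed.

Let kill_I' n i (A : 'M_(m, n)) : Ci i *m A = 0 -> I i *m A = 0 -> I' i *m A = 0.
Proof.
by move=> e1 e2; have /sub_addsmxP[[a b] /= ->] := I'_split i;
   rewrite mulmxDl -!mulmxA e1 e2 !mulmx0 addr0.
Qed.

Section Rep.
Variables (n : nat) (rho : @letter d -> 'M[k]_n).
Hypothesis rhoK : forall c, rho c *m rho (linv c) = 1%:M.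

(** [P *m y] represents the linear maps on [J'] that vanish on [J], and [T y] is their failure of
    equivariance on the complements [Ci i]; on [I i] there is none. *)
Let T (y : 'M[k]_(\rank C, n)) : {ffun 'I_d -> 'M[k]_(m, n)} :=
  [ffun i => Ci i *m (g (i, true) *m (P *m y) - P *m y *m rho (i, true))].

Let FT := family (fun i => [set Ci i *m z | z : 'M[k]_(m, n)]%SET).

Let card_FT : #|FT| = (#|k| ^ ((\sum_i \rank (Ci i)) * n))%N.
Proof.
rewrite card_family foldrE big_map big_enum big_distrl /= expn_sum.
by apply: eq_big => // i _; apply: card_mulmx_image.
Qed.

Let T_FT y : T y \in FT.
Proof. by apply/familyP => i; rewrite ffunE; apply/imsetP; eexists. Qed.

(** Where the failure of equivariance vanishes, [P *m y] extends to [N], and there it is 0 because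
    it is 0 on the generating [J]. *)
Let T_inj : injective T.
Proof.
move=> y1 y2 /ffunP e; apply/eqP; rewrite -subr_eq0; set y := y1 - y2.
pose h := P *m y.
have hI i : I' i *m (g (i, true) *m h - h *m rho (i, true)) = 0.
  apply: kill_I'; last first.
    by rewrite /h mulmxBr !mulmxA subP // subP // !mul0mx subrr.
  have := e i; rewrite !ffunE => /eqP; rewrite -subr_eq0 => /eqP <-.
  rewrite -mulmxBr /h /y; congr (_ *m _).
  by rewrite !mulmxBr mulmxBl !opprB !addrA [LHS](ACl (1*4*3*2))%AC.
have gI i : (genD J' i <= I' i)%MS by rewrite -I'E.
have [H HH HE] := exJ' (mx_hom rhoK gI hI).
have H0 x : N x -> H x = 0.
  rewrite -[in N x]clJ; apply: (@hom_ext _ _ _ _ N (im J) H (fun=> 0)) => //.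
  - by rewrite -clJ; apply: cl_sub.
  - by split=> [a u v _ _|c u _ _]; rewrite ?scaler0 ?addr0 ?linear0.
  - move=> _ [u uJ <-]; rewrite HE; last by apply/(im_iota wc)/(submx_trans uJ)/compare_hull.
    by rewrite (invK wc) /h mulmxA subP // mul0mx.
have J'h : J' *m h = 0.
  apply/row_matrixP => i; rewrite row_mul row0.
  have rJ : (row i J' <= J')%MS by apply: row_sub.
  have := HE (iota (row i J')) ((im_iota wc _ _).2 rJ).
  by rewrite (invK wc) => <-; apply: H0; rewrite -clJ'; apply: cl_sub; apply/(im_iota wc).
apply/eqP; rewrite -[y]mul1mx -CP -mulmxA.
have /submxP[w ->] : (row_base C <= J')%MS by rewrite eq_row_base diffmxSl.
by rewrite -mulmxA J'h mulmx0.
Qed.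

Lemma compare_card : (#|k| ^ (\rank C * n) <= #|k| ^ ((\sum_i \rank (Ci i)) * n))%N.
Proof.
rewrite -card_FT -card_mx -(card_imset _ T_inj); apply: subset_leq_card.
by apply/fintype.subsetP => _ /imsetP[y _ ->].
Qed.

(** Equal dimensions make [T] bijective, so whatever equivariance a linear extension of [h] to [J']
    lacks can be repaired by adding some [P *m y]; then [J'] extends it to [N]. *)
Lemma compare_extends : (\rank C = \sum_i \rank (Ci i))%N ->
  extends_to (mxspace rhoK) N (im J).
Proof.
move=> eC h hh.
have surj z : z \in FT -> exists y, T y = z.
  have : [set T y | y : 'M[k]_(\rank C, n)]%SET = [set z in FT]%SET.
    apply/eqP; rewrite eqEcard; apply/andP; split.
      by apply/fintype.subsetP => _ /imsetP[y _ ->]; rewrite inE.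
    by rewrite cardsE card_FT (card_imset _ T_inj) card_mx eC.
  move=> e zF; have : z \in [set z in FT]%SET by rewrite inE.
  by rewrite -e => /imsetP[y _ ->]; exists y.
have sJ : subspace (im J) by apply: im_subspace.
have [phi phiE] : exists phi : 'M_(m, n), forall u, (u <= J)%MS -> h (iota u) = u *m phi.
  exists (pinvmx J *m (\matrix_j (h (iota (row j J)) : 'rV_n))) => u uJ.
  rewrite mulmxA -{1}(mulmxKpV uJ); move: (u *m pinvmx J) => w.
  rewrite !mulmx_sum_row linear_sum (linon_sum _ sJ hh.1); last first.
    by move=> j _; rewrite linearZ; apply: subspaceZ => //; apply/(im_iota wc); apply: row_sub.
  apply: eq_bigr => j _; rewrite linearZ (linonZ _ sJ hh.1) ?rowK //.
  by apply/(im_iota wc); apply: row_sub.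
have [|y Ty] := surj [ffun i => Ci i *m (phi *m rho (i, true) - g (i, true) *m phi)].
  by apply/familyP => i; rewrite ffunE; apply/imsetP; eexists.
pose psi := phi + P *m y.
have psiI i : I' i *m (g (i, true) *m psi - psi *m rho (i, true)) = 0.
  apply: kill_I'.
    move/ffunP/(_ i): Ty; rewrite !ffunE => e.
    rewrite /psi [g _ *m (_ + _)]mulmxDr mulmxDl opprD addrACA mulmxDr e -mulmxDr.
    by rewrite -[X in _ + X]opprB subrr mulmx0.
  apply/row_matrixP => j; rewrite row_mul row0; set u := row _ _.
  have uI : (u <= I i)%MS by apply: row_sub.
  have ud : (u <= dom J (i, true))%MS.
    by apply: submx_trans uI (genD_hull wc _ (fs_dom fI)).
  have ugJ : (u *m g (i, true) <= J)%MS by apply: submx_trans (submxMr _ uI) _.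
  have uJ : (u <= J)%MS by apply: submx_trans uI _.
  have := hom_coord wc hh ud; rewrite !phiE //= => e.
  by rewrite /psi mulmxBr !mulmxDr mulmxDl mulmxDr !mulmxA !subP // !mul0mx !addr0 e subrr.
have gI i : (genD J' i <= I' i)%MS by rewrite -I'E.
have [H HH HE] := exJ' (mx_hom rhoK gI psiI).
exists H => // _ [u uJ <-].
rewrite HE; last by apply/(im_iota wc)/(submx_trans uJ)/compare_hull.
by rewrite (invK wc) /psi mulmxDr mulmxA subP // mul0mx addr0 phiE.
Qed.

End Rep.

Let rankC : (\rank J' = \rank J + \rank C)%N.
Proof.
have := mxrank_cap_compl J' J; rewrite -/C => <-; congr (_ + _)%N.
by apply/eqmx_rank/andP; rewrite capmxSr sub_capmx compare_hull /=.
Qed.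

Let rankCi i : (\rank (I' i) = \rank (I i) + \rank (Ci i))%N.
Proof.
have := mxrank_cap_compl (I' i) (I i); rewrite -/(Ci i) => <-; congr (_ + _)%N.
by apply/eqmx_rank/andP; rewrite capmxSr sub_capmx compare_gen /=.
Qed.

Let sum_rankCi :
  (\sum_i \rank (I' i) = \sum_i \rank (I i) + \sum_i \rank (Ci i))%N.
Proof. by rewrite -big_split; apply: eq_bigr => i _; rewrite rankCi. Qed.

Theorem defect_min : (defect J' I' <= defect J I)%R.
Proof.
(* The trivial one-dimensional module is enough to compare the exponents. *)
have := @compare_card 1 (fun=> 1%:M) (fun=> mul1mx _).
rewrite !muln1 leq_exp2l ?card_field_gt1 // /defect rankC sum_rankCi.
lia.
Qed.

(** With equality [J] passes the test of a window as well, so [full_sub_window] applies with the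
    roles exchanged. *)
Theorem defect_min_eq : defect J' I' = defect J I ->
  (J :=: J')%MS /\ forall i, (I i :=: I' i)%MS.
Proof.
rewrite /defect rankC sum_rankCi => e.
have eC : (\rank C = \sum_i \rank (Ci i))%N by lia.
have JJ' : (J' <= J)%MS.
  apply/(im_mono wc); apply: (@full_sub_window _ _ _ N).
  - exact: im_fd wc _.
  - exact: im_fd wc _.
  - split=> //; first by rewrite -clJ; apply: cl_sub.
    by move=> n rho rhoK; apply: compare_extends.
  - by rewrite clJ -clJ'; apply: cl_sub.
  - exact: (full_im_hull wc fI').
have EJ : (J :=: J')%MS by apply/eqmxP; rewrite compare_hull JJ'.
split=> // i; apply/eqmxP; rewrite compare_gen /=.
have C0 : \rank C = 0%N by have := rankC; rewrite EJ; lia.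
move: eC; rewrite C0 => /esym/eqP; rewrite sum_nat_eq0 => /forallP/(_ i)/= /eqP Ci0.
rewrite -(mxrank_leqif_sup (compare_gen i)) rankCi Ci0 addn0 //.
Qed.

End Compare.
End Uniqueness.

(** * Trace duality over a finite field *)

Section Radicals.
Variables (k : finFieldType).

Lemma card_level_set (T : finType) (h : T -> k) (s : k -> T -> T) :
  (forall a, injective (s a)) -> (forall a u, h (s a u) = h u + a) ->
  (#|[set u | (h u == 0)%R]%SET| * #|k| = #|T|)%N.
Proof.
move=> s_inj hs; rewrite -[RHS]sum1_card (partition_big h predT) //=.
rewrite -[X in (_ * X)%N]sum1_card big_distrr /=; apply: eq_big => // a _.
rewrite muln1 sum1dep_card -[RHS](card_preimset _ (@s_inj a)).
by apply: eq_card => u; rewrite !inE hs -[RHS]subr_eq0 addrK.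
Qed.

(** The zeros of [b] are counted by rows and by columns. A [v] in the radical is orthogonal to all
    of [U], any other [v] to exactly |U|/q points, since the translations [su] make all level sets
    equally large. *)
Lemma card_radicals (U V : finType) (b : U -> V -> k) (su : V -> k -> U -> U)
    (sv : U -> k -> V -> V) :
  (forall v a, injective (su v a)) -> (forall u a, injective (sv u a)) ->
  (forall v a u, ~~ [forall u, b u v == 0] -> b (su v a u) v = b u v + a) ->
  (forall u a v, ~~ [forall v, b u v == 0] -> b u (sv u a v) = b u v + a) ->
  (#|[set u | [forall v, (b u v == 0)%R]]%SET| * #|V| =
   #|[set v | [forall u, (b u v == 0)%R]]%SET| * #|U|)%N.
Proof.
move=> su_inj sv_inj suE svE.
have count (T1 T2 : finType) (b' : T1 -> T2 -> k) s :
    (forall v a, injective (s v a)) ->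
    (forall v a u, ~~ [forall u, (b' u v == 0)%R] -> b' (s v a u) v = b' u v + a) ->
    (#|k| * (\sum_v #|[set u | (b' u v == 0)%R]%SET|) =
     #|T1| * (#|T2| + #|k|.-1 * #|[set v | [forall u, (b' u v == 0)%R]]%SET|))%N.
  move=> s_inj sE; rewrite big_distrr /=.
  rewrite (bigID [pred v | [forall u, (b' u v == 0)%R]]) /=.
  rewrite (eq_bigr (fun=> #|k| * #|T1| * 1)%N); last first.
    move=> v /forallP h; rewrite muln1; congr (_ * _)%N; rewrite -cardsT.
    by apply: eq_card => u; rewrite !inE h.
  rewrite [X in (_ + X)%N](eq_bigr (fun=> #|T1| * 1)%N); last first.
    move=> v nv; rewrite mulnC muln1; apply: card_level_set (s_inj v) _ => a u.
    exact: sE.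
  rewrite -!big_distrr /= !sum1dep_card; set S := [set v | _]%SET.
  have -> : [set v | ~~ [forall u, (b' u v == 0)%R]]%SET = (~: S)%SET.
    by apply/setP => v; rewrite !inE.
  rewrite -(cardsC S); have := card_field_gt1 k.
  by move: #|S| #|~: S|%SET #|T1| => x y z; case: #|k| => // q _ /=; nia.
have e1 := count _ _ b su su_inj suE.
have e2 := count _ _ (fun v u => b u v) sv sv_inj svE.
have e3 : (\sum_v #|[set u | (b u v == 0)%R]%SET| = \sum_u #|[set v | (b u v == 0)%R]%SET|)%N.
  rewrite (eq_bigr (fun v => \sum_(u | (b u v == 0)%R) 1)%N); last first.
    by move=> v _; rewrite sum1dep_card.
  rewrite (exchange_big_dep predT) //=; apply: eq_bigr => u _.
  by rewrite sum1dep_card.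
move: e1; rewrite e3 e2 => e.
have := card_field_gt1 k; move: e; move: (#|[set _ | _]%SET|) (#|[set _ | _]%SET|) => x y.
case: #|k| => [//|[//|q]] /=; move: #|U| #|V| => u v; nia.
Qed.

End Radicals.

Section Adjoint.
Variables (k : finFieldType) (d m n : nat).
Variables (A B : 'I_d -> 'M[k]_m) (gam : 'I_d -> 'M[k]_n).

Let b (f : 'M[k]_(m, n)) (tau : {ffun 'I_d -> 'M[k]_(n, m)}) : k :=
  \sum_i \tr ((A i *m f *m gam i - B i *m f) *m tau i).

Let bE f tau : b f tau = \tr (f *m \sum_i (gam i *m tau i *m A i - tau i *m B i)).
Proof.
rewrite mulmx_sumr raddf_sum /=; apply: eq_bigr => i _.
rewrite mulmxBl mulmxBr !raddfB /=; congr (_ - _).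
  by rewrite -!mulmxA mxtrace_mulC !mulmxA.
by rewrite -mulmxA mxtrace_mulC mulmxA.
Qed.

Lemma trace_delta p q (M : 'M[k]_(p, q)) i j : \tr (M *m delta_mx j i) = M i j.
Proof.
rewrite /mxtrace (bigD1 i) //= big1 ?addr0 => [|l ne].
  rewrite mxE (bigD1 j) //= big1 ?addr0 => [|l ne].
    by rewrite mxE !eqxx mulr1.
  by rewrite mxE (negbTE ne) mulr0.
by rewrite mxE big1 // => l' _; rewrite mxE (negbTE ne) andbF mulr0.
Qed.

Lemma trace_eq0 p q (M : 'M[k]_(p, q)) : (forall N, \tr (M *m N) = 0) -> M = 0.
Proof.
by move=> h; apply/matrixP => i j; rewrite -trace_delta h mxE.
Qed.

(* Trace duality between [f |-> A f gam - B f] and its transpose. *)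
Lemma card_adjoint_kernels :
  (#|[set f : 'M[k]_(m, n) | [forall i, (A i *m f *m gam i == B i *m f)%R]]%SET|
     * #|k| ^ (d * (n * m)) =
   #|[set tau : {ffun 'I_d -> 'M[k]_(n, m)} |
       (\sum_i (gam i *m tau i *m A i) == \sum_i (tau i *m B i))%R]%SET|
     * #|k| ^ (m * n))%N.
Proof.
have -> : (#|k| ^ (d * (n * m)) = #|{ffun 'I_d -> 'M[k]_(n, m)}|)%N.
  by rewrite card_ffun card_mx card_ord -expnM mulnC.
rewrite -card_mx.
have -> : [set f : 'M[k]_(m, n) | [forall i, A i *m f *m gam i == B i *m f]]%SET =
  [set f | [forall tau, b f tau == 0]]%SET.
  apply/setP => f; rewrite !inE; apply/forallP/forallP => h.
    move=> tau; apply/eqP; rewrite /b big1 // => i _.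
    by rewrite (eqP (h i)) subrr mul0mx raddf0.
  move=> i; rewrite -subr_eq0; apply/eqP/trace_eq0 => N.
  have := h [ffun j => if j == i then N else 0].
  rewrite /b (bigD1 i) //= ffunE eqxx big1 ?addr0 => [/eqP //|j ne].
  by rewrite ffunE (negbTE ne) mulmx0 raddf0.
have -> : [set tau : {ffun 'I_d -> 'M[k]_(n, m)} |
       \sum_i (gam i *m tau i *m A i) == \sum_i (tau i *m B i)]%SET =
  [set tau | [forall f, b f tau == 0]]%SET.
  apply/setP => tau; rewrite !inE -subr_eq0 -sumrB; apply/eqP/forallP => h.
    by move=> f; rewrite bE h mulmx0 raddf0.
  by apply/trace_eq0 => N; rewrite mxtrace_mulC; apply/eqP; rewrite -bE.
have bDl f1 f2 tau : b (f1 + f2) tau = b f1 tau + b f2 tau.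
  by rewrite !bE mulmxDl raddfD.
have bZl a f tau : b (a *: f) tau = a * b f tau.
  by rewrite !bE -scalemxAl linearZ.
have bDr f t1 t2 : b f (t1 + t2) = b f t1 + b f t2.
  rewrite /b -big_split; apply: eq_bigr => i _ /=.
  by rewrite ffunE mulmxDr raddfD.
have bZr a f tau : b f (a *: tau) = a * b f tau.
  rewrite /b big_distrr; apply: eq_bigr => i _ /=.
  by rewrite ffunE -scalemxAr linearZ.
(* A partner with nonzero pairing. The default 0 occurs only on the radical, where nothing but
   injectivity of the translation is required. *)
pose fu tau : 'M_(m, n) := odflt 0 [pick f | b f tau != 0].
pose ft f : {ffun 'I_d -> 'M[k]_(n, m)} := odflt 0 [pick tau | b f tau != 0].
pose su tau a u := u + (a / b (fu tau) tau) *: fu tau.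
pose sv f a t := t + (a / b f (ft f)) *: ft f.
apply: (@card_radicals k _ _ b su sv).
- by move=> v a x y /addIr.
- by move=> v a x y /addIr.
- move=> tau a f /forallPn/= ex; rewrite /su bDl bZl divfK //.
  rewrite /fu; case: pickP => //= no; case: ex => f' ne.
  by have := no f'; rewrite ne.
- move=> f a tau /forallPn/= ex; rewrite /sv bDr bZr divfK //.
  rewrite /ft; case: pickP => //= no; case: ex => f' ne.
  by have := no f'; rewrite ne.
Qed.

Lemma card_fibers (S T : finType) (A0 : {set S}) (f : S -> T) (c : nat) :
  (forall x, x \in A0 -> #|[set y in A0 | f y == f x]%SET| = c) ->
  #|A0| = (#|[set f x | x in A0]%SET| * c)%N.
Proof.
move=> h; rewrite -[LHS]sum1_card.
rewrite (partition_big f (fun y => y \in [set f x | x in A0]%SET)) /=; last first.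
  by move=> x xA; apply: imset_f.
rewrite -sum_nat_const; apply: eq_bigr => _ /imsetP[x xA ->].
by rewrite sum1dep_card h.
Qed.

End Adjoint.

(** * Counting matrices with a given row space *)

Section MatrixCounts.
Variables (k : finFieldType).
Local Notation q := #|k|.

(** The number of linearly independent [r]-tuples in k^n; for [r > n] the factor [j = n] makes it
    0. *)
Definition frames n r := (\prod_(j < r) (q ^ n - q ^ j))%N.

Lemma card_row_span n m (C : 'M[k]_m) :
  #|[set z : 'M[k]_(n, m) | (z <= C)%MS]%SET| = (q ^ (n * \rank C))%N.
Proof.
have -> : [set z : 'M[k]_(n, m) | (z <= C)%MS]%SET =
          [set w *m row_base C | w : 'M[k]_(n, \rank C)]%SET.
  apply/setP => z; rewrite inE -(eq_row_base C); apply/submxP/imsetP => -[w].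
    by move=> ->; exists w.
  by move=> _ ->; exists w.
rewrite card_imset ?card_mx // => x y.
exact: (row_free_inj (row_base_free C)).
Qed.

Lemma card_left_kernel n m (C : 'M[k]_m) :
  #|[set z : 'M[k]_(n, m) | z *m C == 0]%SET| = (q ^ (n * (m - \rank C)))%N.
Proof.
rewrite -mxrank_ker -card_row_span; apply: eq_card => z; rewrite !inE.
exact/eqP/sub_kermxP.
Qed.

(** A new row may be any vector outside the span of the rows already chosen. *)
Lemma card_row_free n r :
  #|[set w : 'M[k]_(r, n) | row_free w]%SET| = frames n r.
Proof.
rewrite /frames; elim: r => [|r IH].
  rewrite big_ord0; apply/eqP/cards1P; exists 0; apply/setP => w.
  by rewrite !inE flatmx0 eqxx -row_leq_rank.
rewrite big_ord_recr /= -IH -[RHS]sum_nat_const -sum1_card -[r.+1]add1n.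
rewrite (partition_big (@dsubmx _ 1 r n) (fun w => w \in [set w : 'M[k]_(r, n) | row_free w]%SET)) /=.
  apply: eq_bigr => A; rewrite inE => fA.
  rewrite (reindex (fun v : 'rV_n => col_mx v A)) /=; last first.
    exists (@usubmx _ 1 r n) => [v _|w]; first by rewrite col_mxKu.
    by case/andP=> _ /eqP <-; rewrite vsubmxK.
  transitivity #|(~: [set v : 'rV[k]_n | (v <= A)%MS])%SET|.
    rewrite -sum1_card; apply: eq_bigl => v; rewrite !inE col_mxKd eqxx andbT.
    rewrite /row_free eqn_leq rank_leq_row /= -(leq_add2r (\rank (v :&: A)%MS)).
    rewrite -addsmxE mxrank_sum_cap (eqnP fA) addnAC leq_add2r.
    rewrite (ltn_leqif (mxrank_leqif_sup _)) ?capmxSl // sub_capmx submx_refl.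
    by [].
  rewrite cardsCs finset.setCK.
  have := card_row_span 1 (<<A>>%MS); rewrite mul1n genmxE (eqnP fA) card_mx mul1n => <-.
  by congr (_ - _)%N; apply: eq_card => v; rewrite !inE genmxE.
move=> w; rewrite !inE => fw; rewrite -row_leq_rank.
have := mxrank_adds_leqif (usubmx w) (dsubmx w); rewrite addsmxE vsubmxK (eqnP fw).
move=> [le _]; rewrite -(leq_add2l 1); apply: leq_trans le _.
by rewrite leq_add2r rank_leq_row.
Qed.

(** Matrices with row space [S] are the products [w *m row_base S] with [w] of full column rank;
    transposition turns [w] into a row free matrix. *)
Lemma card_same_span n m (S : 'M[k]_m) :
  #|[set z : 'M[k]_(n, m) | (z == S)%MS]%SET| = frames n (\rank S).
Proof.
rewrite -card_row_free.
have -> : [set z : 'M[k]_(n, m) | (z == S)%MS]%SET =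
  [set w *m row_base S | w in [set w^T | w in [set w : 'M[k]_(\rank S, n) | row_free w]]]%SET.
  apply/setP => z; rewrite inE; apply/andP/imsetP => [[zS Sz]|[w0 /imsetP[w + ->] ->]].
    have /submxP[w zw] : (z <= row_base S)%MS by rewrite eq_row_base.
    exists w => //; apply/imsetP; exists w^T; rewrite ?trmxK // inE -row_leq_rank mxrank_tr.
    apply: leq_trans (_ : \rank z <= _)%N; first exact: mxrankS.
    by rewrite zw mxrankM_maxl.
  rewrite inE => fw; have zS : (w^T *m row_base S <= S)%MS.
    by apply: submx_trans (submxMl _ _) _; rewrite eq_row_base.
  split=> //; rewrite -(mxrank_leqif_sup zS) mxrankMfree ?row_base_free //.
  by rewrite mxrank_tr (eqnP fw).
rewrite card_imset ?card_imset //; first exact: trmx_inj.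
exact: (row_free_inj (row_base_free S)).
Qed.

(** Orbit counting: GL_n acts transitively from the left on the matrices with the row space of [t],
    and all fibres of [gam |-> gam *m t] over this orbit have the same size. *)
Lemma card_GL_transport n m (t s : 'M[k]_(n.+1, m)) :
  (#|[set gam : {'GL_n.+1[k]} | GLval gam *m t == s]%SET| * frames n.+1 (\rank t) =
   (s == t)%MS * #|'GL_n.+1[k]%g|)%N.
Proof.
have [/eqmxMunitP[P Pu sP]|ne] := boolP (s == t)%MS; last first.
  rewrite mul0n; apply/eqP; rewrite muln_eq0; apply/orP; left.
  rewrite cards_eq0; apply/eqP/setP => gam; rewrite !inE.
  apply: contraNF ne => /eqP <-; apply/eqmxP/eqmxMfull.
  by rewrite row_full_unit; apply: (valP gam).
rewrite mul1n -(genmxE t) -card_same_span mulnC.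
rewrite (@card_fibers _ _ [set: {'GL_n.+1[k]}]%SET (fun gam => GLval gam *m t)
   #|[set gam : {'GL_n.+1[k]} | GLval gam *m t == s]%SET|).
  congr (_ * _)%N; apply: eq_card => z; rewrite inE.
  apply/andP/imsetP => [[zt tz]|[gam _ ->]].
    have /eqmxMunitP[Q Qu ->] : (z == t)%MS by move: zt tz; rewrite !genmxE => -> ->.
    by exists (FinRing.Unit Qu : {'GL_n.+1[k]}).
  have : (GLval gam *m t :=: t)%MS.
    by apply/eqmxMfull; rewrite row_full_unit; apply: (valP gam).
  by move=> e; rewrite !genmxE !e submx_refl.
move=> gam0 _.
(* As [s = P0 *m t], translation by [gam0 * P0^-1] carries the fibre over [s] to the fibre over
   [gam0 *m t]. *)
pose P0 : {'GL_n.+1[k]} := FinRing.Unit Pu.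
have P0E : GLval P0 = P by [].
rewrite -[RHS](card_imset _ (mulgI (gam0 * P0^-1)%g)).
congr #|pred_of_set _|; apply/setP => h; rewrite !inE /=; apply/eqP/imsetP => [e|[h' + ->]].
  exists ((gam0 * P0^-1)^-1 * h)%g; last by rewrite mulKVg.
  rewrite inE invMg invgK !GL_MxE -!mulmxA e (mulmxA (GLval gam0^-1)).
  by rewrite -GL_MxE mulVg GL_1E mul1mx P0E -sP.
rewrite inE => /eqP e; rewrite !GL_MxE -!mulmxA e sP -P0E.
by rewrite (mulmxA (GLval P0^-1)) -GL_MxE mulVg GL_1E mul1mx.
Qed.

End MatrixCounts.

(** * Averaging over tuples in GL_n *)

Section TotalCount.
Variables (k : finFieldType) (d m : nat).
Variables (D g : 'I_d -> 'M[k]_m).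
Local Notation q := #|k|.
Local Notation GL n := 'GL_n[k]%g.

Definition pair_dim := #|{: bool * 'I_d * 'I_m}|.
Local Notation p := pair_dim.

(** Extracts the block [(e, i)], so that a single matrix with [pair_dim] columns stores two families
    of matrices indexed by the generators. *)
Definition sel (e : bool) (i : 'I_d) : 'M[k]_(p, m) :=
  \matrix_(r, j) (r == enum_rank (e, i, j))%:R.

Lemma mul_selE r (Z : 'M[k]_(r, p)) e i l j :
  (Z *m sel e i) l j = Z l (enum_rank (e, i, j)).
Proof.
rewrite mxE (bigD1 (enum_rank (e, i, j))) //= big1 ?addr0.
  by rewrite mxE eqxx mulr1.
by move=> s ne; rewrite mxE (negbTE ne) mulr0.
Qed.

(* The row space of [Z] collects relations [\sum_i b_i = \sum_i a_i x_i] of the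
   window, [a_i] and [b_i] being read off by [sel true i] and [sel false i]. *)
Definition good r (Z : 'M[k]_(r, p)) :=
  [&& [forall i, (Z *m sel true i <= D i)%MS],
      [forall i, (Z *m sel false i == Z *m sel true i)%MS] &
      \sum_i (Z *m sel false i) == \sum_i (Z *m sel true i *m g i)].

Lemma good_eqmx r1 r2 (Z1 : 'M_(r1, p)) (Z2 : 'M_(r2, p)) :
  (Z1 :=: Z2)%MS -> good Z1 = good Z2.
Proof.
move=> e; congr [&& _, _ & _].
- by apply: eq_forallb => i; rewrite (eqmxMr _ e).
- by apply: eq_forallb => i; rewrite !(eqmxMr _ e).
(* The equation becomes containment of a product in 0, which visibly depends on the row space
   only. *)
have E r (Z : 'M_(r, p)) : (\sum_i (Z *m sel false i) == \sum_i (Z *m sel true i *m g i)) =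
    (Z *m (\sum_i sel false i - \sum_i (sel true i *m g i)) <= (0 : 'M_m))%MS.
  rewrite submx0 mulmxBr !mulmx_sumr subr_eq0; congr (_ == _).
  by apply: eq_bigr => i _; rewrite mulmxA.
by rewrite !E (eqmxMr _ e).
Qed.

Section FixedDim.
Variable (n' : nat).
Local Notation n := n'.+1.
Local Notation F := (frames k n).

Definition window_homs (gam : {ffun 'I_d -> {'GL_n[k]}}) :=
  [set f : 'M[k]_(m, n) | [forall i, D i *m f *m GLval (gam i) == D i *m g i *m f]]%SET.

Definition window_tors (gam : {ffun 'I_d -> {'GL_n[k]}}) :=
  [set t : {ffun 'I_d -> 'M[k]_(n, m)} | [forall i, (t i <= D i)%MS] &&
    (\sum_i (GLval (gam i) *m t i) == \sum_i (t i *m g i))]%SET.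

(** [card_adjoint_kernels] with [A i = D i] and [B i = D i *m g i], followed by the substitution
    [t i = tau i *m D i], whose fibres contribute q^(n (m - rank (D i))) for each [i]. *)
Lemma card_window_homs gam :
  (#|window_homs gam| * q ^ (n * \sum_i \rank (D i)) =
   #|window_tors gam| * q ^ (m * n))%N.
Proof.
pose R := [set tau : {ffun 'I_d -> 'M[k]_(n, m)} |
  \sum_i (GLval (gam i) *m tau i *m D i) == \sum_i (tau i *m (D i *m g i))]%SET.
have e1 : (#|window_homs gam| * q ^ (d * (n * m)) = #|R| * q ^ (m * n))%N.
  exact: card_adjoint_kernels.
pose f (tau : {ffun 'I_d -> 'M[k]_(n, m)}) : {ffun 'I_d -> 'M[k]_(n, m)} :=
  [ffun i => tau i *m D i].
have e2 : (#|R| = #|window_tors gam| * q ^ (n * \sum_i (m - \rank (D i))))%N.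
  rewrite (@card_fibers _ _ R f (q ^ (n * \sum_i (m - \rank (D i))))%N).
    congr (_ * _)%N; apply: eq_card => t; rewrite !inE.
    apply/imsetP/andP => [[tau + ->]|[/forallP tD /eqP te]].
      rewrite inE => /eqP te; split.
        by apply/forallP => i; rewrite ffunE submxMl.
      apply/eqP; rewrite (eq_bigr (fun i => GLval (gam i) *m tau i *m D i)).
        rewrite te; apply: eq_bigr => i _; by rewrite ffunE mulmxA.
      by move=> i _; rewrite ffunE mulmxA.
    have tE i : t i *m pinvmx (D i) *m D i = t i by rewrite mulmxKpV.
    exists [ffun i => t i *m pinvmx (D i)]; last first.
      by apply/ffunP => i; rewrite !ffunE tE.
    rewrite inE; apply/eqP; move: te.
    rewrite (eq_bigr (fun i => GLval (gam i) *m (t i *m pinvmx (D i) *m D i))).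
      move=> te; rewrite (eq_bigr (fun i => GLval (gam i) *m (t i *m pinvmx (D i) *m D i))).
        rewrite te; apply: eq_bigr => i _; by rewrite ffunE (mulmxA _ (D i)) tE.
      by move=> i _; rewrite ffunE -mulmxA.
    by move=> i _; rewrite tE.
  move=> tau tauR.
  transitivity #|family (fun i => [set z : 'M[k]_(n, m) | z *m D i == 0]%SET)|.
    pose tr (y : {ffun 'I_d -> 'M[k]_(n, m)}) := tau + y.
    rewrite -[RHS](card_imset (f := tr)); last by move=> y1 y2 /addrI.
    apply: eq_card => y; rewrite [LHS]inE; apply/andP/imsetP => [[_ /eqP e]|[z /familyP zF ->]].
      exists (y - tau); last by rewrite /tr addrC subrK.
      apply/familyP => i; rewrite inE !ffunE mulmxBl subr_eq0.
      by have /ffunP/(_ i) := e; rewrite !ffunE => ->.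
    have E i : (tau + z) i *m D i = tau i *m D i.
      by have := zF i; rewrite inE ffunE mulmxDl => /eqP ->; rewrite addr0.
    split; last by apply/eqP/ffunP => i; rewrite !ffunE -E ffunE.
    move: tauR; rewrite inE => /eqP tauR; rewrite inE; apply/eqP.
    rewrite (eq_bigr (fun i => GLval (gam i) *m tau i *m D i)).
      rewrite tauR; apply: eq_bigr => i _; by rewrite !mulmxA -E.
    by move=> i _; rewrite -!mulmxA E.
  rewrite card_family foldrE big_map big_enum big_distrr /= expn_sum.
  by apply: eq_big => // i _; apply: card_left_kernel.
have e3 : (d * (n * m) = n * \sum_i (m - \rank (D i)) + n * \sum_i \rank (D i))%N.
  rewrite -mulnDr -big_split /= (eq_bigr (fun=> m)); last first.
    by move=> i _; rewrite subnK // rank_leq_col.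
  by rewrite sum_nat_const card_ord; lia.
apply/eqP; rewrite -(eqn_pmul2r (m := q ^ (n * \sum_i (m - \rank (D i))))); last first.
  by rewrite expn_gt0 (ltnW (card_field_gt1 k)).
by rewrite -mulnA -expnD addnC -e3 e1 e2; apply/eqP; lia.
Qed.

Definition weight r (Z : 'M[k]_(r, p)) : rat :=
  \prod_i ((F (\rank (Z *m sel true i)))%:R)^-1.

Let compat (t s : {ffun 'I_d -> 'M[k]_(n, m)}) :=
  [forall i, (t i <= D i)%MS] && (\sum_i s i == \sum_i (t i *m g i)).

Let moves (gam : {ffun 'I_d -> {'GL_n[k]}}) (t s : {ffun 'I_d -> 'M[k]_(n, m)}) :=
  [forall i, GLval (gam i) *m t i == s i].

Lemma frames_rank_neq0 (t : 'M[k]_(n, m)) : (F (\rank t))%:R != 0 :> rat.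
Proof.
rewrite -(genmxE t) pnatr_eq0 -card_same_span; apply/eqP => /eqP; rewrite cards_eq0.
by move/eqP/setP/(_ t); rewrite !inE !genmxE submx_refl.
Qed.

Lemma card_GL_neq0 : #|GL n|%:R != 0 :> rat.
Proof. by rewrite pnatr_eq0 -lt0n cardG_gt0. Qed.

Lemma card_moves t s :
  (#|[set gam | moves gam t s]%SET|)%:R / #|GL n|%:R ^+ d =
  \prod_i ((s i == t i)%MS%:R / (F (\rank (t i)))%:R) :> rat.
Proof.
have -> : (#|[set gam | moves gam t s]%SET| =
   \prod_i #|[set h : {'GL_n[k]} | GLval h *m t i == s i]%SET|)%N.
  transitivity #|family (fun i => [set h : {'GL_n[k]} | GLval h *m t i == s i]%SET)|.
    apply: eq_card => gam; rewrite inE; apply/forallP/familyP => h i.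
      by rewrite inE.
    by have := h i; rewrite inE.
  by rewrite card_family foldrE big_map big_enum; apply: eq_big.
rewrite -[X in _ / _ ^+ X](card_ord d) -prodr_const natr_prod -prodf_div.
apply: eq_bigr => i _; apply/eqP.
rewrite eqr_div ?frames_rank_neq0 ?card_GL_neq0 // -!natrM.
by rewrite card_GL_transport.
Qed.

(** Introducing [s i = gam i *m t i] separates [gam] from the linear condition. For fixed [t] and
    [s] only the proportion of tuples carrying [t] to [s] remains, and the pair is stored as one
    matrix [Z]. *)
Lemma sum_window_tors :
  (\sum_gam (#|window_tors gam|)%:R) / #|GL n|%:R ^+ d =
  \sum_(Z : 'M[k]_(n, p) | good Z) weight Z.
Proof.
have torsE gam : #|window_tors gam| =
    (\sum_t \sum_s (compat t s && moves gam t s : nat))%N.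
  rewrite -sum1_card big_mkcond; apply: eq_bigr => t _.
  pose s0 : {ffun 'I_d -> 'M[k]_(n, m)} := [ffun i => GLval (gam i) *m t i].
  rewrite (bigD1 s0) //= big1 ?addn0 => [|s ne].
    have -> : moves gam t s0 by apply/forallP => i; rewrite ffunE.
    have -> : (t \in window_tors gam) = compat t s0.
      rewrite inE /compat; congr (_ && (_ == _)).
      by apply: eq_bigr => i _; rewrite ffunE.
    by rewrite andbT; case: compat.
  case: (boolP (moves gam t s)) => [/forallP h|_]; last by rewrite andbF.
  case/eqP: ne; apply/ffunP => i; rewrite ffunE; exact/esym/eqP.
rewrite -natr_sum (eq_bigr _ (fun gam _ => torsE gam)) exchange_big /=.
under eq_bigr do rewrite exchange_big /=.
have inner t s : (\sum_gam (compat t s && moves gam t s : nat) =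
    compat t s * #|[set gam | moves gam t s]%SET|)%N.
  case: (compat t s); last by rewrite big1.
  by rewrite mul1n -sum1dep_card [RHS]big_mkcond; apply: eq_bigr => gam _; case: moves.
under eq_bigr do under eq_bigr do rewrite inner.
rewrite natr_sum mulr_suml.
rewrite (eq_bigr (fun t => \sum_s
  (compat t s * #|[set gam | moves gam t s]%SET|)%:R / #|GL n|%:R ^+ d)); last first.
  by move=> t _; rewrite natr_sum mulr_suml.
rewrite pair_big /=.
pose tos (Z : 'M[k]_(n, p)) : {ffun 'I_d -> 'M[k]_(n, m)} * {ffun 'I_d -> 'M[k]_(n, m)} :=
  ([ffun i => Z *m sel true i], [ffun i => Z *m sel false i]).
rewrite (reindex tos) /=; last first.
  pose ofs (ts : {ffun 'I_d -> 'M[k]_(n, m)} * {ffun 'I_d -> 'M[k]_(n, m)}) : 'M[k]_(n, p) :=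
    \matrix_(l, r) (let x := enum_val r : bool * 'I_d * 'I_m in
      if x.1.1 then ts.1 x.1.2 l x.2 else ts.2 x.1.2 l x.2).
  exists ofs => [Z _|[t s] _].
    apply/matrixP => l r; rewrite mxE -[in RHS](enum_valK r).
    by case: (enum_val r) => [[[] i] j]; rewrite /= ffunE mul_selE.
  by congr pair; apply/ffunP => i; rewrite ffunE; apply/matrixP => l j;
     rewrite mul_selE mxE enum_rankK.
rewrite [RHS]big_mkcond; apply: eq_bigr => Z _.
rewrite natrM -mulrA card_moves /good /compat.
have -> : [forall i, (tos Z).1 i <= D i]%MS = [forall i, (Z *m sel true i <= D i)%MS].
  by apply: eq_forallb => i; rewrite ffunE.
have -> : \sum_i (tos Z).2 i = \sum_i (Z *m sel false i).
  by apply: eq_bigr => i _; rewrite ffunE.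
have -> : \sum_i ((tos Z).1 i *m g i) = \sum_i (Z *m sel true i *m g i).
  by apply: eq_bigr => i _; rewrite ffunE.
case: [forall i, (Z *m sel true i <= D i)%MS]; last by rewrite mul0r.
case: (_ == _); last by rewrite mul0r andbF.
rewrite mul1r andbT; case: forallP => [h|/forallP/forallPn[i ni]].
  by apply: eq_bigr => i _; rewrite !ffunE h mul1r.
by rewrite (bigD1 i) //= !ffunE (negbTE ni) mul0r mul0r.
Qed.

(** The number of [Z] with row space [S] is F_(rk S), which is 0 when the rank of [S] exceeds [n];
    this makes the index set independent of [n]. *)
Lemma sum_good_span :
  \sum_(Z : 'M[k]_(n, p) | good Z) weight Z =
  \sum_(S : 'M[k]_p | (<<S>>%MS == S) && good S) (F (\rank S))%:R * weight S.
Proof.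
rewrite (partition_big (fun Z : 'M[k]_(n, p) => <<Z>>%MS)
  (fun S : 'M[k]_p => (<<S>>%MS == S) && good S)) /=; last first.
  by move=> Z gZ; rewrite genmx_id eqxx /= (good_eqmx (genmxE Z)).
apply: eq_bigr => S /andP[/eqP SS gS].
rewrite (eq_bigr (fun=> weight S)); last first.
  move=> Z /andP[_ /eqP ZS]; rewrite /weight; apply: eq_bigr => i _.
  by rewrite -(eqmxMr _ (genmxE Z)) ZS.
rewrite sumr_const [RHS]mulr_natl -card_same_span; congr (_ *+ _).
apply: eq_card => Z; rewrite !inE [in LHS]unfold_in /=.
have -> : (Z == S)%MS = (<<Z>>%MS == S).
  by apply/genmxP/eqP => [->|->]; rewrite SS.
case: eqP => [ZS|_]; last by rewrite andbF.
by rewrite andbT -(good_eqmx (genmxE Z)) ZS.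
Qed.

Theorem total_count :
  (\sum_gam (#|window_homs gam|)%:R) / #|GL n|%:R ^+ d =
  q%:R ^+ (m * n) / q%:R ^+ (n * \sum_i \rank (D i)) *
  \sum_(S : 'M[k]_p | (<<S>>%MS == S) && good S) (F (\rank S))%:R * weight S.
Proof.
rewrite -sum_good_span -sum_window_tors mulrA; congr (_ / _).
rewrite mulr_sumr; apply: eq_bigr => gam _.
have q0 : q%:R != 0 :> rat by rewrite pnatr_eq0 -lt0n (ltnW (card_field_gt1 k)).
apply: (mulIf (expf_neq0 (n * \sum_i \rank (D i)) q0)).
rewrite mulrAC divfK ?expf_neq0 // -!natrX -!natrM card_window_homs.
by rewrite mulnC.
Qed.

End FixedDim.

End TotalCount.

(** * Spaces of relations and full systems *)

Section GoodSpaces.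
Context {k : finFieldType} {d : nat} {V : fspace k d} {m : nat}.
Context {iota : {linear 'rV[k]_m -> V}} {D g : @letter d -> 'M[k]_m}.
Hypothesis wc : window_coord iota D g.
Local Notation q := #|k|.
Local Notation p := (pair_dim d m).
Local Notation sel := (@sel k d m).
Local Notation gi := (fun i => g (i, true)).
Local Notation good := (@good k d m (fun i => D (i, true)) gi).
Implicit Types (I : 'I_d -> 'M[k]_m) (S : 'M[k]_p) (u v w : 'rV[k]_m) (z : 'rV[k]_p).

Notation im := (@im k d V m iota).
Notation dom := (@dom k d m D g).
Notation genD := (@genD k d m D g).
Notation hull := (@hull k d m g).
Notation ends := (@ends k d m g).
Notation full_system := (@full_system k d m D g).

Definition gens S : 'I_d -> 'M[k]_m := fun i => <<S *m sel true i>>%MS.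

(** The growth exponent in q^n of the summand belonging to [S]; see [term_asym]. *)
Definition excess S : int := (\rank S)%:Z - (\sum_i \rank (gens S i))%N%:Z.

Definition in_rel I z :=
  [&& [forall i, (z *m sel true i <= I i)%MS], [forall i, (z *m sel false i <= I i)%MS] &
      \sum_i (z *m sel false i) == \sum_i (z *m sel true i *m gi i)].

Definition glue (a b : 'I_d -> 'rV[k]_m) : 'rV[k]_p :=
  \row_r (let x := enum_val r : bool * 'I_d * 'I_m in
     if x.1.1 then a x.1.2 0 x.2 else b x.1.2 0 x.2).

Lemma glue_sel a b e i : glue a b *m sel e i = if e then a i else b i.
Proof.
apply/rowP => j; rewrite mul_selE mxE enum_rankK /=.
by case: e.
Qed.

Lemma sel_inj z : (forall e i, z *m sel e i = 0) -> z = 0.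
Proof.
move=> h; apply/rowP => r; rewrite -(enum_valK r).
case: (enum_val r : bool * 'I_d * 'I_m) => [[e i] j].
by rewrite -mul_selE h !mxE.
Qed.

Lemma sum_letters (W : zmodType) (P : pred (@letter d)) (F : letter -> W) :
  \sum_(c | P c) F c = \sum_(i | P (i, true)) F (i, true) + \sum_(i | P (i, false)) F (i, false).
Proof.
rewrite big_mkcond /= (eq_bigr (fun c => if P (c.1, c.2) then F (c.1, c.2) else 0)); last first.
  by case.
rewrite -(pair_bigA _ (fun i e => if P (i, e) then F (i, e) else 0)) /=.
rewrite [in RHS]big_mkcond [X in _ = _ + X]big_mkcond -big_split /=.
by apply: eq_bigr => i _; rewrite big_bool.
Qed.

(** The map [\sum_i a_i x_i - \sum_i b_i] on pairs of families with entries in [I] is onto the hull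
    and has kernel [R]; the rank formula follows by counting its fibres. If [R] has components [I],
    its excess is therefore [- defect (hull I) I]. *)
Lemma rel_exists I : exists2 R : 'M[k]_p, <<R>>%MS = R &
  (forall z, (z <= R)%MS = in_rel I z) /\
  (\rank R + \rank (hull I) = 2 * \sum_i \rank (I i))%N.
Proof.
have [R0 R0E] : exists R : 'M[k]_p, forall z, (z <= R)%MS <-> in_rel I z.
  apply: (rowspace_of_pred (P := fun z => in_rel I z)).
    rewrite /in_rel; apply/and3P; split; try by apply/forallP => i; rewrite mul0mx sub0mx.
    by rewrite !big1 // => i _; rewrite !mul0mx.
  move=> a x y /and3P[/forallP x1 /forallP x2 /eqP x3] /and3P[/forallP y1 /forallP y2 /eqP y3].
  apply/and3P; split.
  - by apply/forallP => i; rewrite mulmxDl -scalemxAl addmx_sub ?scalemx_sub.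
  - by apply/forallP => i; rewrite mulmxDl -scalemxAl addmx_sub ?scalemx_sub.
  under eq_bigr do rewrite mulmxDl -scalemxAl.
  under [X in _ == X]eq_bigr do rewrite !mulmxDl -!scalemxAl.
  by rewrite !big_split /= -!scaler_sumr x3 y3.
exists <<R0>>%MS; first by rewrite genmx_id.
have RE z : (z <= <<R0>>)%MS = in_rel I z by rewrite genmxE; apply/idP/idP => /R0E.
split=> //; rewrite genmxE.
pose T : {set 'rV[k]_p} := [set z | [forall i, (z *m sel true i <= I i)%MS] &&
  [forall i, (z *m sel false i <= I i)%MS]]%SET.
pose f z := \sum_i (z *m sel true i *m gi i) - \sum_i (z *m sel false i).
have fE z : f z = z *m (\sum_i (sel true i *m gi i) - \sum_i sel false i).
  rewrite mulmxBr !mulmx_sumr; congr (_ - _); apply: eq_bigr => i _.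
  by rewrite mulmxA.
have cT : #|T| = (q ^ (2 * \sum_i \rank (I i)))%N.
  pose FF := family (fun i => [set u : 'rV[k]_m | (u <= I i)%MS]%SET).
  have cF : #|FF| = (q ^ (\sum_i \rank (I i)))%N.
    rewrite card_family foldrE big_map big_enum expn_sum.
    by apply: eq_big => // i _; rewrite card_row_span mul1n.
  rewrite mul2n -addnn expnD -cF -cardX.
  pose sp z : {ffun 'I_d -> 'rV[k]_m} * {ffun 'I_d -> 'rV[k]_m} :=
    ([ffun i => z *m sel true i], [ffun i => z *m sel false i]).
  have sp_inj : injective sp.
    move=> x y [/ffunP e1 /ffunP e2]; apply/eqP; rewrite -subr_eq0.
    apply/eqP/sel_inj => e i; rewrite mulmxBl; apply/eqP; rewrite subr_eq0; apply/eqP.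
    by case: e; [have := e1 i|have := e2 i]; rewrite !ffunE.
  rewrite -(card_imset _ sp_inj); apply: eq_card => -[a b].
  rewrite [RHS]inE /=; apply/imsetP/andP => [[z + [-> ->]]|[/familyP aF /familyP bF]].
    rewrite inE => /andP[/forallP h1 /forallP h2].
    by split; apply/familyP => i; rewrite inE ffunE.
  exists (glue a b); last first.
    by congr pair; apply/ffunP => i; rewrite ffunE glue_sel.
  rewrite inE; apply/andP; split; apply/forallP => i; rewrite glue_sel.
    by have := aF i; rewrite inE.
  by have := bF i; rewrite inE.
have := @card_fibers _ _ T f (q ^ \rank R0)%N; rewrite cT.
have -> : [set f x | x in T]%SET = [set u : 'rV[k]_m | (u <= hull I)%MS]%SET.
  apply/setP => u; rewrite inE; apply/imsetP/idP => [[z + ->]|].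
    rewrite inE => /andP[/forallP h1 /forallP h2]; rewrite /f addmx_sub ?eqmx_opp //.
      apply: summx_sub => i _; apply: submx_trans (ends_hull I (i, false)).
      exact: submxMr.
    apply: summx_sub => i _; apply: submx_trans (h2 i) (ends_hull I (i, true)).
  move=> /sub_sumsmxP[w ->].
  exists (glue (fun i => w (i, false) *m ends I (i, false) *m g (i, false))
               (fun i => - (w (i, true) *m ends I (i, true)))).
    rewrite inE; apply/andP; split; apply/forallP => i; rewrite glue_sel /=.
      rewrite mulmxA (mul_gK wc (i, true)); exact: submxMl.
    by rewrite eqmx_opp submxMl.
  rewrite /f sum_letters addrC; congr (_ + _).
    by apply: eq_bigr => i _; rewrite glue_sel (mul_gK wc (i, false)).
  by rewrite -sumrN; apply: eq_bigr => i _; rewrite glue_sel opprK.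
rewrite card_row_span mul1n -expnD addnC => h; apply: (expnI (card_field_gt1 k)).
rewrite -h // => z zT.
rewrite -[\rank R0]mul1n -card_row_span.
pose tr y := z + y.
have tr_inj : injective tr by move=> y1 y2 /addrI.
rewrite -[RHS](card_imset _ tr_inj).
have R0T y : (y <= R0)%MS -> [/\ forall i, (y *m sel true i <= I i)%MS,
   forall i, (y *m sel false i <= I i)%MS & f y = 0].
  move=> /R0E/and3P[/forallP h1 /forallP h2 /eqP h3]; split=> //.
  by rewrite /f h3 subrr.
move: zT; rewrite inE => /andP[/forallP z1 /forallP z2].
apply: eq_card => y; rewrite [LHS]inE; apply/andP/imsetP => [[]|[x + ->]].
  rewrite inE => /andP[/forallP y1 /forallP y2] /eqP e.
  exists (y - z); last by rewrite /tr addrC subrK.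
  rewrite inE; apply/R0E/and3P; split.
  - by apply/forallP => i; rewrite mulmxBl addmx_sub ?eqmx_opp.
  - by apply/forallP => i; rewrite mulmxBl addmx_sub ?eqmx_opp.
  rewrite eq_sym -subr_eq0 -/(f _) fE mulmxBl -!fE e subrr //.
rewrite inE => /R0T[x1 x2 x3]; split.
  by rewrite inE; apply/andP; split; apply/forallP => i; rewrite /tr mulmxDl addmx_sub.
by rewrite /tr fE mulmxDl -!fE x3 addr0.
Qed.

(** The equation of a good space can be solved for any single term, which puts this term into the
    span of the others. *)
Lemma good_full S : good S -> full_system (gens S).
Proof.
case/and3P=> /forallP SD /forallP SB /eqP SE.
have BA i : (S *m sel false i :=: gens S i)%MS.
  by apply: eqmx_trans (eqmx_sym (genmxE _)); apply/eqmxP/SB.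
have AG i : (S *m sel true i *m g (i, true) :=: ends (gens S) (i, false))%MS.
  exact/eqmx_sym/eqmxMr/genmxE.
split=> [i|[i []]]; first by rewrite genmxE.
  rewrite -[ends _ _]/(gens S i) -(BA i).
  have -> : S *m sel false i =
      \sum_j (S *m sel true j *m g (j, true)) - \sum_(j | j != i) (S *m sel false j).
    by rewrite -SE (bigD1 i) //= addrK.
  rewrite addmx_sub ?eqmx_opp //; apply: summx_sub => j ne.
    by apply: (sumsmx_sup (j, false)); rewrite ?AG // xpair_eqE andbF.
  apply: (sumsmx_sup (j, true)); last by rewrite BA.
  by apply: contra ne => /eqP[->].
rewrite -AG.
have -> : S *m sel true i *m g (i, true) =
    \sum_j (S *m sel false j) - \sum_(j | j != i) (S *m sel true j *m g (j, true)).
  by rewrite SE (bigD1 i) //= addrK.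
rewrite addmx_sub ?eqmx_opp //; apply: summx_sub => j ne.
  by apply: (sumsmx_sup (j, true)); rewrite ?BA // xpair_eqE andbF.
apply: (sumsmx_sup (j, false)) => //; last by rewrite AG.
by apply: contra ne => /eqP[->].
Qed.

Lemma good_in_rel S z : good S -> (z <= S)%MS -> in_rel (gens S) z.
Proof.
case/and3P=> /forallP SD /forallP SB /eqP SE /submxP[a ->].
apply/and3P; split.
- by apply/forallP => i; rewrite genmxE -mulmxA submxMl.
- apply/forallP => i; rewrite genmxE -mulmxA; apply: submx_trans (submxMl _ _) _.
  by case/andP: (SB i).
apply/eqP; transitivity (a *m \sum_i (S *m sel false i)).
  by rewrite mulmx_sumr; apply: eq_bigr => i _; rewrite mulmxA.
by rewrite SE mulmx_sumr; apply: eq_bigr => i _; rewrite !mulmxA.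
Qed.

(** Fullness writes a vector of one domain through the other letters, and this is a relation having
    that vector as an entry; so the components of [R] fill all of [I]. *)
Lemma rel_good I R : full_system I -> (forall z, (z <= R)%MS = in_rel I z) ->
  good R /\ forall i, (gens R i :=: I i)%MS.
Proof.
move=> fI RE.
have rel3 z : (z <= R)%MS -> [/\ forall i, (z *m sel true i <= I i)%MS,
   forall i, (z *m sel false i <= I i)%MS &
   \sum_i (z *m sel false i) = \sum_i (z *m sel true i *m gi i)].
  by rewrite RE => /and3P[/forallP ? /forallP ? /eqP ?].
have R_true i : (R *m sel true i :=: I i)%MS.
  apply/eqmxP/andP; split; apply/row_subP => j.
    by rewrite row_mul; have [h _ _] := rel3 _ (row_sub j R).
  set u := row _ _; have uI : (u <= I i)%MS by apply: row_sub.
  have := submx_trans (submxMr (gi i) uI) (fs_full fI (i, false)).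
  move=> /sub_sumsmxP[w]; rewrite sum_letters /= => e.
  pose a j := if j == i then u else - (w (j, false) *m I j).
  pose z := glue a (fun j => w (j, true) *m I j).
  have zR : (z <= R)%MS.
    rewrite RE; apply/and3P; split.
    - apply/forallP => l; rewrite glue_sel /a; case: eqP => [->//|_].
      by rewrite eqmx_opp submxMl.
    - by apply/forallP => l; rewrite glue_sel submxMl.
    apply/eqP; rewrite [RHS](bigD1 i) //= glue_sel /a eqxx e.
    rewrite -[LHS]addr0 -addrA; congr (_ + _).
      by apply: eq_big => [l|l _]; rewrite ?glue_sel // xpair_eqE andbF.
    rewrite -[LHS](subrr (\sum_(l | l != i) (w (l, false) *m I l *m gi l))) -sumrN.
    congr (_ + _).
      apply: eq_big => [l|l _]; last by rewrite mulmxA.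
      by rewrite xpair_eqE eqxx andbT.
    by apply: eq_bigr => l ne; rewrite glue_sel /a (negbTE ne) mulNmx.
  have -> : u = z *m sel true i by rewrite glue_sel /a eqxx.
  exact: submxMr.
have R_false i : (R *m sel false i :=: I i)%MS.
  apply/eqmxP/andP; split; apply/row_subP => j.
    by rewrite row_mul; have [_ h _] := rel3 _ (row_sub j R).
  set u := row _ _; have uI : (u <= I i)%MS by apply: row_sub.
  have := submx_trans uI (fs_full fI (i, true)).
  move=> /sub_sumsmxP[w]; rewrite sum_letters /= => e.
  pose b j := if j == i then u else - (w (j, true) *m I j).
  pose z := glue (fun j => w (j, false) *m I j) b.
  have zR : (z <= R)%MS.
    rewrite RE; apply/and3P; split.
    - by apply/forallP => l; rewrite glue_sel submxMl.
    - apply/forallP => l; rewrite glue_sel /b; case: eqP => [->//|_].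
      by rewrite eqmx_opp submxMl.
    apply/eqP; rewrite (bigD1 i) //= glue_sel /b eqxx e addrAC addrC.
    rewrite -[RHS]addr0; congr (_ + _).
      by apply: eq_big => [l|l _]; rewrite ?glue_sel ?mulmxA // xpair_eqE andbF.
    rewrite -[RHS](subrr (\sum_(l | l != i) (w (l, true) *m I l))) -sumrN.
    congr (_ + _).
      by apply: eq_big => [l|l _] //; rewrite xpair_eqE eqxx andbT.
    by apply: eq_bigr => l ne; rewrite glue_sel /b (negbTE ne).
  have -> : u = z *m sel false i by rewrite glue_sel /b eqxx.
  exact: submxMr.
split; last by move=> i; apply: eqmx_trans (genmxE _) (R_true i).
apply/and3P; split.
- by apply/forallP => i; rewrite R_true; apply: (fs_dom fI).
- by apply/forallP => i; apply/eqmxP; apply: eqmx_trans (R_false i) (eqmx_sym (R_true i)).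
apply/eqP/row_matrixP => j; rewrite !linear_sum /=.
have [_ _ h] := rel3 _ (row_sub j R).
rewrite (eq_bigr (fun i => row j R *m sel false i)); last by move=> i _; rewrite row_mul.
by rewrite h; apply: eq_bigr => i _; rewrite !row_mul.
Qed.

Definition good_module S : set V := cl (im (hull (gens S))).

Lemma good_module_no_free S : good S -> no_free_quotient (good_module S).
Proof.
move=> gS; apply: full_no_free_quotient; first exact: (im_fd wc).
exact: (full_im_hull wc (good_full gS)).
Qed.

Lemma good_module_eq0 S : good S -> (forall x, good_module S x -> x = 0) -> S = 0.
Proof.
move=> gS h; have u0 u : (u <= hull (gens S))%MS -> u = 0.
  move=> uJ; apply: (wc_inj wc); rewrite linear0; apply: h; apply: cl_sub.
  exact/(im_iota wc).
have g0 i : gens S i = 0.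
  apply/row_matrixP => j; rewrite row0; apply: u0.
  exact: submx_trans (row_sub j _) (ends_hull _ (i, true)).
apply/row_matrixP => j; rewrite row0; apply: sel_inj => e i.
have /and3P[/forallP h1 /forallP h2 _] := good_in_rel gS (row_sub j S).
apply/eqP; rewrite -submx0; case: e; first by have := h1 i; rewrite g0.
by have := h2 i; rewrite g0.
Qed.

(** [S] lies in the space [R] of all relations with entries in [gens S], whose rank is given by
    [rel_exists]; equal excess means equal rank. *)
Lemma excess_le S : good S ->
  (excess S <= - defect (hull (gens S)) (gens S))%R /\
  (<<S>>%MS = S -> excess S = - defect (hull (gens S)) (gens S) ->
   forall R, <<R>>%MS = R -> (forall z, (z <= R)%MS = in_rel (gens S) z) -> S = R).
Proof.
move=> gS; have [R RR [RE rR]] := rel_exists (gens S).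
have SR : (S <= R)%MS by apply/row_subP => j; rewrite RE good_in_rel // row_sub.
split; first by have := mxrankS SR; rewrite /excess /defect; lia.
move=> SS e R' RR' RE'; rewrite -SS -RR'; apply/genmxP.
have E : (R' :=: R)%MS.
  apply/eqmxP/andP; split; apply/row_subP => j; first by rewrite RE -RE' row_sub.
  by rewrite RE' -RE row_sub.
rewrite !E SR -(mxrank_leqif_sup SR).2 eqn_leq mxrankS //=.
by move: e; rewrite /excess /defect; lia.
Qed.

Hypothesis wV : fwin setT (im 1%:M).
Hypothesis clV : cl (im 1%:M) = setT.

(** [S0] consists of all relations over the full window of [N]. Any other [S] falls short because it
    omits relations over its own domains or because these have a larger defect. *)
Theorem good_max (N : set V) (K : 'M[k]_m) :
  stable N -> no_free_quotient N -> (forall u, (u <= K)%MS <-> N (iota u)) ->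
  exists S0, [/\ <<S0>>%MS = S0, good S0, good_module S0 = N,
    excess S0 = - defect K (genD K) &
    forall S, <<S>>%MS = S -> good S -> good_module S = N -> S != S0 ->
      (excess S < - defect K (genD K))%R].
Proof.
move=> sN nfN NK.
have [I [fI clI exI IE dI]] := full_system_exists wc wV clV sN nfN NK.
have [R RR [RE rR]] := rel_exists I.
have [gR RI] := rel_good fI RE.
have hullR : (hull (gens R) :=: hull I)%MS.
  apply/eqmxP/andP; split; apply/sumsmx_subP => c _; apply: (sumsmx_sup c) => //;
  rewrite /ends; case: ifP => _; rewrite ?RI //; by rewrite (eqmxMr _ (RI _)).
have sumR : (\sum_i \rank (gens R i) = \sum_i \rank (I i))%N.
  by apply: eq_bigr => i _; rewrite RI.
exists R; split=> //.
- by rewrite /good_module (im_eqmx wc hullR).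
- by rewrite -dI /excess /defect sumR; lia.
move=> S SS gS SN ne.
have le1 := (excess_le gS).1.
have fS := good_full gS.
have le2 := defect_min wc sN fS SN clI exI IE.
rewrite -dI lt_neqAle; apply/andP; split; last first.
  by apply: le_trans le1 _; rewrite lerN2.
apply: contra ne => /eqP e; apply/eqP.
have e2 : defect (hull I) I = defect (hull (gens S)) (gens S).
  by apply/eqP; rewrite eq_le le2 /= -lerN2 -e.
have [_ IS] := defect_min_eq wc sN fS fI SN clI exI IE e2.
apply: (excess_le gS).2 => //; first by rewrite e e2.
move=> z; rewrite RE /in_rel; congr [&& _, _ & _]; apply: eq_forallb => i;
by rewrite IS.
Qed.

End GoodSpaces.

(** * From letters to the group algebra *)

Section RingAction.
Context {k : fieldType} {d : nat}.
Local Notation F := (free_group d).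
Local Notation A := {malg k[F]}.
Local Notation R := ((group_alg k F)^c).
Implicit Types (X Y : fspace k d) (c : @letter d) (a b : A) (x y : A).

Definition wact (X : fspace k d) (w : seq letter) (v : X) : X :=
  foldl (fun v c => act c v) v w.

Definition ract (X : fspace k d) (a : A) (v : X) : X :=
  \sum_(g <- msupp a) a@_g *: wact (fg_word g) v.

Lemma stable_wact X (Z : set X) w v : stable Z -> Z v -> Z (wact w v).
Proof. by move=> sZ; elim: w v => //= c w IH v zv; apply/IH/sZ.2. Qed.

Lemma stable_ract X (Z : set X) a v : stable Z -> Z v -> Z (ract a v).
Proof.
move=> sZ zv; apply: subspace_sum; first exact: sZ.1.
by move=> g _; apply: subspaceZ; [exact: sZ.1|exact: stable_wact].
Qed.

Lemma hom_wact X Y (Z : set X) (h : X -> Y) w v : stable Z -> hom Z h -> Z v ->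
  h (wact w v) = wact w (h v).
Proof.
move=> sZ hh; elim: w v => //= c w IH v zv.
by rewrite IH ?hh.2 //; apply: sZ.2.
Qed.

Lemma hom_ract X Y (Z : set X) (h : X -> Y) a v : stable Z -> hom Z h -> Z v ->
  h (ract a v) = ract a (h v).
Proof.
move=> sZ hh zv; have zw g : Z (wact (fg_word g) v) by apply: stable_wact.
rewrite /ract (linon_sum _ sZ.1 hh.1) => [|g _]; last exact: subspaceZ sZ.1 _.
apply: eq_bigr => g _; rewrite (linonZ _ sZ.1 hh.1) //.
by rewrite (hom_wact _ sZ hh).
Qed.

Lemma alg_wact (w : seq letter) (rw : reduced w) (x : @alg_space k d) :
  wact w x = ga_mul x << FreeGroup rw >>.
Proof.
elim: w rw x => [|c w IH] rcw x /=.
  have -> : FreeGroup rcw = 1%g by apply: val_inj.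
  exact/esym/ga_mulg1.
have rw : reduced w by exact: path_sorted rcw.
rewrite (IH rw) /rmulg -ga_mulA ga_mulUU mulr1; congr (ga_mul _ << _ >>).
apply: val_inj => /=; case: w rcw {IH rw} => [|b w] //=.
by rewrite /reduced /= => /andP[/negbTE->].
Qed.

Lemma scale_monalgU (e f : k) (g : F) : e *: << f *g g >> = << e * f *g g >> :> A.
Proof. by apply/malgP => h; rewrite mcoeffZ !mcoeffU mulrnAr. Qed.

Lemma ga_mulZr (e : k) x y : ga_mul x (e *: y) = e *: ga_mul x y.
Proof.
rewrite (monalgE y) scaler_sumr !ga_mul_sumr scaler_sumr; apply: eq_bigr => g _.
rewrite (monalgE x) !ga_mul_suml scaler_sumr; apply: eq_bigr => h _.
by rewrite scale_monalgU !ga_mulUU scale_monalgU mulrCA.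
Qed.

Lemma alg_ract a (x : @alg_space k d) : ract a x = ga_mul x a.
Proof.
rewrite [in RHS](monalgE a) ga_mul_sumr; apply: eq_bigr => -[w rw] _.
rewrite (alg_wact rw) /= -ga_mulZr; congr (ga_mul _ _).
by rewrite scale_monalgU mulr1.
Qed.

Lemma ga_mul_const (e f : k) : ga_mul << e *g 1%g >> << f *g 1%g >> = << e * f *g 1%g >> :> A.
Proof.
rewrite ga_mulUU.
rewrite mulg1.
by [].
Qed.

Lemma ga_mul_constC (e : k) (g : F) :
  ga_mul << e *g 1%g >> << g >> = ga_mul << g >> << e *g 1%g >> :> A.
Proof. by rewrite ga_mulUU [RHS]ga_mulUU mulr1 mul1r mul1g mulg1. Qed.

Lemma ga_mul_lgenV c : ga_mul << lgen c >> << lgen (linv c) >> = ga_one :> A.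
Proof. by rewrite ga_mulUU -lgenV mulgV mulr1. Qed.

Lemma ga_mul_lgen c (w : seq letter) (rw : reduced w) (rcw : reduced (c :: w)) :
  ga_mul << lgen c >> << FreeGroup rw >> = << FreeGroup rcw >> :> A.
Proof.
rewrite ga_mulUU mulr1; congr << _ >>; apply: val_inj => /=.
by case: w rcw rw => [|b w] //=; rewrite /reduced /= => /andP[/negbTE->].
Qed.

Lemma ga_mul_coeff (e : k) (g : F) : ga_mul << g >> << e *g 1%g >> = << e *g g >> :> A.
Proof. by rewrite ga_mulUU mulg1 mul1r. Qed.

End RingAction.

Lemma submod_of_set (R0 : nzRingType) (L : lmodType R0) (Z : set L) :
  Z 0 -> (forall a x y, Z x -> Z y -> Z (a *: x + y)) ->
  exists N : submodClosed L, forall x, (x \in N) <-> Z x.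
Proof.
move=> Z0 ZL; pose P : {pred L} := fun x => `[< Z x >].
have clP : GRing.submod_closed P.
  by split=> [|a x y /asboolP zx /asboolP zy]; apply/asboolP => //; apply: ZL.
pose N : submodClosed L := HB.pack P (GRing.isSubmodClosed.Build _ _ P clP).
by exists N => x; rewrite -[x \in N]/(`[< Z x >]); split=> /asboolP.
Qed.

Section ModuleSpace.
Context {k : fieldType} {d : nat}.
Local Notation F := (free_group d).
Local Notation A := {malg k[F]}.
Local Notation R := ((group_alg k F)^c).
Variable (L : lmodType R).
Implicit Types (c : @letter d) (a b : A).

(** [L] already carries its structure over the group algebra; the alias carries the vector space
    structure obtained by restricting scalars to [k]. *)
Definition mod_alias : Type := L.
HB.instance Definition _ := GRing.Zmodule.on mod_alias.

Definition mod_scale (e : k) (v : mod_alias) : mod_alias := (<< e *g 1%g >> : R) *: (v : L).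

Lemma scale_comp a b (v : L) : (a : R) *: ((b : R) *: v) = (ga_mul b a : R) *: v.
Proof. exact: scalerA. Qed.

Lemma mod_scaleA e f v : mod_scale e (mod_scale f v) = mod_scale (e * f) v.
Proof.
have E : ga_mul << f *g 1%g >> << e *g 1%g >> = << e * f *g 1%g >> :> A.
  by rewrite ga_mul_const (mulrC f e).
exact: etrans (scale_comp << e *g 1%g >> << f *g 1%g >> v) (congr1 (fun a : R => a *: (v : L)) E).
Qed.

Lemma mod_scale1 : left_id 1 mod_scale.
Proof. by move=> v; apply: scale1r. Qed.

Lemma mod_scaleDr : right_distributive mod_scale +%R.
Proof. by move=> e v w; apply: scalerDr. Qed.

Lemma mod_scaleDl v : {morph mod_scale^~ v : e f / e + f}.
Proof. by move=> e f; rewrite /mod_scale monalgUD; apply: scalerDl. Qed.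

HB.instance Definition _ := GRing.Zmodule_isLmodule.Build k mod_alias
  mod_scaleA mod_scale1 mod_scaleDr mod_scaleDl.

Definition mod_act c (v : mod_alias) : mod_alias := (<< lgen c >> : R) *: (v : L).

Lemma mod_act_linear c : linear (mod_act c).
Proof.
move=> e v w; pose S (a : R) := a *: (v : L).
have E : (<< lgen c >> : R) *: ((<< e *g 1%g >> : R) *: (v : L)) =
         (<< e *g 1%g >> : R) *: ((<< lgen c >> : R) *: (v : L)).
  apply: etrans (scale_comp << lgen c >> << e *g 1%g >> v) _.
  apply: etrans (congr1 S (ga_mul_constC e (lgen c))) _.
  exact/esym/scale_comp.
apply: etrans (@scalerDr R L << lgen c >> (mod_scale e v) w) _.
exact: (congr1 (fun t : L => t + (<< lgen c >> : R) *: (w : L)) E).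
Qed.

HB.instance Definition _ c := GRing.isLinear.Build k mod_alias mod_alias _
  (mod_act c) (mod_act_linear c).

Lemma mod_actK c v : mod_act (linv c) (mod_act c v) = v.
Proof.
apply: etrans (scale_comp << lgen (linv c) >> << lgen c >> v) _.
apply: etrans (congr1 (fun a : R => a *: (v : L)) (ga_mul_lgenV c)) _.
exact: scale1r.
Qed.

Definition mod_space : fspace k d :=
  @FSpace k d mod_alias (fun c => mod_act c : {linear _ -> _}) mod_actK.

Lemma mod_wact (w : seq letter) (rw : reduced w) (v : mod_space) :
  wact w v = (<< FreeGroup rw >> : R) *: (v : L).
Proof.
elim: w rw v => [|c w IH] rcw v /=.
  have -> : FreeGroup rcw = 1%g by apply: val_inj.
  exact/esym/(@scale1r R L).
have rw : reduced w by exact: path_sorted rcw.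
apply: etrans (IH rw _) _; apply: etrans (scale_comp << FreeGroup rw >> << lgen c >> v) _.
exact: (congr1 (fun a : R => a *: (v : L)) (ga_mul_lgen rw rcw)).
Qed.

Lemma mod_ract a (v : mod_space) : ract a v = (a : R) *: (v : L).
Proof.
rewrite [in RHS](monalgE a) [RHS]scaler_suml; apply: eq_bigr => -[w rw] _.
apply: etrans (congr1 (mod_scale _) (mod_wact rw v)) _.
apply: etrans (scale_comp << a@_(FreeGroup rw) *g 1%g >> << FreeGroup rw >> v) _.
exact: (congr1 (fun a : R => a *: (v : L)) (ga_mul_coeff _ _)).
Qed.

Lemma stable_scale (Z : set mod_space) (a : R) v : stable Z -> Z v -> Z (a *: (v : L)).
Proof. by move=> sZ zv; have := stable_ract a sZ zv; rewrite mod_ract. Qed.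

Lemma submod_stable (N : submodClosed L) : stable ([set x | x \in N] : set mod_space).
Proof.
split; first split.
- exact: rpred0.
- by move=> e x y Nx Ny; apply: rpredD => //; apply: (rpredZ (<< e *g 1%g >> : R)).
- by move=> c x Nx; apply: (rpredZ (<< lgen c >> : R)).
Qed.

Lemma stable_submod (Z : set mod_space) : stable Z ->
  exists N : submodClosed L, forall x, (x \in N) <-> Z x.
Proof.
move=> sZ; apply: submod_of_set; first exact: subspace0 sZ.1.
move=> a x y zx zy.
apply: (@subspaceD _ _ mod_space _ _ _ sZ.1) => //; exact: stable_scale.
Qed.

End ModuleSpace.

Lemma ga_mul_scalar (k : fieldType) (d : nat) (x : {malg k[free_group d]}) (f : k) :
  ga_mul x << f *g 1%g >> = f *: x.
Proof.
by rewrite -[f in LHS]mulr1 -scale_monalgU ga_mulZr; congr (_ *: _); apply: ga_mulg1.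
Qed.

(** * Algebraic submodules and free quotients *)

Section Algebraic.
Context {k : fieldType} {d : nat}.
Local Notation F := (free_group d).
Local Notation A := {malg k[F]}.
Local Notation R := ((group_alg k F)^c).
Variable (L : lmodType R).
Local Notation V := (mod_space L).
Implicit Types (N : submodClosed L) (a : R) (x y z : L).

Definition carrier N : set V := [set x | x \in N].

Lemma submodB N x y : x \in N -> y \in N -> x - y \in N.
Proof. by move=> Nx Ny; rewrite -scaleN1r rpredD // rpredZ. Qed.

Lemma alg_one_neq0 : (<< 1%g >> : A) != 0.
Proof. by rewrite monalgU_eq0 oner_eq0. Qed.

(** If [H] reaches 1 at [e], then [x |-> H x *: e] projects [N] onto the submodule [P] generated by
    [e], with complement the kernel of [H], and [e] is a basis of [P]. *)
Lemma algebraic_no_free N : algebraic N -> no_free_quotient (carrier N).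
Proof.
move=> algN H HH e Ne; apply/eqP => He; have sN := submod_stable N.
have HZ a x : x \in N -> H (a *: x) = ga_mul (H x) a.
  by move=> Nx; rewrite -(mod_ract a (x : V)) (hom_ract _ sN HH) // alg_ract.
have HE a : H (a *: e) = a by rewrite HZ // He; apply: ga_mul1g.
have [P PE] : exists P : submodClosed L, forall x, (x \in P) <-> exists a, x = a *: e.
  apply: (stable_submod (L := L) (Z := [set x : V | exists a : R, x = a *: (e : L)])).
  split; first split.
  - by exists 0; rewrite [RHS](scale0r (e : L)).
  - move=> f x y [a ->] [b ->]; exists ((<< f *g 1%g >> : R) * a + b).
    by rewrite [RHS]scalerDl -[X in _ = X + _]scalerA.
  - by move=> c x [a ->]; exists ((<< lgen c >> : R) * a); rewrite -[RHS]scalerA.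
have [Q QE] : exists Q : submodClosed L, forall x, (x \in Q) <-> x \in N /\ H x = 0.
  apply: (stable_submod (L := L) (Z := [set x : V | x \in N /\ H x = 0])).
  split; first split.
  - by split; [exact: rpred0|rewrite (linon0 sN.1 HH.1)].
  - move=> f x y [Nx Hx] [Ny Hy]; split; first exact: sN.1.2.
    by rewrite HH.1 // Hx Hy scaler0 addr0.
  - move=> c x [Nx Hx]; have Ncx := sN.2 c _ Nx; split=> //.
    by rewrite HH.2 // Hx linear0.
have PN x : x \in P -> x \in N by move=> /PE[a ->]; apply: rpredZ.
have sum : is_direct_sum N P Q.
  split=> //; first by move=> x /QE[].
    move=> x Nx; exists ((H x : R) *: (e : L)); first by apply/PE; exists (H x).
    exists (x - (H x : R) *: (e : L)); last by rewrite addrC subrK.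
    apply/QE; split; first by apply: submodB => //; apply: rpredZ.
    have := linonB sN.1 HH.1 Nx (PN _ ((PE _).2 (ex_intro _ (H x : R) erefl))).
    by move=> ->; rewrite HE subrr.
  by move=> x /PE[a ->] /QE[_]; rewrite HE => ->; rewrite scale0r.
have free : is_free P.
  exists [set (e : L)]; split.
  - by move=> b ->; apply/PE; exists 1; rewrite scale1r.
  - move=> x /PE[a ->]; exists [:: (e : L)], (fun=> a); split.
      by move=> b; rewrite inE => /eqP ->.
    by rewrite big_seq1.
  - move=> s c us sE s0 b bs; have be : b = e := sE _ bs.
    have sE' : s = [:: b].
      case: s us sE bs {s0} => [//|u [|v s]] us sE; first by rewrite inE => /eqP ->.
      have := sE u; rewrite mem_head => /(_ isT) ue.
      have := sE v; rewrite !inE eqxx orbT => /(_ isT) ve.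
      by move: us; rewrite ue ve /= inE eqxx.
    by move: s0; rewrite sE' big_seq1 be => /(congr1 (H : L -> A)); rewrite HE (linon0 sN.1 HH.1).
have e0 := algN P Q sum free (e : L) ((PE _).2 (ex_intro _ 1 (esym (scale1r _)))).
by move: He; rewrite e0 (linon0 sN.1 HH.1) => /esym/eqP; rewrite (negbTE alg_one_neq0).
Qed.

(** The coefficient function is required to vanish off [s], so that for a basis it is determined by
    [x] although [s] is not. *)
Definition expands (B : set L) (s : seq L) (c : L -> R) x :=
  [/\ uniq s, forall b, b \in s -> B b, forall b, b \notin s -> c b = 0 &
      x = \sum_(b <- s) c b *: b].

Lemma expands_incl B s s' c x : expands B s c x -> uniq s' -> {subset s <= s'} ->
  x = \sum_(b <- s') c b *: b.
Proof.
move=> [us sB c0 ->] us' ss'.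
rewrite [RHS](bigID (mem s)) /= [X in _ + X]big1 ?addr0; last first.
  by move=> b /c0 ->; rewrite scale0r.
rewrite -[RHS]big_filter; apply: perm_big; apply: uniq_perm => //; first exact: filter_uniq.
move=> b; rewrite mem_filter; apply/idP/andP => [bs|[]//]; split=> //; exact: ss'.
Qed.

Lemma expands_lin B s1 s2 c1 c2 x1 x2 (f : L -> R) x (a1 a2 : R) :
  expands B s1 c1 x1 -> expands B s2 c2 x2 ->
  x = a1 *: x1 + a2 *: x2 -> (forall b, f b = a1 * c1 b + a2 * c2 b) ->
  expands B (undup (s1 ++ s2)) f x.
Proof.
move=> e1 e2 -> fE; have [_ B1 z1 _] := e1; have [_ B2 z2 _] := e2.
split; first exact: undup_uniq.
- by move=> b; rewrite mem_undup mem_cat => /orP[/B1|/B2].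
- move=> b; rewrite mem_undup mem_cat negb_or => /andP[n1 n2].
  by rewrite fE z1 // z2 // !mulr0 addr0.
rewrite [in LHS](expands_incl e1 (undup_uniq (s1 ++ s2))); last first.
  by move=> b bs; rewrite mem_undup mem_cat bs.
rewrite [in LHS](expands_incl e2 (undup_uniq (s1 ++ s2))); last first.
  by move=> b bs; rewrite mem_undup mem_cat bs orbT.
rewrite !scaler_sumr -big_split /=; apply: eq_bigr => b _.
by rewrite fE scalerDl !scalerA.
Qed.

Lemma expands_exists P B x : is_basis P B -> x \in P -> exists s c, expands B s c x.
Proof.
move=> [_ gen _] /gen[s [c [sB ->]]].
elim: s sB => [|u s IH] sB.
  by exists [::], (fun=> 0); split=> //; rewrite !big_nil.
have [|s' [c' e']] := IH; first by move=> b bs; apply: sB; rewrite inE bs orbT.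
have eu : expands B [:: u] (fun b => if b == u then c u else 0) (c u *: u).
  split=> //; first by move=> b; rewrite inE => /eqP ->; apply: sB; rewrite mem_head.
    by move=> b; rewrite inE => /negbTE ->.
  by rewrite big_seq1 eqxx.
exists (undup ([:: u] ++ s')), (fun b => 1 * (if b == u then c u else 0) + 1 * c' b).
by apply: (expands_lin eu e') => //; rewrite big_cons !scale1r.
Qed.

Lemma expands_unique P B s1 s2 c1 c2 x : is_basis P B ->
  expands B s1 c1 x -> expands B s2 c2 x -> c1 =1 c2.
Proof.
move=> [_ _ indep] e1 e2 b.
have x0 : 0 = 1 *: x + (-1) *: x by rewrite scale1r scaleN1r subrr.
pose f b := 1 * c1 b + (-1) * c2 b.
have [uu uB u0 uE] := expands_lin e1 e2 x0 (f := f) (fun=> erefl).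
have := indep _ f uu uB (esym uE) b.
case bs: (b \in undup (s1 ++ s2)); last first.
  have [_ _ z1 _] := e1; have [_ _ z2 _] := e2.
  move: bs => /negbT; rewrite mem_undup mem_cat negb_or => /andP[n1 n2].
  by rewrite z1 // z2.
move=> /(_ isT); rewrite /f.
by rewrite mul1r mulN1r => /eqP; rewrite subr_eq0 => /eqP.
Qed.

(** A nonzero free summand [P] has a basis vector [b]. Projecting to [P] and taking the coefficient
    at [b] is a homomorphism into the group algebra with value 1 at [b]. *)
Lemma no_free_algebraic N : no_free_quotient (carrier N) -> algebraic N.
Proof.
move=> nfN P Q [PN QN spl dis] [B bB] x Px.
apply/eqP/negPn/negP => x0; have [BP _ _] := bB.
have [b Bb] : exists b, B b.
  apply/not_existsP => nB; have [[|u s] [c [_ sB _ xE]]] := expands_exists bB Px.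
    by case/eqP: x0; rewrite xE big_nil.
  by apply: (nB u); apply: sB; rewrite mem_head.
pose G (v : V) (a : A) := exists y z s c,
  [/\ y \in P, z \in Q, (v : L) = y + z, expands B s c y & c b = a :> A].
have Gex v : (v : L) \in N -> exists a, G v a.
  move=> /spl[y Py [z Qz vE]]; have [s [c e]] := expands_exists bB Py.
  by exists (c b), y, z, s, c.
have Guniq v a a' : G v a -> G v a' -> a = a'.
  move=> [y [z [s [c [Py Qz vE e <-]]]]] [y' [z' [s' [c' [Py' Qz' vE' e' <-]]]]].
  have yy : y = y'.
    apply/eqP; rewrite -subr_eq0; apply/eqP/dis; first exact: submodB.
    have -> : y - y' = z' - z; last exact: submodB.
    by apply/eqP; rewrite subr_eq addrAC -subr_eq opprK -vE [z' + _]addrC -vE'.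
  by move: e'; rewrite -yy => e'; apply: (expands_unique bB e e').
have Glin v1 v2 a1 a2 (r1 r2 : R) : G v1 a1 -> G v2 a2 ->
   G (r1 *: (v1 : L) + r2 *: (v2 : L)) (ga_mul a1 r1 + ga_mul a2 r2).
  move=> [y [z [s [c [Py Qz -> e <-]]]]] [y' [z' [s' [c' [Py' Qz' -> e' <-]]]]].
  exists (r1 *: y + r2 *: y'), (r1 *: z + r2 *: z'), (undup (s ++ s')),
    (fun u => r1 * c u + r2 * c' u); split.
  - by rewrite rpredD // rpredZ.
  - by rewrite rpredD // rpredZ.
  - by rewrite !scalerDr addrACA.
  - exact: expands_lin e e' _ _.
  - by [].
pose H (v : V) : @alg_space k d := xget 0 (G v).
have HG v : (v : L) \in N -> G v (H v).
  by move=> /Gex[a Ga]; rewrite /H; case: xgetP => [a' _ //|/(_ a)].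
have HE v a : G v a -> H v = a.
  by move=> Ga; rewrite /H; case: xgetP => [a' _ /= Ga'|/(_ a)//]; apply: Guniq Ga' Ga.
have Gcast v v' a a' : v = v' -> a = a' -> G v a -> G v' a' by move=> <- <-.
have HH : hom (carrier N) H.
  split=> [f u v Nu Nv|c u Nu Ncu]; apply: HE.
    apply: Gcast (Glin _ _ _ _ (<< f *g 1%g >> : R) 1 (HG _ Nu) (HG _ Nv)).
      exact: (congr1 (fun t : L => (<< f *g 1%g >> : R) *: (u : L) + t) (scale1r (v : L))).
    apply: f_equal2; last exact: ga_mulg1.
    exact: ga_mul_scalar.
  apply: Gcast (Glin _ _ _ _ (<< lgen c >> : R) 0 (HG _ Nu) (HG _ Nu)).
    apply: etrans (addr0 ((<< lgen c >> : R) *: (u : L))).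
    exact: (congr1 (fun t : L => (<< lgen c >> : R) *: (u : L) + t) (scale0r (u : L))).
  apply: etrans (addr0 (ga_mul (H u) << lgen c >>)).
  exact: (congr1 (fun t : A => ga_mul (H u) << lgen c >> + t) (ga_mul0r _)).
have /eqP := nfN H HH (b : V) (PN _ (BP _ Bb)); apply; apply: HE.
exists b, 0, [:: b], (fun u => if u == b then 1 else 0); split.
- exact: BP.
- exact: rpred0.
- by rewrite addr0.
- split=> //; first by move=> u; rewrite inE => /eqP ->.
    by move=> u; rewrite inE => /negbTE ->.
  by rewrite big_seq1 eqxx scale1r.
- by rewrite eqxx.
Qed.

End Algebraic.

(** * Existence of a window *)

Section RactLaws.
Context {k : fieldType} {d : nat}.
Local Notation F := (free_group d).
Local Notation A := {malg k[F]}.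
Implicit Types (X Y : fspace k d) (c : @letter d) (a b : A).

Lemma wact_lmul X c (w : seq letter) (v : X) : wact (lmul c w) v = wact w (act c v).
Proof.
case: w => [|b w] //=; case: eqP => [->|] //=.
by rewrite actK.
Qed.

Lemma wact_wmul X (u w : seq letter) (v : X) : wact (wmul u w) v = wact w (wact u v).
Proof. by elim: u v => //= c u IH v; rewrite wact_lmul IH. Qed.

Lemma ractw X (e : {fset F}) a (v : X) : (msupp a `<=` e)%fset ->
  ract a v = \sum_(g <- e) a@_g *: wact (fg_word g) v.
Proof.
move=> le; rewrite /ract (big_fset_incl _ le) // => g _ /mcoeff_outdom ->.
by rewrite scale0r.
Qed.

Lemma ract_linear X (v : X) (f : k) a b : ract (f *: a + b) v = f *: ract a v + ract b v.
Proof.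
pose e := (msupp a `|` msupp b `|` msupp (f *: a + b))%fset.
have ea : (msupp a `<=` e)%fset by apply: fsubset_trans (fsubsetUl _ _) (fsubsetUl _ _).
have eb : (msupp b `<=` e)%fset by apply: fsubset_trans (fsubsetUr _ _) (fsubsetUl _ _).
have eab : (msupp (f *: a + b) `<=` e)%fset by apply: fsubsetUr.
rewrite (ractw v ea) (ractw v eb) (ractw v eab) scaler_sumr -big_split /=.
by apply: eq_bigr => g _; rewrite mcoeffD mcoeffZ scalerDl scalerA.
Qed.

Lemma ractU X (f : k) (g : F) (v : X) : ract << f *g g >> v = f *: wact (fg_word g) v.
Proof. by rewrite (ractw v msuppU_le) big_seq_fset1 mcoeffUU. Qed.

Lemma ract_hom X (v : X) : hom setT (fun a : @alg_space k d => ract a v : X).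
Proof.
have lin : linon setT (fun a : @alg_space k d => ract a v : X).
  by move=> f a b _ _; apply: ract_linear.
split=> // c a _ _.
have sT := @subspaceT _ _ (@alg_space k d).
have -> : a = \sum_(g <- msupp a) a@_g *: (<< g >> : A) :> A.
  by rewrite {1}(monalgE a); apply: eq_bigr => g _; rewrite scale_monalgU mulr1.
rewrite linear_sum !(linon_sum (h := fun a : @alg_space k d => ract a v : X) _ sT lin) //.
rewrite linear_sum; apply: eq_bigr => g _.
rewrite linearZ !(linonZ (h := fun a : @alg_space k d => ract a v : X) _ sT lin) // linearZ.
congr (_ *: _); rewrite /= /rmulg ga_mulUU mulr1 !ractU !scale1r.
by rewrite wact_wmul.
Qed.

Lemma ract_mul X a b (v : X) : ract (ga_mul b a) v = ract a (ract b v).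
Proof.
by rewrite -(hom_ract a stableT (ract_hom v) I) alg_ract.
Qed.

Lemma wactD X w (u v : X) : wact w (u + v) = wact w u + wact w v.
Proof. by elim: w u v => //= c w IH u v; rewrite linearD IH. Qed.

Lemma wact0 X w : wact w (0 : X) = 0.
Proof. by elim: w => //= c w IH; rewrite linear0. Qed.

Lemma ractDr X a (u v : X) : ract a (u + v) = ract a u + ract a v.
Proof.
by rewrite /ract -big_split; apply: eq_bigr => g _; rewrite /= wactD scalerDr.
Qed.

Lemma ract0r X a : ract a (0 : X) = 0.
Proof. by rewrite /ract big1 // => g _; rewrite wact0 scaler0. Qed.

Lemma hom_wact_prefix X Y (Z : set X) (h : X -> Y) w (v : X) : hom Z h ->
  (forall i, (i <= size w)%N -> Z (wact (take i w) v)) -> h (wact w v) = wact w (h v).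
Proof.
move=> hh; elim: w v => //= c w IH v hZ; rewrite IH; last first.
  by move=> i le; apply: (hZ i.+1).
by rewrite hh.2 //; [apply: (hZ 0%N)|have := hZ 1%N isT; rewrite /= take0].
Qed.

Lemma fd_span X (s : seq X) : exists2 Z : set X, fd Z &
  (forall x, x \in s -> Z x) /\
  (forall S, subspace S -> (forall x, x \in s -> S x) -> Z `<=` S).
Proof.
elim: s => [|u s [Z fZ [Zs Zmin]]].
  exists [set 0].
    pose z (_ : 'rV[k]_0) : X := 0.
    have zl : linear z by move=> a x y; rewrite /z scaler0 addr0.
    pose zL : {linear 'rV[k]_0 -> X} := HB.pack z (GRing.isLinear.Build _ _ _ _ _ zl).
    exists 0%N, zL; split; first by move=> x y _; rewrite (thinmx0 x) (thinmx0 y).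
    by apply/seteqP; split=> [_ ->|_ [x _ <-]] //; exists 0.
  by split=> // S [S0 _] _ x ->.
exists (addl Z u); first exact: fd_addl.
have sZ := fd_subspace fZ.
split=> [x|S sS hS]; last first.
  apply: addl_min => //; last by apply: hS; rewrite mem_head.
  by apply: Zmin => // x xs; apply: hS; rewrite inE xs orbT.
rewrite inE => /predU1P[->|xs]; first exact: addl_vec.
exact/addl_sub/Zs.
Qed.

Lemma grow_agree X Y (Z Z' : set X) (h H : X -> Y) : grow Z Z' -> fd Z ->
  hom Z' h -> hom setT H -> (forall x, Z x -> H x = h x) -> forall x, Z' x -> H x = h x.
Proof.
move=> gZ fZ hh HH e; elim: gZ hh => // Z1 y b g1 IH y1 hh.
have Z12 : Z1 `<=` addl Z1 (act b y) by apply: addl_sub.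
have s1 := fd_subspace (grow_fd g1 fZ).
have {}IH := IH (hom_sub Z12 hh).
have zb : addl Z1 (act b y) (act b y) by apply: addl_vec.
move=> x [a xa]; rewrite -[x](subrK (a *: act b y)) addrC.
rewrite (HH.1 a) // (hh.1 a) //; last exact: Z12.
by rewrite HH.2 // (hh.2 b y) ?IH //; apply: Z12.
Qed.

End RactLaws.

Section WindowExistence.
Context {k : fieldType} {d : nat}.
Local Notation F := (free_group d).
Local Notation A := {malg k[F]}.
Local Notation R := ((group_alg k F)^c).
Variable (L : lmodType R).
Local Notation V := (mod_space L).

Lemma presentation_value r (p : {linear 'rV[R]_r -> L}) (y : 'rV[R]_r) :
  p y = \sum_l ract (y 0 l) (p (delta_mx 0 l) : V) :> V.
Proof.
rewrite {1}[y]row_sum_delta linear_sum /=; apply: eq_bigr => l _.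
by apply: etrans (linearZ_LR p _ _) _; rewrite mod_ract.
Qed.

Section Extend.
Variables (r s : nat) (f : {linear 'rV[R]_s -> 'rV[R]_r}) (p : {linear 'rV[R]_r -> L}).
Hypothesis pres : presents f p.
Variables (X : fspace k d) (e : 'I_r -> X).

Let H0 (y : 'rV[R]_r) : X := \sum_l ract (y 0 l) (e l).

Let H0D (y z : 'rV[R]_r) : H0 (y + z) = H0 y + H0 z.
Proof.
rewrite /H0 -big_split; apply: eq_bigr => l _ /=.
by have := ract_linear (e l) 1 (y 0 l) (z 0 l); rewrite !scale1r mxE.
Qed.

Let H0Z (a : R) (y : 'rV[R]_r) : H0 (a *: y) = ract a (H0 y).
Proof.
rewrite /H0 (big_morph _ (ractDr a) (ract0r X a)); apply: eq_bigr => l _.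
by rewrite -ract_mul mxE.
Qed.

Hypothesis rel0 : forall j, H0 (f (delta_mx 0 j)) = 0.

Lemma H0_relations (z : 'rV[R]_s) : H0 (f z) = 0.
Proof.
have H00 : H0 0 = 0 by apply: (addrI (H0 0)); rewrite -H0D !addr0.
rewrite [z]row_sum_delta linear_sum /=; elim/big_rec: _ => [//|j y _ y0].
have -> : f (z 0 j *: delta_mx 0 j) = z 0 j *: f (delta_mx 0 j) by apply: linearZ_LR.
by rewrite H0D y0 H0Z rel0 ract0r addr0.
Qed.

(** [H0] vanishes on the kernel of [p], so composing it with any section of [p] gives a well-defined
    homomorphism. *)
Lemma presentation_extend : exists2 H : V -> X, hom setT H &
  forall l, H (p (delta_mx 0 l)) = e l.
Proof.
have [psurj pker] := pres.
pose sec (x : V) : 'rV[R]_r := xget 0 [set y | p y = x].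
have secE x : p (sec x) = x.
  by rewrite /sec; case: xgetP => [y _ //|]; have [y py] := psurj x => /(_ y).
have wd y : H0 (sec (p y)) = H0 y.
  have : p (sec (p y) - y) = 0 by rewrite linearB secE subrr.
  move=> /pker[z fz]; have := H0_relations z; rewrite fz => h.
  by rewrite -[sec _](subrK y) H0D h add0r.
exists (fun x => H0 (sec x)).
  split=> [a x y _ _|c x _ _].
    have -> : a *: x + y = p ((<< a *g 1%g >> : R) *: sec x + sec y).
      by rewrite linearP !secE.
    rewrite wd H0D H0Z ractU; congr (_ + _).
  have -> : act c x = p ((<< lgen c >> : R) *: sec x).
    by rewrite linearZ_LR secE.
  by rewrite wd H0Z ractU scale1r.
move=> l; rewrite wd /H0 (bigD1 l) //= big1 ?addr0 => [|j ne].
  by rewrite mxE !eqxx ractU scale1r.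
by rewrite mxE (negbTE ne) andbF /ract msupp0 big_seq_fset0.
Qed.

End Extend.

Theorem window_exists : fin_presented L ->
  exists m (iota : {linear 'rV[k]_m -> V}),
    [/\ injective iota, cl (range iota) = setT &
        forall X, extends_to X setT (range iota)].
Proof.
case=> r [s [f [p pres]]]; have [psurj pker] := pres.
have [Z0 fZ0 [Z0p Z0min]] := fd_span [seq (p (delta_mx 0 l) : V) | l <- enum 'I_r].
have Z0e l : Z0 (p (delta_mx 0 l)) by apply: Z0p; apply: map_f; rewrite mem_enum.
have clZ0 : cl Z0 = setT.
  apply/seteqP; split=> // x _; have [y <-] := psurj x.
  rewrite presentation_value; apply: (subspace_sum _ (stable_cl Z0).1) => l _.
  exact: (stable_ract _ (stable_cl Z0) (cl_sub (Z0e l))).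
(* The window takes in the whole path of every word of every relator, starting at the generators, so
   that a partial homomorphism can be evaluated along the relators. *)
pose pre (l : 'I_r) (g : F) : seq V :=
  [seq wact (take i (fg_word g)) (p (delta_mx 0 l) : V) | i <- iota 0 (size (fg_word g)).+1].
pose t : seq V := flatten [seq flatten [seq
    flatten [seq pre l g | g <- msupp (f (delta_mx 0 j) 0 l : A)]
  | l <- enum 'I_r] | j <- enum 'I_s].
have [|Z gZ tZ] := @grow_seq _ _ _ Z0 t fZ0; first by rewrite clZ0.
have fZ := grow_fd gZ fZ0; have sZ := fd_subspace fZ.
have Zpre j l g i : g \in msupp (f (delta_mx 0 j) 0 l : A) -> (i <= size (fg_word g))%N ->
    Z (wact (take i (fg_word g)) (p (delta_mx 0 l) : V)).
  move=> gs le; apply: tZ; apply/flattenP.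
  eexists; first by apply: map_f; rewrite mem_enum.
  apply/flattenP; eexists; first by apply: (map_f _ (_ : l \in _)); rewrite mem_enum.
  apply/flattenP; eexists; first by apply: map_f; exact: gs.
  by apply/mapP; exists i; rewrite // mem_iota add0n ltnS.
have Ze l : Z (p (delta_mx 0 l)) by apply: (grow_sub gZ).
have ext X : extends_to X setT Z.
  move=> h hh; pose e l := h (p (delta_mx 0 l)).
  have [|H HH He] := @presentation_extend r s f p pres X e.
    move=> j; set y := f (delta_mx 0 j).
    have hpy : h (p y) = 0.
      have -> : p y = 0 by apply/pker; exists (delta_mx 0 j).
      exact: linon0 sZ hh.1.
    apply: etrans _ hpy.
    have Zg l g : g \in msupp (y 0 l : A) -> Z (wact (fg_word g) (p (delta_mx 0 l) : V)).
      by move=> gs; have := Zpre j l g _ gs (leqnn _); rewrite take_size.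
    have Zl l : Z (ract (y 0 l) (p (delta_mx 0 l) : V)).
      rewrite /ract big_seq; apply: subspace_sum => // g gs.
      by apply: subspaceZ => //; apply: Zg.
    rewrite presentation_value (linon_sum _ sZ hh.1) //.
    apply: eq_bigr => l _; rewrite /ract big_seq [in RHS]big_seq.
    rewrite (linon_sum _ sZ hh.1); last by move=> g gs; apply: subspaceZ => //; apply: Zg.
    apply: eq_bigr => g gs; rewrite (linonZ _ sZ hh.1); last exact: Zg.
    congr (_ *: _); rewrite (hom_wact_prefix hh) // => i; exact: Zpre gs.
  exists H => //; apply: (grow_agree gZ fZ0 hh HH) => x Zx.
  have Z0Z := grow_sub gZ.
  apply: (Z0min [set x | Z x /\ H x = h x] _ _ x Zx).2.
    split.
      by split; [exact: subspace0 sZ|rewrite (linon0 sZ hh.1) (linon0 subspaceT HH.1)].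
    move=> a u v [Zu hu] [Zv hv]; split; first exact: sZ.2.
    by rewrite HH.1 // hh.1 // hu hv.
  by move=> _ /mapP[l _ ->]; split; [apply: Ze|rewrite He].
have [m [iota [inj ZE]]] := fZ.
exists m, iota; rewrite -ZE; split=> //.
apply/seteqP; split=> // x _; have : cl Z0 x by rewrite clZ0.
apply: cl_min; first exact: stable_cl.
by move=> z zz; apply: cl_sub; apply: (grow_sub gZ).
Qed.

End WindowExistence.

(** * Uniqueness of the Euler characteristic *)

Section Augmentation.
Context {k : fieldType} {d : nat}.
Local Notation F := (free_group d).
Local Notation A := {malg k[F]}.
Local Notation R := ((group_alg k F)^c).

Definition triv_space : fspace k d := mxspace (rho := fun=> 1%:M : 'M[k]_1) (fun=> mulmx1 _).

Lemma triv_wact w (v : triv_space) : wact w v = v.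
Proof. by elim: w v => //= c w IH v; rewrite IH mulmx1. Qed.

(** The augmentation, read off from the trivial one-dimensional module; it transports matrix
    identities to a field, where ranks are available. *)
Definition augm (a : R) : k := (ract a (1%:M : triv_space) : 'M[k]_1) 0 0.

Lemma triv_ract (a : R) (v : triv_space) : ract a v = augm a *: v.
Proof.
have E (w : triv_space) : ract a w = (\sum_(g <- msupp (a : A)) (a : A)@_g) *: w.
  by rewrite scaler_suml; apply: eq_bigr => g _; rewrite triv_wact.
by rewrite /augm !E mxE mxE eqxx mulr1.
Qed.

Lemma augm_zmod : zmod_morphism augm.
Proof.
move=> a b; rewrite /augm -scaleN1r addrC.
have -> : ract (-1 *: (b : A) + a) (1%:M : triv_space) = _ := ract_linear _ _ _ _.
by rewrite mxE mxE mulN1r addrC.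
Qed.

Lemma augm_monoid : monoid_morphism augm.
Proof.
split.
  rewrite /augm; have -> : ract (1 : R) _ = _ := ractU 1 1%g (1%:M : triv_space).
  by rewrite scale1r /= mxE.
move=> a b; rewrite /augm; have -> : ract (a * b) _ = _ := ract_mul a b (1%:M : triv_space).
by rewrite !triv_ract scalerA mxE [X in _ * X]mxE eqxx mulr1 /augm !triv_ract !mxE !eqxx !mulr1.
Qed.

HB.instance Definition _ := GRing.isZmodMorphism.Build R k augm augm_zmod.
HB.instance Definition _ := GRing.isMonoidMorphism.Build R k augm augm_monoid.

End Augmentation.

Section EulerCharUnique.
Context {k : fieldType} {d : nat}.
Local Notation R := ((group_alg k (free_group d))^c).
Variable (M : lmodType R).

Lemma rV_linear_mulmx s r (f : {linear 'rV[R]_s -> 'rV[R]_r}) :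
  exists Fm : 'M[R]_(s, r), forall u, f u = u *m Fm.
Proof.
exists (\matrix_i f (delta_mx 0 i)) => u.
rewrite {1}[u]row_sum_delta linear_sum mulmx_sum_row; apply: eq_bigr => i _.
by rewrite rowK; apply: linearZ_LR.
Qed.

Section Compare.
Variables (r s r' s' : nat) (f : {linear 'rV[R]_s -> 'rV[R]_r}) (p : {linear 'rV[R]_r -> M}).
Variables (f' : {linear 'rV[R]_s' -> 'rV[R]_r'}) (p' : {linear 'rV[R]_r' -> M}).
Hypotheses (pres : presents f p) (f_inj : injective f) (pres' : presents f' p').

Lemma lift_mx q (X : 'M[R]_(q, r)) : (forall i, p (row i X) = 0) ->
  exists U : 'M[R]_(q, s), forall Fm, (forall u, f u = u *m Fm) -> X = U *m Fm.
Proof.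
move=> h; have /choice[u uE] : forall i, exists u, f u = row i X.
  by move=> i; have [_ pk] := pres; apply: (pk _).1 (h i).
exists (\matrix_i u i) => Fm FmE; apply/row_matrixP => i.
by rewrite row_mul rowK -FmE uE.
Qed.

Lemma transfer_mx : exists Am : 'M[R]_(r', r), forall y, p (y *m Am) = p' y.
Proof.
have /choice[x xE] : forall i : 'I_r', exists x, p x = p' (delta_mx 0 i).
  by move=> i; have [ps _] := pres; apply: ps.
exists (\matrix_i x i) => y; rewrite mulmx_sum_row {2}[y]row_sum_delta !linear_sum.
apply: eq_bigr => i _; rewrite rowK.
by apply: etrans (linearZ_LR p _ _) _; rewrite xE; apply/esym/linearZ_LR.
Qed.

End Compare.

(* Schanuel's lemma in matrix form: two presentations are compared by a pair of
   block matrices with product 1, and the augmentation reduces them to [k]. *)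
Lemma schanuel_leq r s r' s' (f : {linear 'rV[R]_s -> 'rV[R]_r}) (p : {linear 'rV[R]_r -> M})
    (f' : {linear 'rV[R]_s' -> 'rV[R]_r'}) (p' : {linear 'rV[R]_r' -> M}) :
  presents f p -> injective f -> presents f' p' -> (s + r' <= s' + r)%N.
Proof.
move=> pres f_inj pres'.
have [Fm FE] := rV_linear_mulmx f; have [Fm' FE'] := rV_linear_mulmx f'.
have [Am AE] := transfer_mx p' pres; have [Bm BE] := transfer_mx p pres'.
have pF i : p (row i Fm) = 0.
  by have [_ pk] := pres; apply: (pk _).2; exists (delta_mx 0 i); rewrite FE rowE.
have pF' i : p' (row i Fm') = 0.
  by have [_ pk] := pres'; apply: (pk _).2; exists (delta_mx 0 i); rewrite FE' rowE.
have [|U /(_ _ FE') UE] := lift_mx pres' (X := 1%:M - Am *m Bm).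
  move=> i; have -> : row i (1%:M - Am *m Bm) = delta_mx 0 i - delta_mx 0 i *m Am *m Bm.
    by rewrite raddfB /= row1 row_mul rowE.
  by apply: etrans (linearB p' _ _) _; rewrite BE AE subrr.
have [|U' /(_ _ FE) UE'] := lift_mx pres (X := 1%:M - Bm *m Am).
  move=> i; have -> : row i (1%:M - Bm *m Am) = delta_mx 0 i - delta_mx 0 i *m Bm *m Am.
    by rewrite raddfB /= row1 row_mul rowE.
  by apply: etrans (linearB p _ _) _; rewrite AE BE subrr.
have [|G /(_ _ FE') GE] := lift_mx pres' (X := Fm *m Bm).
  by move=> i; rewrite row_mul BE pF.
have [|G' /(_ _ FE) GE'] := lift_mx pres (X := Fm' *m Am).
  by move=> i; rewrite row_mul AE pF'.
have cancelF q (X Y : 'M[R]_(q, s)) : X *m Fm = Y *m Fm -> X = Y.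
  move=> e; apply/row_matrixP => i; apply: f_inj.
  by rewrite !FE -!row_mul e.
pose Bl := block_mx (- G) Fm U Am; pose Cl := block_mx (- G') Fm' U' Bm.
have BC : Bl *m Cl = 1%:M.
  rewrite mulmx_block [RHS]scalar_mx_block; congr block_mx.
  - rewrite mulNmx mulmxN opprK; apply: cancelF.
    rewrite mulmxDl -!mulmxA -GE' -UE' mul1mx mulmxBr mulmx1.
    by rewrite !mulmxA -GE addrCA subrr addr0.
  - by rewrite mulNmx -GE addNr.
  - rewrite mulmxN; apply: cancelF.
    rewrite mulmxDl mulNmx -!mulmxA -GE' -UE' mul0mx mulmxBr mulmx1 !mulmxA -UE.
    by rewrite mulmxBl mul1mx addNr.
  - by rewrite -UE subrK.
have := congr1 (map_mx augm) BC; rewrite map_mxM map_mx1.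
exact: mulmx1_min.
Qed.

Lemma has_euler_char_inj c1 c2 : has_euler_char M c1 -> has_euler_char M c2 -> c1 = c2.
Proof.
move=> [r [s [f [p [pres inj ->]]]]] [r' [s' [f' [p' [pres' inj' ->]]]]].
have := schanuel_leq pres inj pres'; have := schanuel_leq pres' inj' pres.
lia.
Qed.

Lemma euler_charE c : has_euler_char M c -> euler_char M = c.
Proof.
move=> h; rewrite /euler_char; case: xgetP => [c' _ /= h'|/(_ c)//].
exact: has_euler_char_inj h' h.
Qed.

Lemma has_euler_char_fin_presented c : has_euler_char M c -> fin_presented M.
Proof. by move=> [r [s [f [p [pres _ _]]]]]; exists r, s, f, p. Qed.

End EulerCharUnique.

(** * The presentation attached to a window *)

Section LeftTranslation.
Context {k : fieldType} {d : nat}.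
Local Notation F := (free_group d).
Local Notation A := {malg k[F]}.
Implicit Types (c : @letter d) (u h : F).

Lemma ga_mulU_mcoeff (e : k) u (y : A) h :
  (ga_mul << e *g u >> y)@_h = e * y@_(u^-1 * h)%g.
Proof.
rewrite {1}(monalgE y) ga_mul_sumr raddf_sum /=.
under eq_bigr => x _ do rewrite ga_mulUU mcoeffU.
have E (x : F) : ((u * x)%g == h) = (x == (u^-1 * h)%g).
  by apply/eqP/eqP => [<-|->]; rewrite ?mulKg ?mulKVg.
have [xg|nxg] := msuppP.
  rewrite (big_fsetD1 _ xg) /= E eqxx mulr1n big1_fset ?addr0 // => x.
  by rewrite in_fsetD1 E; case: eqP.
rewrite mulr0 big1_fset // => x xm _; rewrite E; case: eqP => // ex.
by rewrite -ex xm in nxg.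
Qed.

Lemma ga_mulBl (a b x : A) : ga_mul (a - b) x = ga_mul a x - ga_mul b x.
Proof.
apply: (addIr (ga_mul b x)); apply: etrans (esym (ga_mulDl _ _ _)) _.
exact: etrans (congr1 (ga_mul^~ x) (subrK b a)) (esym (subrK _ _)).
Qed.

Lemma ga_mul_rel (e f : k) c (x : A) h :
  (ga_mul (<< e *g lgen c >> - << f *g 1%g >>) x)@_h =
  e * x@_(lgen (linv c) * h)%g - f * x@_h.
Proof.
have E1 : (1^-1 * h = h)%g by rewrite invg1 mul1g.
have -> : ga_mul (<< e *g lgen c >> - << f *g 1%g >>) x =
    ga_mul << e *g lgen c >> x - ga_mul << f *g 1%g >> x by apply: ga_mulBl.
apply: etrans (mcoeffB _ _ _) _.
apply: etrans (f_equal2 (fun a b => a - b) (ga_mulU_mcoeff e (lgen c) x h)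
  (ga_mulU_mcoeff f 1%g x h)) _.
apply: f_equal2; first exact: (congr1 (fun g => e * x@_(g * h)%g) (lgenV c)).
exact: (congr1 (fun g => - (f * x@_g)) E1).
Qed.

Definition first_letter h : option letter := ohead (fg_word h).

Lemma first_letter_mul c h : first_letter h != Some (linv c) ->
  glen (lgen c * h)%g = (glen h).+1 /\ first_letter (lgen c * h)%g = Some c.
Proof.
case: h => [[|b w] rw]; rewrite /first_letter /glen //=.
move=> ne; have /negbTE -> // : b != linv c by apply: contra ne => /eqP ->.
Qed.

End LeftTranslation.

Section SystemInjective.
Context {k : fieldType} {d m : nat}.
Local Notation F := (free_group d).
Local Notation A := {malg k[F]}.
Local Notation R := ((group_alg k F)^c).
Variables (D g : 'I_d -> 'M[k]_m).
Hypothesis g_unit : forall i, g i \in unitmx.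

Let T := {i : 'I_d & 'I_(\rank (D i))}.
Local Notation pt := (existT (fun i : 'I_d => 'I_(\rank (D i)))).

Definition rel_row (t : T) : 'rV[k]_m := row (tagged t) (row_base (D (tag t))).

Definition cst (u : 'rV[k]_m) : 'rV[R]_m := \row_l (<< u 0 l *g 1%g >> : R).

(** One row for each generator [i] and each basis vector [v] of [D i], expressing the window
    relation [v x_i = v g_i]. *)
Definition rel_mx : 'M[R]_(#|{: T}|, m) := \matrix_(a, l)
  (<< rel_row (enum_val a) 0 l *g lgen (tag (enum_val a), true) >>
   - << (rel_row (enum_val a) *m g (tag (enum_val a))) 0 l *g 1%g >> : A).

Lemma card_rel_index : #|{: T}| = (\sum_i \rank (D i))%N.
Proof.
rewrite card_tagged sumnE big_map big_enum.
by apply: eq_bigr => i _; rewrite card_ord.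
Qed.

Section Kernel.
Variables (x : 'rV[R]_#|{: T}|).
Hypothesis x0 : x *m rel_mx = 0.

Let y (t : T) : A := x 0 (enum_rank t).

(** The coefficients of [x] at the group element [h], recombined into a vector of [D i]. *)
Let xi i h : 'rV[k]_m := (\row_j (y (pt i j))@_h) *m row_base (D i).

Let xiE i h : xi i h = \sum_j (y (pt i j))@_h *:
    rel_row (pt i j).
Proof. by rewrite /xi mulmx_sum_row; apply: eq_bigr => j _; rewrite mxE. Qed.

Let sum_tagged (f : T -> k) :
  \sum_i \sum_(j < \rank (D i)) f (pt i j) = \sum_t f t.
Proof.
rewrite (sig_big_dep _ _ (fun i j => f (pt i j))) /=.
by apply: eq_bigr => -[i j] _.
Qed.

(** This is the coefficient of [x *m rel_mx = 0] at [h]. Products are taken in the converse ring, so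
    the letters multiply group elements from the left. *)
Let xi_rel h : \sum_i xi i (lgen (i, false) * h)%g = \sum_i (xi i h *m g i).
Proof.
apply/rowP => l.
have := congr1 (fun M : 'rV[R]_m => (M 0 l : A)@_h) x0.
rewrite mxE [X in _ = X@_h -> _]mxE mcoeff0 raddf_sum /=.
rewrite (reindex enum_rank) /=; last by apply: onW_bij; apply: enum_rank_bij.
rewrite (eq_bigr (fun t : T => rel_row t 0 l * (y t)@_(lgen (tag t, false) * h)%g
   - (rel_row t *m g (tag t)) 0 l * (y t)@_h)); last first.
  move=> t _; rewrite mxE enum_rankK.
  exact: (ga_mul_rel _ _ (tag t, true) (y t) h).
rewrite sumrB => /eqP; rewrite subr_eq0 => /eqP.
rewrite -!sum_tagged /= !summxE => e.
rewrite (eq_bigr (fun i => \sum_j rel_row (pt i j) 0 l *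
   (y (pt i j))@_(lgen (i, false) * h)%g)); last first.
  by move=> i _; rewrite xiE summxE; apply: eq_bigr => j _; rewrite mxE mulrC.
rewrite e; apply: eq_bigr => i _; rewrite xiE mulmx_suml summxE.
by apply: eq_bigr => j _; rewrite -scalemxAl [RHS]mxE mulrC.
Qed.

(* A longest [h] with some [xi i h != 0] must start with [(i, false)], for this
   one [i], and then the relation at [h] itself reads [xi i h *m g i = 0]. *)
Let xi0 i h : xi i h = 0.
Proof.
pose occ n := exists i h, xi i h != 0 /\ glen h = n.
have [B Bmax] : exists B, forall n, `[< occ n >] -> (n <= B)%N.
  exists (\max_(t : T) \max_(h <- msupp (y t)) glen h) => n /asboolP[j [h' [ne <-]]].
  have [j' nej] : exists j', (y (pt j j'))@_h' != 0.
    apply/not_existsP => no; case/eqP: ne; rewrite xiE big1 // => j' _.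
    by have /negP := no j'; rewrite negbK => /eqP ->; rewrite scale0r.
  apply: leq_trans (leq_bigmax (pt j j')).
  by apply: leq_bigmax_seq => //; rewrite -mcoeff_neq0.
apply/eqP/negPn/negP => ne.
have occE : exists n, `[< occ n >] by exists (glen h); apply/asboolP; exists i, h.
case: (ex_maxnP occE Bmax) => n /asboolP[j [h0 [ne0 hn]]] nmax.
have long j' h' : glen h' = n.+1 -> xi j' h' = 0.
  move=> e; apply/eqP/negPn/negP => ne'.
  have : (n.+1 <= n)%N by apply: nmax; apply/asboolP; exists j', h'.
  by rewrite ltnn.
have long2 j' h' : glen h' = n.+2 -> xi j' h' = 0.
  move=> e; apply/eqP/negPn/negP => ne'.
  have : (n.+2 <= n)%N by apply: nmax; apply/asboolP; exists j', h'.
  by rewrite ltnNge leqnSn.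
have starts j' : xi j' h0 != 0 -> first_letter h0 = Some (j', false).
  move=> nej; apply/eqP/negPn/negP => fl.
  have [l1 f1] := first_letter_mul (c := (j', true)) fl.
  have := xi_rel (lgen (j', true) * h0)%g.
  rewrite [RHS]big1 => [|i' _]; last by rewrite long ?mul0mx // l1 hn.
  rewrite (bigD1 j') //= [X in _ + X]big1 ?addr0 => [|i' nei]; last first.
    have [|l2 _] := first_letter_mul (c := (i', false)) (h := (lgen (j', true) * h0)%g).
      by rewrite f1; apply: contra nei; rewrite /linv /= => /eqP[->].
    by rewrite long2 // l2 l1 hn.
  have -> : lgen (j', false) = (lgen (j', true))^-1%g by rewrite lgenV.
  by rewrite mulKg => e; rewrite e eqxx in nej.
have fl := starts j ne0; have := xi_rel h0.
rewrite big1 => [|i' _]; last first.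
  have [|l2 _] := first_letter_mul (c := (i', false)) (h := h0).
    by rewrite fl; apply/eqP => -[].
  by rewrite long // l2 hn.
rewrite (bigD1 j) //= big1 ?addr0 => [|i' nei]; last first.
  have [->|/starts] := eqVneq (xi i' h0) 0; first by rewrite mul0mx.
  by rewrite fl => -[e]; rewrite e eqxx in nei.
move=> /esym e; case/eqP: ne0.
by rewrite -[xi j h0](mulmxK (g_unit j)) e mul0mx.
Qed.

Lemma rel_mx_inj0 : x = 0.
Proof.
apply/rowP => a; rewrite -(enum_valK a) [RHS]mxE; case: (enum_val a) => i j.
apply/malgP => h; rewrite mcoeff0; have := xi0 i h.
rewrite /xi -[RHS](mul0mx _ (row_base (D i))) => /(row_free_inj (row_base_free _)).
by move/rowP/(_ j); rewrite !mxE.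
Qed.
End Kernel.
End SystemInjective.

Lemma rel_linear (k : fieldType) (d m : nat) (X : fspace k d) c (G : 'M[k]_m)
    (phi : {linear 'rV[k]_m -> X}) : linear (fun v => act c (phi v) - phi (v *m G)).
Proof.
move=> e v v'; rewrite mulmxDl -scalemxAl.
rewrite (linearP phi) (linearP (fs_act X c)) (linearP phi).
by rewrite opprD addrACA -scalerN -scalerDr.
Qed.

Lemma subspace_rowspace (k : fieldType) (d m n : nat) (X : fspace k d) (Z : set X)
    (psi : {linear 'rV[k]_m -> X}) (B : 'M[k]_(n, m)) :
  subspace Z -> (forall j, Z (psi (row j B))) -> forall u, (u <= B)%MS -> Z (psi u).
Proof.
move=> sZ hB u /submxP[w ->]; rewrite mulmx_sum_row linear_sum.
elim/big_rec: _ => [|j x _ Zx]; first exact: subspace0 sZ.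
by rewrite (linearZ_LR psi); apply: (subspaceD (Z := Z)) => //; apply: subspaceZ.
Qed.

Lemma linear_row_ext (R : nzRingType) (m : nat) (V : lmodType R) (f g : 'rV[R]_m -> V) :
  linear f -> linear g ->
  (forall l, f (delta_mx 0 l) = g (delta_mx 0 l)) -> f =1 g.
Proof.
move=> lf lg fg y; pose fL : {linear 'rV[R]_m -> V} := HB.pack f (GRing.isLinear.Build _ _ _ _ _ lf).
pose gL : {linear 'rV[R]_m -> V} := HB.pack g (GRing.isLinear.Build _ _ _ _ _ lg).
rewrite -[f]/(fL : _ -> _) -[g]/(gL : _ -> _) (row_sum_delta y) (linear_sum fL) (linear_sum gL).
apply: eq_bigr => l _.
by rewrite (linearZ_LR fL) (linearZ_LR gL) /= fg.
Qed.

Lemma quotmod_pi_linear (R : nzRingType) (M : lmodType R) (N : submodClosed M) :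
  linear (quotmod_pi N).
Proof. by move=> a x y; rewrite quotmod_piD quotmod_piZ. Qed.

Section QuotientSpace.
Context {k : fieldType} {d : nat}.
Local Notation R := ((group_alg k (free_group d))^c).
Variables (M : lmodType R) (N : submodClosed M).

Definition quotmod_modpi : mod_space M -> mod_space (quotmod N) := quotmod_pi N.

Lemma quotmod_modpi_linear : linear quotmod_modpi.
Proof. by move=> e x y; apply: (quotmod_pi_linear N (<< e *g 1%g >> : R)). Qed.

HB.instance Definition _ := GRing.isLinear.Build k (mod_space M) (mod_space (quotmod N)) _
  quotmod_modpi quotmod_modpi_linear.

Lemma quotmod_modpi_act c x : quotmod_modpi (act c x) = act c (quotmod_modpi x).
Proof. exact: (quotmod_piZ N (<< lgen c >> : R) x). Qed.

End QuotientSpace.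

Lemma hom_modLinear (k : fieldType) (d : nat)
    (M M' : lmodType (group_alg k (free_group d))^c) (H : mod_space M -> mod_space M') :
  hom setT H -> linear (H : M -> M').
Proof.
move=> HH a x y; apply: etrans (linonD HH.1 I I) _.
apply: (f_equal2 (fun u v : M' => u + v)) => //.
apply: etrans (congr1 H (esym (mod_ract a x))) _.
exact: etrans (hom_ract a (@stableT _ _ (mod_space M)) HH I) (mod_ract _ _).
Qed.

Section RowCombination.
Context {R : nzRingType} {M : lmodType R} {r : nat} (e : 'I_r -> M).

Definition row_comb (y : 'rV[R]_r) : M := \sum_l y 0 l *: e l.

Lemma row_comb_linear : linear row_comb.
Proof.
move=> a y z; rewrite /row_comb scaler_sumr -big_split /=; apply: eq_bigr => l _.
by rewrite !mxE scalerDl scalerA.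
Qed.

Lemma row_comb0 : row_comb 0 = 0.
Proof. by rewrite /row_comb big1 // => l _; rewrite mxE scale0r. Qed.

Lemma row_combZ a y : row_comb (a *: y) = a *: row_comb y.
Proof. by have := row_comb_linear a y 0; rewrite row_comb0 !addr0. Qed.

Lemma row_combB y z : row_comb (y - z) = row_comb y - row_comb z.
Proof. by have := row_comb_linear (-1) z y; rewrite !scaleN1r !(addrC (- _)). Qed.

Lemma row_comb_mul s (B : 'M[R]_(s, r)) x :
  (forall a, row_comb (row a B) = 0) -> row_comb (x *m B) = 0.
Proof.
move=> h; pose f : {linear 'rV[R]_r -> M} :=
  HB.pack row_comb (GRing.isLinear.Build _ _ _ _ _ row_comb_linear).
rewrite -[row_comb]/(f : _ -> _) mulmx_sum_row linear_sum big1 // => a _.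
by rewrite linearZ_LR /= h scaler0.
Qed.

Lemma row_comb_euler s (B : 'M[R]_(s, r)) :
  (forall x, exists y, row_comb y = x) ->
  (forall y, row_comb y = 0 <-> exists x : 'rV_s, x *m B = y) ->
  (forall x : 'rV_s, x *m B = 0 -> x = 0) ->
  has_euler_char M (r%:Z - s%:Z).
Proof.
move=> surj ker inj.
have fl : linear (fun x : 'rV[R]_s => x *m B).
  by move=> a x y; rewrite mulmxDl scalemxAl.
pose f : {linear 'rV[R]_s -> 'rV[R]_r} :=
  HB.pack (fun x : 'rV[R]_s => x *m B) (GRing.isLinear.Build _ _ _ _ _ fl).
pose p : {linear 'rV[R]_r -> M} :=
  HB.pack row_comb (GRing.isLinear.Build _ _ _ _ _ row_comb_linear).
exists r, s, f, p; split=> // x y e'.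
apply/eqP; rewrite -subr_eq0; apply/eqP/inj.
by rewrite mulmxBl; apply/eqP; rewrite subr_eq0; apply/eqP.
Qed.

End RowCombination.

Section SystemEuler.
Context {k : fieldType} {d m : nat}.
Local Notation F := (free_group d).
Local Notation A := {malg k[F]}.
Local Notation R := ((group_alg k F)^c).
Variables (D g : 'I_d -> 'M[k]_m).
Hypothesis g_unit : forall i, g i \in unitmx.
Variables (M : lmodType R) (p0 : {linear 'rV[k]_m -> mod_space M}).
Hypothesis p0_gen : cl (range p0) = setT.
Hypothesis p0_rel : forall i u, (u <= D i)%MS -> act (i, true) (p0 u) = p0 (u *m g i).
Hypothesis p0_ext : forall (X : fspace k d) (phi : {linear 'rV[k]_m -> X}),
  (forall i u, (u <= D i)%MS -> act (i, true) (phi u) = phi (u *m g i)) ->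
  exists2 H : mod_space M -> X, hom setT H & forall u, H (p0 u) = phi u.

Local Notation s := #|{: {i : 'I_d & 'I_(\rank (D i))}}|.
Local Notation W := (mod_space 'rV[R]_m).

Definition sys_p : 'rV[R]_m -> M := row_comb (fun l => (p0 (delta_mx 0 l) : M)).

Definition cstw (u : 'rV[k]_m) : W := cst u.

Lemma cstw_linear : linear cstw.
Proof.
move=> e u v; apply/rowP => l; rewrite [LHS]mxE [RHS]mxE [X in _ = X + _]mxE.
rewrite [X in _ = _ * X + _]mxE [X in _ = _ + X]mxE mxE [X in X + _]mxE.
apply: etrans (monalgUD _ _ _) _; apply: f_equal2 => //.
by apply: etrans _ (esym (ga_mul_const _ _)); rewrite mulrC.
Qed.

HB.instance Definition _ := GRing.isLinear.Build k 'rV[k]_m W _ cstw cstw_linear.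

Lemma cst_delta l : cst (d := d) (delta_mx 0 l : 'rV[k]_m) = delta_mx 0 l.
Proof.
apply/rowP => j; rewrite mxE [RHS]mxE mxE eqxx /=.
by case: (j == l) => //; rewrite monalgU0.
Qed.

Lemma sys_p_cst u : sys_p (cstw u) = p0 u.
Proof.
rewrite [in RHS](row_sum_delta u) linear_sum; apply: eq_bigr => l _.
apply: etrans _ (esym (linearZ_LR p0 _ _)).
exact: (congr1 (fun a : R => a *: (p0 (delta_mx 0 l) : M)) (mxE _ _ _ _)).
Qed.

Lemma rel_mx_row a : row a (rel_mx D g) =
  act (tag (enum_val a), true) (cstw (rel_row (enum_val a))) -
  cstw (rel_row (enum_val a) *m g (tag (enum_val a))) :> W.
Proof.
apply/rowP => l; rewrite mxE [LHS]mxE [RHS]mxE; apply: f_equal2.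
  apply: etrans _ (esym (mxE _ _ _ _)).
  apply: etrans _ (esym (congr1 (fun z : A => ga_mul z << lgen (tag (enum_val a), true) >>) (mxE _ _ _ _))).
  by rewrite ga_mulUU mul1g mulr1.
apply: etrans _ (esym (mxE _ _ _ _)); congr (- _).
exact: (esym (mxE _ _ _ _)).
Qed.

Lemma sys_p_act c (w : W) : sys_p (act c w) = act c (sys_p w : mod_space M).
Proof. exact: (row_combZ (fun l => p0 (delta_mx 0 l) : M) (<< lgen c >> : R) w). Qed.

Lemma rel_row_sub (t : {i : 'I_d & 'I_(\rank (D i))}) : (rel_row t <= D (tag t))%MS.
Proof. by apply: submx_trans (row_sub _ _) _; rewrite eq_row_base. Qed.

Lemma sys_p_rel x : sys_p (x *m rel_mx D g) = 0.
Proof.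
apply: row_comb_mul => a; apply: etrans (congr1 sys_p (rel_mx_row a)) _.
apply: etrans (row_combB _ _ _) _.
have e1 := sys_p_act (tag (enum_val a), true) (cstw (rel_row (enum_val a))).
have e2 : act (tag (enum_val a), true) (sys_p (cstw (rel_row (enum_val a))) : mod_space M) =
    act (tag (enum_val a), true) (p0 (rel_row (enum_val a))).
  exact: (congr1 (fs_act (mod_space M) (tag (enum_val a), true)) (sys_p_cst (rel_row (enum_val a)))).
have e3 := p0_rel (rel_row_sub (enum_val a)).
have e4 := sys_p_cst (rel_row (enum_val a) *m g (tag (enum_val a))).
apply: etrans (f_equal2 (fun u v : M => u - v) (etrans e1 (etrans e2 e3)) e4) _.
exact: subrr.
Qed.

Definition sys_im : set (mod_space M) := fun z => exists y, sys_p y = z.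

Lemma sys_im_stable : stable sys_im.
Proof.
have lin a y z : sys_p (a *: y + z) = a *: sys_p y + sys_p z by exact: row_comb_linear.
split; first split.
- by exists 0; apply: row_comb0.
- move=> e z1 z2 [y <-] [z <-]; exists ((<< e *g 1%g >> : R) *: y + z).
  exact: lin.
- move=> c z1 [y <-]; exists ((<< lgen c >> : R) *: y).
  exact: (row_combZ (fun l => p0 (delta_mx 0 l) : M)).
Qed.

Lemma sys_p_surj x : exists y, sys_p y = x.
Proof.
have : cl (range p0) (x : mod_space M) by rewrite p0_gen.
apply: (cl_min (Z := range p0) sys_im_stable).
by move=> z [u _ <-]; exists (cstw u); exact: (sys_p_cst u).
Qed.

(** The universal property is applied to the cokernel of [rel_mx]: classes of constant rows satisfy
    the relations there, so [M] maps back to the cokernel, compatibly with the quotient map. *)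
Lemma sys_p_ker y : sys_p y = 0 <-> exists x : 'rV_s, x *m rel_mx D g = y.
Proof.
split; last by move=> [x <-]; apply: sys_p_rel.
move=> py0.
have [Q QE] : exists Q : submodClosed 'rV[R]_m, forall y, (y \in Q) <-> exists x : 'rV_s, x *m rel_mx D g = y.
  apply: (submod_of_set (Z := [set y | exists x : 'rV_s, x *m rel_mx D g = y])).
    by exists 0; apply: mul0mx.
  by move=> a _ _ [x <-] [x' <-]; exists (a *: x + x'); rewrite mulmxDl scalemxAl.
pose X := mod_space (quotmod Q).
pose phi (u : 'rV[k]_m) : X := quotmod_modpi Q (cstw u).
have phi_lin : linear phi.
  move=> e u v; apply: etrans (congr1 (quotmod_modpi Q) (cstw_linear e u v)) _.
  exact: (quotmod_modpi_linear Q e (cstw u) (cstw v)).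
pose phiL : {linear 'rV[k]_m -> X} := HB.pack phi (GRing.isLinear.Build _ _ _ _ _ phi_lin).
have relQ i u : (u <= D i)%MS -> (act (i, true) (cstw u) - cstw (u *m g i) : 'rV[R]_m) \in Q.
  move=> uD; have sQ := submod_stable Q.
  pose psi v : W := act (i, true) (cstw v) - cstw (v *m g i).
  pose psiL : {linear 'rV[k]_m -> W} := 
    HB.pack psi (GRing.isLinear.Build _ _ _ _ _ (rel_linear (i, true) (g i) cstw)).
  apply: (subspace_rowspace (psi := psiL) sQ.1 (B := row_base (D i))); last by rewrite eq_row_base.
  move=> j.
  apply/QE; exists (delta_mx 0 (enum_rank (existT (fun i => 'I_(\rank (D i))) i j))).
  by rewrite -rowE rel_mx_row enum_rankK.
have [|H HH HE] := p0_ext (phi := phiL).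
  move=> i u uD; apply: etrans (esym (quotmod_piZ Q (<< lgen (i, true) >> : R) (cst u))) _.
  exact/quotmod_piE/relQ.
have HPL : linear (fun y => (H (sys_p y) : quotmod Q)).
  move=> a y1 y2; apply: etrans (congr1 H (row_comb_linear _ a y1 y2)) _.
  exact: (hom_modLinear HH).
have HP : H (sys_p y) = quotmod_pi Q y.
  have base l : (H (sys_p (delta_mx 0 l)) : quotmod Q) = quotmod_pi Q (delta_mx 0 l); last first.
    exact: (linear_row_ext HPL (@quotmod_pi_linear _ _ Q) base).
  have e1 : sys_p (delta_mx 0 l) = p0 (delta_mx 0 l).
    exact: etrans (congr1 sys_p (esym (cst_delta l))) (sys_p_cst (delta_mx 0 l)).
  apply: etrans (congr1 H e1) (etrans (HE _) _).
  exact: (congr1 (quotmod_pi Q) (cst_delta l)).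
have : quotmod_pi Q y = quotmod_pi Q 0.
  rewrite -HP py0 (linon0 subspaceT HH.1).
  by apply/esym; apply: (addrI (quotmod_pi Q 0)); rewrite -quotmod_piD !addr0.
by move=> /quotmod_piE; rewrite subr0 => /QE.
Qed.

Theorem system_euler_char : has_euler_char M (m%:Z - (\sum_i \rank (D i))%N%:Z).
Proof.
rewrite -card_rel_index; apply: (row_comb_euler sys_p_surj sys_p_ker).
by move=> x; apply: (rel_mx_inj0 g_unit).
Qed.

End SystemEuler.

(** * Euler characteristics of quotients *)

Section QuotientSystem.
Context {k : fieldType} {d : nat} {V : fspace k d} {m : nat}.
Context {iota : {linear 'rV[k]_m -> V}} {D g : @letter d -> 'M[k]_m}.
Hypothesis wc : window_coord iota D g.

Notation im := (@im k d V m iota).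
Notation genD := (@genD k d m D g).

Lemma im1E : im 1%:M = range iota.
Proof.
apply/seteqP; split=> [_ [u _ <-]|_ [u _ <-]]; first by exists u.
by exists u; rewrite ?submx1.
Qed.

Hypothesis wcl : cl (range iota) = setT.
Hypothesis wext : forall X, extends_to X setT (range iota).

Lemma window_extend (X : fspace k d) (phi : {linear 'rV[k]_m -> X}) :
  (forall i u, (u <= D (i, true))%MS ->
    act (i, true) (phi u) = phi (u *m g (i, true))) ->
  exists2 H : V -> X, hom setT H & forall u, H (iota u) = phi u.
Proof.
move=> rel; have hh : hom (im 1%:M) (phi \o (@inv k d V m iota)).
  apply: (coord_hom wc) => [a u v _ _|c u]; first by rewrite linearP.
  rewrite (sub_dom wc) => /and3P[_ uD _].
  case: c uD => i [] uD; first by rewrite rel.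
  have := rel i _ (window_D_linv wc uD); rewrite (mul_gK wc (i, false)) => <-.
  by rewrite (@actK _ _ X (i, true)).
rewrite im1E in hh; have [H HH HE] := wext hh.
by exists H => // u; rewrite HE /= ?(invK wc) //; exists u.
Qed.

Variables (V' : fspace k d) (pi : {linear V -> V'}) (N : set V) (K : 'M[k]_m).
Hypothesis pi_act : forall c x, pi (act c x) = act c (pi x).
Hypothesis pi_surj : forall y, exists x, pi x = y.
Hypothesis pi_ker : forall x, pi x = 0 <-> N x.
Hypothesis sN : stable N.
Hypothesis NK : forall u, (u <= K)%MS <-> N (iota u).
Hypothesis clK : cl (im K) = N.

Lemma stable_actV c x : N (act c x) <-> N x.
Proof.
by split=> [/(sN.2 (linv c))|/(sN.2 c)//]; rewrite actK.
Qed.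

(** Since [N] is a submodule, a letter that keeps a vector of [N] in the window keeps it in the
    trace. *)
Lemma genD_stable i : (genD K i :=: D (i, true) :&: K)%MS.
Proof.
apply/eqmxP/andP; split; apply/row_subP => j; set u := row j _.
  have : (u <= genD K i)%MS by apply: row_sub.
  by rewrite (sub_dom wc) sub_capmx => /and3P[-> ->].
have : (u <= D (i, true) :&: K)%MS by apply: row_sub.
rewrite sub_capmx (sub_dom wc) => /andP[uD uK]; rewrite uK uD /=.
by apply/NK; rewrite -(wc_act wc uD); apply/stable_actV/NK.
Qed.

(** The quotient gets the window modulo the trace, and each domain modulo its intersection with the
    trace. That intersection is [genD K i], so the numbers differ by the defect. *)
Theorem quotient_system : exists m' (D' g' : 'I_d -> 'M[k]_m') (p0 : {linear 'rV[k]_m' -> V'}),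
  [/\ forall i, g' i \in unitmx, cl (range p0) = setT,
      forall i u, (u <= D' i)%MS -> act (i, true) (p0 u) = p0 (u *m g' i),
      forall (X : fspace k d) (phi : {linear 'rV[k]_m' -> X}),
        (forall i u, (u <= D' i)%MS -> act (i, true) (phi u) = phi (u *m g' i)) ->
        exists2 H : V' -> X, hom setT H & forall u, H (p0 u) = phi u &
      m'%:Z - (\sum_i \rank (D' i))%N%:Z =
        m%:Z - (\sum_i \rank (D (i, true)))%N%:Z - defect K (genD K)].
Proof.
(* [C] is the quotient map with kernel [K] in coordinates, and [B] is a section of it. *)
have [m' [C [B [CB CK rC]]]] : exists m' (C : 'M[k]_(m, m')) (B : 'M[k]_(m', m)),
    [/\ B *m C = 1%:M, forall u : 'rV_m, (u *m C == 0) = (u <= K)%MS &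
        (m' + \rank K)%N = m].
  exists (\rank (cokermx K)), (col_base (cokermx K)), (pinvmx (col_base (cokermx K))).
  split; first exact: mulVpmx (col_base_full _).
    move=> u; rewrite submxE -[in RHS](mulmx_base (cokermx K)) [in RHS]mulmxA.
    by apply/esym/mulmx_free_eq0/row_base_free.
  by rewrite mxrank_coker subnK // rank_leq_col.
(* A vector of [D i] lies in [N] exactly when its image under the letter does, so the letter acts
   injectively on the image of [D i] in the quotient. *)
have kerE i : forall a : 'rV_m, (a *m (D (i, true) *m C) == 0) =
    (a *m (D (i, true) *m g (i, true) *m C) == 0).
  move=> a; rewrite !mulmxA !CK.
  have aD : (a *m D (i, true) <= D (i, true))%MS by apply: submxMl.
  by apply/idP/idP => /NK; rewrite -?(wc_act wc aD) ?stable_actV => h; apply/NK;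
    rewrite -?(wc_act wc aD) ?stable_actV.
have /choice[g' hg'] : forall i, exists g' : 'M_m', g' \in unitmx /\
    D (i, true) *m C *m g' = D (i, true) *m g (i, true) *m C.
  by move=> i; have [g' ? ?] := same_kernel_unitmx (kerE i); exists g'.
pose p0 (w : 'rV[k]_m') := pi (iota (w *m B)).
have p0_lin : linear p0 by move=> a u v; rewrite /p0 mulmxDl -scalemxAl !linearP.
pose p0L : {linear 'rV[k]_m' -> V'} := HB.pack p0 (GRing.isLinear.Build _ _ _ _ _ p0_lin).
have eqC u v : u *m C = v *m C -> pi (iota u) = pi (iota v).
  move=> e; apply/eqP; rewrite -subr_eq0 -!linearB; apply/eqP/pi_ker/NK.
  by rewrite -CK mulmxBl e subrr.
have p0E u : p0 (u *m C) = pi (iota u) by apply: eqC; rewrite -!mulmxA CB mulmx1.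
exists m', (fun i => <<D (i, true) *m C>>%MS), g', p0L; split.
- by move=> i; case: (hg' i).
- apply/seteqP; split=> // y _; have [x <-] := pi_surj y.
  have sS : stable [set x | cl (range p0) (pi x)].
    split; first split=> /=; first by rewrite linear0; apply: subspace0 (stable_cl _).1.
      by move=> a u v hu hv; rewrite linearP; apply: (stable_cl _).1.2.
    by move=> c u hu; rewrite /= pi_act; apply: (stable_cl _).2.
  have : cl (range iota) x by rewrite wcl.
  apply: (cl_min sS) => _ [u _ <-] /=; rewrite -p0E.
  by apply: cl_sub; exists (u *m C).
- move=> i w; rewrite genmxE => /submxP[a ->].
  have aD : (a *m D (i, true) <= D (i, true))%MS by apply: submxMl.
  rewrite mulmxA -[p0L _]/(p0 _) p0E -pi_act (wc_act wc aD) -p0E -[p0L _]/(p0 _).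
  by congr p0; rewrite -!mulmxA; congr (a *m _); rewrite !mulmxA; case: (hg' i).
- move=> X phi rel; pose psi (u : 'rV[k]_m) := phi (u *m C).
  have psi_lin : linear psi by move=> a u v; rewrite /psi mulmxDl -scalemxAl !linearP.
  pose psiL : {linear 'rV[k]_m -> X} := HB.pack psi (GRing.isLinear.Build _ _ _ _ _ psi_lin).
  have [|H HH HE] := @window_extend X psiL.
    move=> i u /submxP[a ->]; rewrite -[psiL _]/(psi _) -[psiL _]/(psi _) /psi rel.
      congr (phi _); rewrite -!mulmxA; congr (a *m _); rewrite !mulmxA.
      by case: (hg' i).
    by rewrite genmxE -mulmxA submxMl.
  have H0 x : N x -> H x = 0.
    rewrite -clK; have sS : stable [set x | H x = 0].
      split; first split=> /=; first exact: linon0 (@subspaceT _ _ V) HH.1.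
        by move=> a u v hu hv; rewrite /= HH.1 // hu hv scaler0 addr0.
      by move=> c u hu; rewrite /= HH.2 // hu linear0.
    apply: (cl_min sS) => _ [u uK <-] /=; rewrite HE -[psiL _]/(psi _) /psi.
    by move: uK; rewrite -CK => /eqP ->; rewrite linear0.
  have /choice[s sE] := pi_surj.
  have Hpi x : H (s (pi x)) = H x.
    have : N (s (pi x) - x) by apply/pi_ker; rewrite linearB sE subrr.
    move=> /H0; rewrite -[_ - _]addrC -scaleN1r HH.1 // => e.
    by apply/eqP; rewrite -subr_eq0 -e scaleN1r addrC.
  exists (fun y => H (s y)); last first.
    by move=> w; rewrite Hpi HE -[psiL _]/(psi _) /psi -mulmxA CB mulmx1.
  split=> [a y z _ _|c y _ _].
    have [x <-] := pi_surj y; have [x' <-] := pi_surj z.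
    by rewrite -linearP !Hpi HH.1.
  by have [x <-] := pi_surj y; rewrite -pi_act !Hpi HH.2.
have rD i : (\rank <<D (i, true) *m C>>%MS + \rank (genD K i))%N = \rank (D (i, true)).
  rewrite genmxE genD_stable -[RHS](mxrank_mul_ker _ C).
  have cK : (K :=: kermx C)%MS.
    apply/eqmxP/andP; split; apply/row_subP => j.
      by apply/sub_kermxP/eqP; rewrite CK row_sub.
    by rewrite -CK; apply/eqP/sub_kermxP/row_sub.
  by rewrite (cap_eqmx (eqmx_refl (D (i, true))) cK).
have : (\sum_i \rank <<D (i, true) *m C>>%MS + \sum_i \rank (genD K i))%N =
    (\sum_i \rank (D (i, true)))%N.
  by rewrite -big_split; apply: eq_bigr.
rewrite /defect /=; move: rC; move: (\sum_i \rank <<_>>)%N (\sum_i \rank (genD K i))%N (\sum_i \rank (D _))%N.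
move=> s1 s2 s3; lia.
Qed.

End QuotientSystem.

Section EulerCharacteristic.
Context {k : fieldType} {d m : nat}.
Local Notation R := ((group_alg k (free_group d))^c).
Context {L : lmodType R} {iota : {linear 'rV[k]_m -> mod_space L}}.
Context {D g : @letter d -> 'M[k]_m}.
Hypothesis wc : window_coord iota D g.
Hypothesis wcl : cl (range iota) = setT.
Hypothesis wext : forall X, extends_to X setT (range iota).

Notation im := (@im k d (mod_space L) m iota).
Notation genD := (@genD k d m D g).

Definition window_chi : int := m%:Z - (\sum_i \rank (D (i, true)))%N%:Z.

Theorem window_euler_char : has_euler_char L window_chi.
Proof.
apply: (@system_euler_char k d m (fun i => D (i, true)) (fun i => g (i, true)) _ L iota wcl).
- by move=> i; apply: window_g_unit wc _.
- by move=> i u uD; apply: (wc_act wc).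
- by move=> X phi; apply: (window_extend wc wext).
Qed.

Theorem quotient_euler_char (N : submodClosed L) (K : 'M[k]_m) :
  (forall u, (u <= K)%MS <-> carrier N (iota u)) -> cl (im K) = carrier N ->
  has_euler_char (quotmod N) (window_chi - defect K (genD K)).
Proof.
move=> NK clK.
have surj (y : mod_space (quotmod N)) : exists x, quotmod_modpi N x = y.
  by exists (repr (y : quotmod N)); apply: quotmod_repr.
have ker (x : mod_space L) : quotmod_modpi N x = 0 <-> carrier N x.
  have <- : quotmod_modpi N 0 = 0 by apply: linear0.
  split=> [/(quotmod_piE N x 0)|h]; first by rewrite subr0.
  by apply/(quotmod_piE N x 0); rewrite subr0.
have [m' [D' [g' [p0 [gu pg prel pext e]]]]] :=
  quotient_system (V' := mod_space (quotmod N)) (pi := quotmod_modpi N) wc wcl wext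
    (@quotmod_modpi_act _ _ _ N) surj ker (submod_stable N) NK clK.
have := system_euler_char gu pg prel pext; rewrite e; exact.
Qed.

End EulerCharacteristic.

(** * Counting homomorphisms out of a window *)

Lemma linear_scale (R : nzRingType) (M M' : lmodType R) (f : M -> M') :
  linear f -> forall a x, f (a *: x) = a *: f x.
Proof.
move=> fl a x; pose fL : {linear M -> M'} := HB.pack f (GRing.isLinear.Build _ _ _ _ _ fl).
exact: (linearZ_LR fL).
Qed.

Lemma modLinear_hom (k : fieldType) (d : nat)
    (M M' : lmodType (group_alg k (free_group d))^c) (H : M -> M') :
  linear H -> hom setT (H : mod_space M -> mod_space M').
Proof.
move=> Hl; split=> [a x y _ _|c x _ _]; first exact: (Hl (<< a *g 1%g >> : _^c) x y).
exact: (linear_scale Hl (<< lgen c >> : _^c) x).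
Qed.

Section HomCount.
Context {k : finFieldType} {d m : nat}.
Local Notation F := (free_group d).
Local Notation R := ((group_alg k F)^c).
Context {L : lmodType R} {iota : {linear 'rV[k]_m -> mod_space L}}.
Context {D g : @letter d -> 'M[k]_m}.
Hypothesis wc : window_coord iota D g.
Hypothesis wcl : cl (range iota) = setT.
Hypothesis wext : forall X, extends_to X setT (range iota).
Variables (n' : nat) (phi : {multiplicative F -> {'GL_n'.+1[k]}}).
Local Notation n := n'.+1.
Local Notation homs := (@window_homs k d m (fun i => D (i, true)) (fun i => g (i, true)) n'
  [ffun i => phi (fgen i)]).

Local Notation X := (mod_space (gl_module phi)).

Lemma gl_module_act i (v : X) : act (i, true) v = v *m GLval (phi (fgen i)).
Proof. by apply: etrans (gl_scaleU phi 1 (fgen i) v) (scale1r _). Qed.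

Definition gl_map (w : 'M[k]_(m, n)) : 'rV[k]_m -> X := fun u => u *m w.

Lemma gl_map_linear w : linear (gl_map w).
Proof.
move=> e u v; rewrite /gl_map mulmxDl -scalemxAl; congr (_ + _).
by rewrite [RHS](gl_scaleU phi e 1%g) gl_phi1 mulmx1.
Qed.

HB.instance Definition _ w := GRing.isLinear.Build k 'rV[k]_m X _ (gl_map w) (gl_map_linear w).

Lemma homsE w : w \in homs <->
  forall i u, (u <= D (i, true))%MS -> act (i, true) (gl_map w u) = gl_map w (u *m g (i, true)).
Proof.
rewrite inE; split=> [/forallP h i _ /submxP[a ->]|h].
  rewrite gl_module_act /gl_map -!mulmxA; congr (a *m _); rewrite !mulmxA.
  by have /eqP := h i; rewrite ffunE.
apply/forallP => i; apply/eqP/row_matrixP => j; rewrite ffunE !row_mul.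
have := h i (row j (D (i, true))) (row_sub _ _); rewrite gl_module_act /gl_map.
by [].
Qed.

(** A homomorphism is determined by its matrix on the generating window, and every solution of the
    window equations extends. *)
Lemma card_Hom_window : card_Hom L (gl_module phi) = #|homs|.
Proof.
have /choice[H HP] : forall w, exists H : L -> gl_module phi, w \in homs ->
    linear H /\ forall u, H (iota u) = gl_map w u.
  move=> w; case: (boolP (w \in homs)) => [/homsE hw|_]; last by exists (fun=> 0).
  have [H HH HE] := window_extend wc wext hw.
  by exists H => _; split=> //; apply: hom_modLinear HH.
have uniq (f f' : L -> gl_module phi) : linear f -> linear f' ->
    (forall u, f (iota u) = f' (iota u)) -> f = f'.
  move=> /modLinear_hom hf /modLinear_hom hf' e; apply/funext => x.
  have sub : range iota `<=` setT by [].
  apply: (hom_ext (@stableT _ _ (mod_space L)) sub hf hf'); last by rewrite wcl.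
  by move=> _ [u _ <-]; apply: e.
rewrite /card_Hom.
have -> : [set f : L -> gl_module phi | linear f] = H @` [set w | w \in homs].
  apply/seteqP; split=> [f fl|_ [w wh <-]]; last by case: (HP w wh).
  have hf := modLinear_hom fl.
  pose f0 (u : 'rV[k]_m) : X := f (iota u).
  have f0l : linear f0.
    by move=> a u v; rewrite /f0 linearP; apply: (hf.1 a (iota u) (iota v)).
  pose w : 'M[k]_(m, n) := \matrix_i f0 (delta_mx 0 i).
  have f0E u : f0 u = gl_map w u.
    apply: (linear_row_ext f0l (gl_map_linear w)) => i.
    by rewrite /gl_map -rowE rowK.
  have wh : w \in homs.
    apply/homsE => i u uD; rewrite -!f0E /f0 -(wc_act wc uD).
    by apply/esym/hf.2.
  exists w => //; have [Hl HE] := HP w wh; apply: uniq => // u.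
  by rewrite HE -f0E.
rewrite fset_set_image //.
have fE (T : finType) (W : {set T}) : fset_set [set x | x \in W] = [fset x in W]%fset.
  by apply/fsetP => x; rewrite in_fset_set // mem_setE !inE.
rewrite card_in_imfset /=; first by rewrite fE -[LHS]/(#|` [fset x in homs]%fset|) card_finset.
move=> w w'; rewrite !in_fset_set // !mem_setE => wh wh' e; apply/row_matrixP => i.
have [_ HE] := HP w wh; have [_ HE'] := HP w' wh'.
by rewrite !rowE -[LHS]/(gl_map w _) -HE e HE'.
Qed.

End HomCount.

Section LambdaCount.
Context {k : finFieldType} {d m : nat}.
Local Notation F := (free_group d).
Local Notation R := ((group_alg k F)^c).
Context {L : lmodType R} {iota : {linear 'rV[k]_m -> mod_space L}}.
Context {D g : @letter d -> 'M[k]_m}.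
Hypothesis wc : window_coord iota D g.
Hypothesis wcl : cl (range iota) = setT.
Hypothesis wext : forall X, extends_to X setT (range iota).
Variable n' : nat.
Local Notation n := n'.+1.

Definition fg_hom (gam : {ffun 'I_d -> {'GL_n[k]}}) : {multiplicative F -> {'GL_n[k]}} :=
  
  HB.pack (fg_lift gam) (monoid.isMultiplicative.Build _ _ _ (@fg_liftM d _ gam)).

Lemma fg_hom_bij : bijective fg_hom.
Proof.
exists (fun phi : {multiplicative F -> {'GL_n[k]}} => [ffun i => phi (fgen i)]) => [gam|phi].
  by apply/ffunP => i; rewrite ffunE; apply: fg_lift_gen.
apply: ghom_ext => u; apply/esym/fg_lift_unique => [x y|i]; first exact: gmulfM.
by rewrite ffunE.
Qed.

Lemma Lambda_window : Lambda L n =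
  (\sum_gam (#|@window_homs k d m (fun i => D (i, true)) (fun i => g (i, true)) n' gam|)%:R)
    / #|'GL_n[k]%g|%:R ^+ d :> rat.
Proof.
rewrite /Lambda; congr (_ / _).
rewrite (reindex_fsbigT fg_hom); last exact: fg_hom_bij.
rewrite [RHS](fsbig_seq _ _ (index_enum_uniq _)).
have <- : [set: {ffun 'I_d -> {'GL_n[k]}}] = [set` index_enum {ffun 'I_d -> {'GL_n[k]}}].
  by apply/seteqP; split=> // gam _; rewrite /= mem_index_enum.
apply: eq_fsbigr => gam _; rewrite (card_Hom_window wc wcl wext).
congr (_%:R); congr #|pred_of_set (window_homs _ _ _)|.
by apply/ffunP => i; rewrite ffunE; apply: fg_lift_gen.
Qed.

End LambdaCount.

(** * Asymptotics and rational functions of q^n *)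

Section Asymptotics.
Variable q : rat.
Hypothesis q_ge2 : 2 <= q.
Implicit Types (f h : nat -> rat) (e : int).

Lemma q_gt0 : 0 < q. Proof. exact: lt_le_trans q_ge2. Qed.
Let q_neq0 : q != 0. Proof. exact: lt0r_neq0 q_gt0. Qed.
Let qn_gt0 n : 0 < q ^+ n. Proof. exact: exprn_gt0 q_gt0. Qed.
Let q_ge1 : 1 <= q. Proof. exact: le_trans q_ge2. Qed.

Definition Oq h := exists (C : rat) (n0 : nat), forall n, (n0 <= n)%N -> `|h n| <= C * q ^- n.

Lemma Oq_ex0 h : Oq h ->
  exists2 C : rat, 0 <= C & exists n0, forall n, (n0 <= n)%N -> `|h n| <= C * q ^- n.
Proof.
move=> [C [n0 hC]]; exists C; last by exists n0.
have := le_trans (normr_ge0 _) (hC n0 (leqnn _)).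
by rewrite pmulr_lge0 // invr_gt0.
Qed.

Lemma Oq_eq h h' n0 : (forall n, (n0 <= n)%N -> h n = h' n) -> Oq h -> Oq h'.
Proof.
move=> e [C [n1 hC]]; exists C, (maxn n0 n1) => n; rewrite geq_max => /andP[le0 le1].
by rewrite -e // hC.
Qed.

Lemma Oq0 : Oq (fun=> 0).
Proof. by exists 0, 0%N => n _; rewrite normr0 mul0r. Qed.

Lemma OqD h h' : Oq h -> Oq h' -> Oq (fun n => h n + h' n).
Proof.
move=> [C [n0 hC]] [C' [n1 hC']]; exists (C + C'), (maxn n0 n1) => n.
rewrite geq_max => /andP[le0 le1]; apply: le_trans (ler_normD _ _) _.
by rewrite mulrDl lerD ?hC ?hC'.
Qed.

Lemma OqM h h' : Oq h -> Oq h' -> Oq (fun n => h n * h' n).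
Proof.
move=> /Oq_ex0[C C0 [n0 hC]] /Oq_ex0[C' C'0 [n1 hC']].
exists (C * C'), (maxn n0 n1) => n; rewrite geq_max => /andP[le0 le1].
rewrite normrM; apply: le_trans (ler_pM (normr_ge0 _) (normr_ge0 _) (hC n le0) (hC' n le1)) _.
rewrite mulrACA ler_wpM2l ?mulr_ge0 // ger_pMr ?invr_gt0 // invf_le1 //.
exact: exprn_ege1.
Qed.

Lemma Oq_sum (I : Type) (s : seq I) (P : pred I) (h : I -> nat -> rat) :
  (forall i, P i -> Oq (h i)) -> Oq (fun n => \sum_(i <- s | P i) h i n).
Proof.
move=> hO; elim: s => [|i s IH].
  by apply: (@Oq_eq (fun=> 0) _ 0%N) Oq0 => n _; rewrite big_nil.
have [Pi|nPi] := boolP (P i).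
  by apply: (@Oq_eq _ _ 0%N) (OqD (hO i Pi) IH) => n _; rewrite big_cons Pi.
by apply: (@Oq_eq _ _ 0%N) IH => n _; rewrite big_cons (negbTE nPi).
Qed.

Definition asym f e := Oq (fun n => f n / q ^ (e * n%:Z) - 1).

Let qz_neq0 (a : int) : q ^ a != 0. Proof. exact: expfz_neq0. Qed.

Lemma asym_one : asym (fun=> 1) 0.
Proof. by apply: (@Oq_eq _ _ 0%N) Oq0 => n _; rewrite mul0r expr0z divr1 subrr. Qed.

(** From a b - 1 = (a - 1)(b - 1) + (a - 1) + (b - 1) for the normalised factors. *)
Lemma asymM f f' e e' : asym f e -> asym f' e' -> asym (fun n => f n * f' n) (e + e').
Proof.
move=> hf hf'; apply: (@Oq_eq _ _ 0%N) (OqD (OqM hf hf') (OqD hf hf')) => n _.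
rewrite (mulrDl e) (expfzDr _ _ q_neq0) invfM mulrACA; set a := f n / _; set b := f' n / _.
rewrite -[in RHS](subrK 1 a) -[in RHS](subrK 1 b).
move: (a - 1) (b - 1) => x y.
by rewrite mulrDl mulrDr mulr1 mul1r !addrA addrK.
Qed.

Lemma asym_prod (I : Type) (s : seq I) (f : I -> nat -> rat) (e : I -> int) :
  (forall i, asym (f i) (e i)) ->
  asym (fun n => \prod_(i <- s) f i n) (\sum_(i <- s) e i).
Proof.
move=> hf; elim: s => [|i s IH].
  by rewrite big_nil; apply: (@Oq_eq _ _ 0%N) asym_one => n _; rewrite big_nil.
by rewrite big_cons; apply: (@Oq_eq _ _ 0%N) (asymM (hf i) IH) => n _; rewrite big_cons.
Qed.

Lemma asym_factor j : asym (fun n => q ^+ n - q ^+ j) 1.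
Proof.
exists (q ^+ j), 0%N => n _; rewrite mul1r -exprnP mulrBl divff ?gt_eqF //.
by rewrite addrC addKr normrN normrM normfV !gtr0_norm.
Qed.

Lemma factor_gt0 j n : (j < n)%N -> 0 < q ^+ n - q ^+ j.
Proof. by move=> lt; rewrite subr_gt0 ltr_eXn2l // (lt_le_trans _ q_ge2). Qed.

(** The constant 2 q^j comes from q^n - q^j >= q^n / 2, valid for n > j because q >= 2. *)
Lemma asym_factorV j : asym (fun n => (q ^+ n - q ^+ j)^-1) (-1).
Proof.
exists (2 * q ^+ j), j.+1 => n lt; have p0 := factor_gt0 lt.
have -> : (q ^+ n - q ^+ j)^-1 / q ^ (-1 * n%:Z) - 1 = q ^+ j / (q ^+ n - q ^+ j).
  rewrite mulN1r -exprnN invrK mulrC -[X in _ - X](mulfV (lt0r_neq0 p0)) -mulrBl.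
  by rewrite opprB addrC subrK.
rewrite normrM normfV !gtr0_norm // [2 * _]mulrC -mulrA ler_wpM2l ?(ltW (qn_gt0 j)) //.
rewrite -[2]invrK -invfM lef_pV2 ?posrE ?mulr_gt0 ?invr_gt0 //.
rewrite ler_pdivrMl // mulrBr lerBrDr [leRHS](mulr_natl _ 2) mulr2n lerD2l.
apply: le_trans (_ : q ^+ j.+1 <= _); last by rewrite ler_weXn2l.
by rewrite exprS ler_wpM2r // ltW.
Qed.

(** The exponents are integers, so a gap costs at least one factor q^(-n). *)
Lemma asym_small f e E : asym f e -> (e < E)%R -> Oq (fun n => f n / q ^ (E * n%:Z)).
Proof.
move=> hf lt; have hs : Oq (fun n => q ^ ((e - E) * n%:Z)).
  have [r ->] : exists r : nat, e - E = - r.+1%:Z by exists (`|E - e|.-1)%N; lia.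
  exists 1, 0%N => n _; rewrite mulNr -PoszM -exprnN mul1r normfV gtr0_norm //.
  by rewrite lef_pV2 ?posrE // ler_weXn2l // leq_pmull.
apply: (@Oq_eq _ _ 0%N) (OqD (OqM hf hs) hs) => n _.
rewrite mulrBl (mulrBl n%:Z) (expfzDr _ _ q_neq0) mul1r subrK mulrA divfK //.
by rewrite -invr_expz.
Qed.

End Asymptotics.

Section EventuallyRational.
Variable q : rat.
Implicit Types (f h : nat -> rat).

Definition erat f := exists (P Q : {poly rat}) (n0 : nat), forall n, (n0 <= n)%N ->
  Q.[q ^+ n] != 0 /\ f n = P.[q ^+ n] / Q.[q ^+ n].

Lemma erat_eq f h n0 : (forall n, (n0 <= n)%N -> f n = h n) -> erat f -> erat h.
Proof.
move=> e [P [Q [n1 hf]]]; exists P, Q, (maxn n0 n1) => n.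
by rewrite geq_max => /andP[le0 le1]; rewrite -e //; apply: hf.
Qed.

Lemma erat_poly (P : {poly rat}) : erat (fun n => P.[q ^+ n]).
Proof. by exists P, 1, 0%N => n _; rewrite hornerC divr1 oner_eq0. Qed.

Lemma eratD f h : erat f -> erat h -> erat (fun n => f n + h n).
Proof.
move=> [P [Q [n0 hf]]] [P' [Q' [n1 hh]]]; exists (P * Q' + P' * Q), (Q * Q'), (maxn n0 n1).
move=> n; rewrite geq_max => /andP[/hf[Q0 ->] /hh[Q'0 ->]]; rewrite !hornerE.
by rewrite mulf_neq0 // addf_div.
Qed.

Lemma eratM f h : erat f -> erat h -> erat (fun n => f n * h n).
Proof.
move=> [P [Q [n0 hf]]] [P' [Q' [n1 hh]]]; exists (P * P'), (Q * Q'), (maxn n0 n1).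
move=> n; rewrite geq_max => /andP[/hf[Q0 ->] /hh[Q'0 ->]]; rewrite !hornerM.
by rewrite mulf_neq0 // mulf_div.
Qed.

Lemma eratV f n0 : (forall n, (n0 <= n)%N -> f n != 0) -> erat f -> erat (fun n => (f n)^-1).
Proof.
move=> f0 [P [Q [n1 hf]]]; exists Q, P, (maxn n0 n1) => n.
rewrite geq_max => /andP[/f0 fn0 /hf[Q0 fE]].
by move: fn0; rewrite fE mulf_eq0 negb_or invf_div => /andP[].
Qed.

Lemma erat_sum (I : Type) (s : seq I) (P : pred I) (f : I -> nat -> rat) :
  (forall i, erat (f i)) -> erat (fun n => \sum_(i <- s | P i) f i n).
Proof.
move=> hf; elim: s => [|i s IH].
  by apply: (@erat_eq _ _ 0%N) (erat_poly 0) => n _; rewrite big_nil horner0.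
have [Pi|nPi] := boolP (P i).
  by apply: (@erat_eq _ _ 0%N) (eratD (hf i) IH) => n _; rewrite big_cons Pi.
by apply: (@erat_eq _ _ 0%N) IH => n _; rewrite big_cons (negbTE nPi).
Qed.

Lemma erat_prod (I : Type) (s : seq I) (f : I -> nat -> rat) :
  (forall i, erat (f i)) -> erat (fun n => \prod_(i <- s) f i n).
Proof.
move=> hf; elim: s => [|i s IH].
  by apply: (@erat_eq _ _ 0%N) (erat_poly 1) => n _; rewrite big_nil hornerC.
by apply: (@erat_eq _ _ 0%N) (eratM (hf i) IH) => n _; rewrite big_cons.
Qed.

End EventuallyRational.

Section Frames.
Variable k : finFieldType.
Local Notation q := (#|k|%:R : rat).

Lemma card_field_ge2 : 2 <= q.
Proof. by rewrite ler_nat card_field_gt1. Qed.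

(** [frames] is built with truncated subtraction; the bound on [r] keeps every factor
    untruncated. *)
Lemma framesE n r : (r <= n)%N -> (frames k n r)%:R = \prod_(j < r) (q ^+ n - q ^+ j).
Proof.
move=> le; rewrite natr_prod; apply: eq_bigr => j _.
by rewrite natrB ?natrX // leq_exp2l ?card_field_gt1 // (leq_trans (ltnW (ltn_ord j))).
Qed.

Lemma frames_asym r : asym q (fun n => (frames k n r)%:R) r%:Z.
Proof.
have := asym_prod card_field_ge2 (index_enum 'I_r) (fun j : 'I_r => @asym_factor q card_field_ge2 j).
rewrite big_const_ord iter_addr addr0 natz.
by apply: (@Oq_eq _ _ _ r) => n le; rewrite framesE.
Qed.

Lemma framesV_asym r : asym q (fun n => (frames k n r)%:R^-1) (- r%:Z).
Proof.
have := asym_prod card_field_ge2 (index_enum 'I_r) (fun j : 'I_r => @asym_factorV q card_field_ge2 j).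
rewrite big_const_ord iter_addr addr0 mulNrn natz.
by apply: (@Oq_eq _ _ _ r) => n le; rewrite framesE // -prodfV.
Qed.

Lemma frames_erat r : erat q (fun n => (frames k n r)%:R).
Proof.
apply: (@erat_eq _ (fun n => (\prod_(j < r) ('X - (q ^+ j)%:P)).[q ^+ n]) _ r) (erat_poly _ _) => n le.
by rewrite framesE // horner_prod; apply: eq_bigr => j _; rewrite !hornerE.
Qed.

Lemma framesV_erat r : erat q (fun n => (frames k n r)%:R^-1).
Proof.
apply: (@eratV _ _ r) (frames_erat r) => n le; rewrite framesE //.
apply/prodf_neq0 => j _; apply/lt0r_neq0/(factor_gt0 card_field_ge2).
exact: leq_trans (ltn_ord j) le.
Qed.

End Frames.

(** * The expansion of Lambda *)

Lemma sum_fibers (T : finType) (U : choiceType) (P : pred T) (f : T -> U) (A : set U)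
    (F : T -> rat) : finite_set A -> (forall x, P x -> A (f x)) ->
  \sum_(x | P x) F x = \sum_(y \in A) \sum_(x | P x && (f x == y)) F x.
Proof.
move=> finA PA; rewrite fsbig_finite // (exchange_big_dep P) /=; last by move=> y x _ /andP[].
apply: eq_bigr => x Px; rewrite big_mkcond (bigD1_seq (f x)) ?fset_uniq //=; last first.
  by rewrite in_fset_set //; apply/mem_set/PA.
rewrite Px eqxx /= big1 ?addr0 // => y; rewrite eq_sym => /negbTE ->.
by [].
Qed.

Section Expansion.
Context {k : finFieldType} {d m : nat}.
Local Notation R := ((group_alg k (free_group d))^c).
Context {L : lmodType R} {iota : {linear 'rV[k]_m -> mod_space L}}.
Context {D g : @letter d -> 'M[k]_m}.
Hypothesis wc : window_coord iota D g.
Hypothesis wcl : cl (range iota) = setT.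
Hypothesis wext : forall X, extends_to X setT (range iota).
Local Notation q := (#|k|%:R : rat).
Local Notation p := (pair_dim d m).
Local Notation good := (@good k d m (fun i => D (i, true)) (fun i => g (i, true)) p).
Local Notation sel := (@sel k d m).
Local Notation im := (@im k d (mod_space L) m iota).
Local Notation genD := (@genD k d m D g).
Local Notation good_module := (@good_module k d (mod_space L) m iota g).
Local Notation chi := (@window_chi k d m D).
Implicit Types (S : 'M[k]_p) (N : submodClosed L).

Let wV : fwin setT (im 1%:M).
Proof. by split=> [|//|n rho rhoK]; [exact: stableT|rewrite im1E]. Qed.

Let clV : cl (im 1%:M) = setT.
Proof. by rewrite im1E. Qed.

Let q_neq0 : q != 0.
Proof. exact: lt0r_neq0 (q_gt0 (card_field_ge2 k)). Qed.

Definition term S n : rat :=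
  (frames k n (\rank S))%:R * \prod_i (frames k n (\rank (S *m sel true i)))%:R^-1.

Lemma term0 n : term 0 n = 1.
Proof.
rewrite /term mxrank0 {1}/frames big_ord0 mul1r big1 // => i _.
by rewrite mul0mx mxrank0 /frames big_ord0 invr1.
Qed.

Lemma term_asym S : asym q (term S) (excess S).
Proof.
have -> : excess S = (\rank S)%:Z + \sum_i (- (\rank (S *m sel true i))%:Z).
  rewrite /excess sumrN; congr (_ - _).
  by rewrite (big_morph Posz PoszD (erefl _)); apply: eq_bigr => i _; rewrite genmxE.
apply: (asymM (card_field_ge2 k)); first exact: frames_asym.
by apply: asym_prod => [|i]; [exact: card_field_ge2 | exact: framesV_asym].
Qed.

Lemma term_erat S : erat q (term S).
Proof.
apply: eratM; first exact: frames_erat.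
by apply: erat_prod => i; apply: framesV_erat.
Qed.

Lemma Lambda_expansion n : (0 < n)%N ->
  Lambda L n = q ^ (chi * n%:Z) * \sum_(S | (<<S>>%MS == S) && good S) term S n.
Proof.
(* For [n = 0] the module attached to [phi] would have dimension 1, hence the restriction to
   positive [n]. *)
case: n => // n' _; rewrite (Lambda_window wc wcl wext) total_count; congr (_ * _).
rewrite /window_chi mulrBl expfzDr // -!PoszM -exprnP -exprnN.
by rewrite [(n'.+1 * _)%N]mulnC.
Qed.

Lemma Lambda_erat : erat q (Lambda L).
Proof.
apply: (@erat_eq _ (fun n => ('X^m).[q ^+ n] * (('X^(\sum_i \rank (D (i, true)))).[q ^+ n])^-1 *
  \sum_(S | (<<S>>%MS == S) && good S) term S n) _ 1) => [n n0|].
  rewrite Lambda_expansion // !hornerXn /window_chi mulrBl expfzDr // -!PoszM -exprnP -exprnN.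
  by rewrite -!exprM ![(n * _)%N]mulnC.
apply: eratM; last by apply: erat_sum => S; apply: term_erat.
apply: eratM; first exact: erat_poly.
apply: (@eratV _ _ 0%N) (erat_poly _ _) => n _.
by rewrite hornerXn !expf_neq0.
Qed.

Lemma modof_exists : exists f : 'M[k]_p -> submodClosed L,
  forall S, carrier (f S) = good_module S.
Proof.
have /choice[f hf] : forall S, exists N : submodClosed L, forall x, (x \in N) <-> good_module S x.
  by move=> S; apply: stable_submod; apply: stable_cl.
by exists f => S; apply/seteqP; split=> x /hf.
Qed.

Lemma carrier_inj N N' : carrier N = carrier N' -> N = N'.
Proof.
move=> e; apply: submod_ext => x; apply/idP/idP => h.
  by have : carrier N x by []; rewrite e.
by have : carrier N' x by []; rewrite -e.
Qed.

Lemma coords_exists N : exists K : 'M[k]_m, forall u, (u <= K)%MS <-> carrier N (iota u).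
Proof.
have [sN _] := submod_stable N.
apply: (rowspace_of_pred (P := fun u => carrier N (iota u))).
  by rewrite linear0; apply: subspace0 sN.
by move=> a u v hu hv; rewrite linearP; apply: sN.2.
Qed.

Lemma algebraic_quotient N : algebraic N ->
  exists c : int, has_euler_char (quotmod N) (chi - c) /\
  exists S0, [/\ <<S0>>%MS = S0, good S0, good_module S0 = carrier N, excess S0 = - c &
    forall S, <<S>>%MS = S -> good S -> good_module S = carrier N -> S != S0 ->
      (excess S < - c)%R].
Proof.
move=> /algebraic_no_free nfN; have sN := submod_stable N.
have [K NK] := coords_exists N; exists (defect K (genD K)); split.
  exact: (quotient_euler_char wc wcl wext NK (coords_generate wc wV clV sN nfN NK)).
by have [S0 hS0] := good_max wc wV clV sN nfN NK; exists S0.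
Qed.

Lemma good_module_algebraic S N : good S -> S != 0 -> carrier N = good_module S ->
  nonzero_algebraic L N.
Proof.
move=> gS S0 e; split; last first.
  by apply: no_free_algebraic; rewrite e; have := good_module_no_free wc gS.
move=> zN; case/eqP: S0; apply: (good_module_eq0 wc gS) => x; rewrite -e; exact: zN.
Qed.

Lemma good_module0 x : good_module 0 x -> x = 0.
Proof.
have s0 : stable (fun y : mod_space L => y = 0).
  split; first split=> // a y z -> ->; first by rewrite scaler0 addr0.
  by move=> c y ->; rewrite linear0.
have z0 i : gens (0 : 'M[k]_p) i = 0 by rewrite /gens mul0mx genmx0.
apply: (cl_min s0) => _ [u uJ <-].
have : (u <= (0 : 'M[k]_m))%MS.
  apply: submx_trans uJ _; apply/sumsmx_subP => -[i []] _; rewrite /ends /= z0 ?mul0mx //.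
by rewrite submx0 => /eqP ->; rewrite linear0.
Qed.

Lemma good0 : (<<(0 : 'M[k]_p)>>%MS == 0) && good 0.
Proof.
rewrite genmx0 eqxx /=; apply/and3P; split.
- by apply/forallP => i; rewrite mul0mx sub0mx.
- by apply/forallP => i; rewrite !mul0mx; apply/andP; split; apply: submx_refl.
- by rewrite !big1 // => i _; rewrite !mul0mx.
Qed.

(** Summands are grouped by the submodule they generate. In each group the single [S0] of largest
    excess gives the leading power, and the rest is absorbed into [eps]. *)
Theorem expansion :
  [/\ erat q (Lambda L), finite_set (nonzero_algebraic L),
      forall N, nonzero_algebraic L N -> fin_presented (quotmod N) &
      exists eps : submodClosed L -> nat -> rat,
        (forall N, nonzero_algebraic L N -> Oq q (eps N)) /\
        forall n, (0 < n)%N ->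
          Lambda L n = q ^ (euler_char L * n%:Z)
            + \sum_(N \in nonzero_algebraic L)
                q ^ (euler_char (quotmod N) * n%:Z) * (1 + eps N n)].
Proof.
have [f hf] := modof_exists.
pose P S := ((<<S>>%MS == S) && good S) && (S != 0).
have PA S : P S -> nonzero_algebraic L (f S).
  by move=> /andP[/andP[_ gS] S0]; apply: good_module_algebraic gS S0 (hf S).
have AE : nonzero_algebraic L = f @` [set S | P S].
  apply/seteqP; split=> [N [zN algN]|_ [S PS <-]]; last exact: PA.
  have [c [_ [S0 [SS gS SN _ _]]]] := algebraic_quotient algN.
  exists S0; last by apply: carrier_inj; rewrite hf SN.
  apply/andP; split; first by rewrite SS eqxx.
  apply/eqP => S00; apply: zN => x Nx; apply: good_module0; rewrite -S00 SN; exact: Nx.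
have finA : finite_set (nonzero_algebraic L).
  by rewrite AE; apply: finite_image.
pose chiN N := euler_char (quotmod N).
pose part N n := \sum_(S | P S && (f S == N)) term S n.
split=> // [|N [_ /algebraic_quotient[c [hc _]]]|].
- exact: Lambda_erat.
- exact: has_euler_char_fin_presented hc.
(* [eps N] is defined as whatever makes the formula exact, so only its bound needs an argument. *)
exists (fun N n => part N n * q ^ (chi * n%:Z) / q ^ (chiN N * n%:Z) - 1); split.
  move=> N [zN algN]; have [c [hc [S0 [SS gS SN eS max]]]] := algebraic_quotient algN.
  have fS0 : P S0 && (f S0 == N).
    apply/andP; split; last by apply/eqP/carrier_inj; rewrite hf.
    apply/andP; split; first by rewrite SS eqxx.
    apply/eqP => S00; apply: zN => x Nx; apply: good_module0; rewrite -S00 SN; exact: Nx.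
  have q2 := card_field_ge2 k.
  have small S : (P S && (f S == N)) && (S != S0) ->
      Oq q (fun n => term S n / q ^ ((- c) * n%:Z)).
    case/andP=> /andP[/andP[/andP[/eqP SE gS'] _] /eqP fS] ne.
    by apply: (asym_small q2 (term_asym S)); apply: max; rewrite // -fS hf.
  have := term_asym S0; rewrite eS => top.
  apply: (@Oq_eq _ _ _ 0%N) (OqD top (Oq_sum (index_enum _) small)) => n _.
  rewrite /part [in RHS](bigD1 S0) //= -mulr_suml addrAC -mulrDl; congr (_ - _).
  rewrite /chiN (euler_charE hc) (mulrBl _ chi) mulNr (expfzDr (chi * n%:Z) _ q_neq0) invfM -!mulrA.
  congr (_ * _).
  by rewrite mulrA divff ?expfz_neq0 // mul1r.
move=> n n0; rewrite (euler_charE (window_euler_char wc wcl wext)) Lambda_expansion //.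
rewrite (bigD1 0 good0) /= term0 mulrDr mulr1; congr (_ + _).
rewrite (sum_fibers _ finA PA) !fsbig_finite // mulr_sumr; apply: eq_bigr => N _.
by rewrite [1 + _]addrC subrK [RHS]mulrC divfK ?expfz_neq0 // mulrC.
Qed.

End Expansion.

Theorem theorem1p1 (d : nat) (k : finFieldType)
    (L : right_module (group_alg k (free_group d))) :
  fin_presented L ->
  let q : rat := #|k|%:R in
  [/\ exists (P Q : {poly rat}) (n0 : nat), forall n, (n0 <= n)%N ->
        Q.[q ^+ n] != 0 /\ Lambda L n = P.[q ^+ n] / Q.[q ^+ n],
      finite_set (nonzero_algebraic L),
      forall N, nonzero_algebraic L N -> fin_presented (quotmod N)
    & exists eps : submodClosed L -> nat -> rat,
        (forall N, nonzero_algebraic L N ->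
           exists (C : rat) (n0 : nat), forall n, (n0 <= n)%N ->
             `|eps N n| <= C * q ^- n) /\
        exists n0 : nat, forall n, (n0 <= n)%N ->
          Lambda L n = q ^ (euler_char L * n%:Z)
            + \sum_(N \in nonzero_algebraic L)
                q ^ (euler_char (quotmod N) * n%:Z) * (1 + eps N n)].
Proof.
move=> /window_exists[m [iota [inj wcl wext]]] q.
have [D [g wc]] := window_coord_exists inj.
have [rat_ fin pres [eps [epsO epsE]]] := expansion wc wcl wext.
by split=> //; exists eps; split=> //; exists 1%N.
Qed.
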